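(* Fix a tuning parameter $\alpha\ge 0$. Consider the model, estimator and conditions described in the context. Assume that conditions (A0), (A1), (A2), (A3), (A4), (A5), (A6) and $\mathbf A_0(\Theta)$ hold, that the moment condition (M) holds with some $\epsilon>2$, and that there exists $\gamma>1$ such that $\alpha_k^{(0)}=\mathcal O(k^{-\gamma})$ and $\sum_{k\ge 1}k^{-\gamma}\max(\bar\varphi_k,\bar\psi_k)<\infty$ (where $\alpha_k^{(0)}$ are the Lipschitz coefficients in $\mathbf A_0(\Theta)$ and $\bar\varphi_k,\bar\psi_k$ are the constants in (A4), (A5)). Then the minimum density power divergence estimator satisfies $\widehat\theta_{\alpha,n}\to\theta^*$ almost surely as $n\to\infty$.
   Context: Model. Let $\{Y_t,t\in\mathbb Z\}$ be an $\mathbb N_0$-valued time series ($\mathbb N_0=\mathbb N\cup\{0\}$) and $X_t=(X_{1,t},\dots,X_{d_x,t})\in\mathbb R^{d_x}$ a vector of covariates. Let $\mathcal F_{t-1}=\sigma\{Y_{t-1},Y_{t-2},\dots;X_{t-1},X_{t-2},\dots\}$. For $\theta$ in a compact set $\Theta\subset\mathbb R^d$ let $\lambda_t(\theta)=f_\theta(Y_{t-1},Y_{t-2},\dots;X_{t-1},X_{t-2},\dots)$, where $f_\theta$ is a known (up to $\theta$) measurable non-negative function on $\mathbb N_0^{\mathbb N}\times(\mathbb R^{d_x})^{\mathbb N}$. Conditionally on $\mathcal F_{t-1}$, $Y_t$ has probability mass function $g(\cdot\mid\eta_t)$ on $\mathbb N_0$, where $\eta_t=\eta(\lambda_t(\theta^*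 ))$ for a known function $\eta$ (the natural parameter), $\theta^*\in\Theta$ is the unknown true parameter and $\mathbb E(Y_t\mid\mathcal F_{t-1})=\lambda_t(\theta^* )$. Write $\eta_t(\theta)=\eta(\lambda_t(\theta))$. The $Y_t$ have the same distribution, and the support $\{y: g(y\mid\eta_t(\theta))>0\}$ does not depend on $\theta$. Standing assumption: there is a stationary ergodic process $(Y_t,\lambda_t,X_t)$ solving the model. Norms: $\|x\|=\sup_i|x_i|$ for vectors (and any matrix norm for matrices); $\|f\|_\Theta=\sup_{\theta\in\Theta}\|f(\theta)\|$; $\|Z\|_r=(\mathbb E\|Z\|^r)^{1/r}$. Moment condition (M) with parameter $\epsilon$: there is $C>0$ with $\mathbb E\|(Y_t,\lambda_t,X_t)\|^{1+\epsilon}<C$ for all $t$. Estimator. Given observations $(Y_1,X_1),\dots,(Y_n,X_n)$, let $\widehat\lambda_t(\theta)=f_\theta(Y_{t-1},\dots,Y_1,0,0,\dots;X_{t-1},\dots,X_1,0,0,\dots)$ and $\widehat\eta_t(\theta)=\eta(\widehat\lambda_t(\theta))$. For $\alpha>0$ let $\ell_{\alpha,t}(\theta)=\sum_{y=0}^\infty g(y\mid\eta_t(\theta))^{1+\alpha}-(1+\frac1\alpha)g(Y_t\mid\eta_t(\theta))^\alpha$, and for $\alpha=0$ let $\ell_{0,t}(\theta)=-\log g(Y_t\mid\eta_t(\theta))$; $\widehat\ell_{\alpha,t}(\theta)$ is defined identically with $\eta_t(\theta)$ replaced by $\widehat\eta_t(\theta)$. Let $H_{\alpha,n}(\theta)=\frac1n\sum_{t=1}^n\ell_{\alpha,t}(\theta)$,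 $\widehat H_{\alpha,n}(\theta)=\frac1n\sum_{t=1}^n\widehat\ell_{\alpha,t}(\theta)$, and $\widehat\theta_{\alpha,n}=\operatorname{argmin}_{\theta\in\Theta}\widehat H_{\alpha,n}(\theta)$. Condition $\mathbf A_0(\Theta)$: for every $(y,x)$, $\theta\mapsto f_\theta(y,x)$ is continuous on $\Theta$, $\|f_\theta(0)\|_\Theta<\infty$, and there are non-negative $(\alpha_k^{(0)})_{k\ge1}$ with $\sum_k\alpha_k^{(0)}<1$ such that $\|f_\theta(y,x)-f_\theta(y',x')\|_\Theta\le\sum_{k\ge1}\alpha_k^{(0)}(|y_k-y'_k|+\|x_k-x'_k\|)$ for all $(y,x),(y',x')\in\mathbb N_0^{\mathbb N}\times(\mathbb R^{d_x})^{\mathbb N}$. (A0): for all $\theta,\theta'\in\Theta$, if $f_\theta(Y_{t-1},\dots;X_{t-1},\dots)=f_{\theta'}(Y_{t-1},\dots;X_{t-1},\dots)$ a.s. for some $t$ then $\theta=\theta'$; and there is $\underline c>0$ with $\inf_{\theta\in\Theta}f_\theta(y,x)\ge\underline c$ for all $(y,x)$. (A1): $\theta^*$ is an interior point of $\Theta$. (A2): there is $\underline\lambda$ with $\mathbb E\|\lambda_t(\theta)\|_\Theta^4=\underline\lambda<\infty$ for all $t\ge1$. (A3): for all $y\in\mathbb N_0$, $\eta\mapsto g(y\mid\eta)$ is twice continuously differentiable on $\mathbb R$, and if $g(y\mid\eta)=g(y\mid\eta')$ for all $y\in\mathbb N_0$ then $\eta=\eta'$. (A4): $\varphi(\eta)=\sum_{y=0}^\infty|\partial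 g(y\mid\eta)/\partial\eta|$ is well defined on $\mathbb R$ and for every $t\ge1$ there is $\bar\varphi_t>0$ with $\sup_{0\le\delta\le1}\big\|\,\|\varphi(\delta\eta_t(\theta)+(1-\delta)\widehat\eta_t(\theta))\|_\Theta\big\|_2\le\bar\varphi_t<\infty$. (A5): for all $t\ge1$, $\psi(\eta)=\big|\frac{1}{g(Y_t\mid\eta)}\frac{\partial g(Y_t\mid\eta)}{\partial\eta}\big|$ is well defined on $\mathbb R$ and there is $\bar\psi_t>0$ with $\sup_{0\le\delta\le1}\big\|\,\|\psi(\delta\eta_t(\theta)+(1-\delta)\widehat\eta_t(\theta))\|_\Theta\big\|_2\le\bar\psi_t<\infty$. (A6): $\lambda\mapsto\eta(\lambda)$, defined on $[\underline c,\infty)$, satisfies $|\eta(\lambda)-\eta(\lambda')|\le c_\eta|\lambda-\lambda'|$ for some $c_\eta>0$, and $\eta(\lambda)=\eta(\lambda')$ implies $\lambda=\lambda'$. *)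

(* Defs.v *)
From mathcomp Require Import all_boot all_order all_algebra.
From mathcomp Require Import all_classical all_reals all_analysis.
Import Order.TTheory GRing.Theory Num.Theory numFieldNormedType.Exports.

Set Implicit Arguments.
Unset Strict Implicit.
Unset Printing Implicit Defensive.

Local Open Scope ring_scope.
Local Open Scope classical_set_scope.

(* Conventions.
   - Parameters theta live in 'rV[R]_d, covariates X_t in 'rV[R]_dx; the norm
     of 'rV is the sup norm (mx_norm), as in the paper.
   - An element (y_1, y_2, ...) of N_0^N is encoded as y : nat -> nat with
     y k = y_{k+1} (0-based).  Same for (x_1, x_2, ...).
   - f : 'rV_d -> (nat -> nat) -> (nat -> 'rV_dx) -> R is f_theta(y, x).
   - The process is Y : int -> Omega -> nat, X : int -> Omega -> 'rV_dx. *)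

Section defs.
Variables (R : realType) (d dx : nat).
Variables (d0 : measure_display) (Omega : measurableType d0).

Definition model := 'rV[R]_d -> (nat -> nat) -> (nat -> 'rV[R]_dx) -> R.

Definition pastY (Y : int -> Omega -> nat) (t : int) (w : Omega) : nat -> nat :=
  fun k => Y (t - (k.+1)%:Z) w.
Definition pastX (X : int -> Omega -> 'rV[R]_dx) (t : int) (w : Omega)
  : nat -> 'rV[R]_dx := fun k => X (t - (k.+1)%:Z) w.

Definition lam (f : model) (Y : int -> Omega -> nat) (X : int -> Omega -> 'rV[R]_dx)
  (theta : 'rV[R]_d) (t : int) (w : Omega) : R :=
  f theta (pastY Y t w) (pastX X t w).

Definition lamhat (f : model) (Y : int -> Omega -> nat) (X : int -> Omega -> 'rV[R]_dx)
  (theta : 'rV[R]_d) (t : nat) (w : Omega) : R :=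
  f theta (fun k => if (k.+1 < t)%N then Y (t%:Z - (k.+1)%:Z) w else 0%N)
          (fun k => if (k.+1 < t)%N then X (t%:Z - (k.+1)%:Z) w else 0).

Definition past_sigma (Y : int -> Omega -> nat) (X : int -> Omega -> 'rV[R]_dx)
  (t : int) : set (set Omega) :=
  <<s [set A | exists s : int, s < t /\
        ((exists y : nat, A = Y s @^-1` [set y]) \/
         (exists (i : 'I_dx) (B : set R), measurable B /\
             A = (fun w => X s w 0 i) @^-1` B))] >>.

Definition path := int -> (nat * R * 'rV[R]_dx).

Definition path_sigma : set (set path) :=
  <<s [set A | exists t : int,
        (exists y : nat, A = [set p : path | (p t).1.1 = y]) \/
        (exists B : set R, measurable B /\ A = [set p : path | B (p t).1.2]) \/
        (exists (i : 'I_dx) (B : set R), measurable B /\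
             A = [set p : path | B ((p t).2 0 i)])] >>.

Definition procZ (f : model) (Y : int -> Omega -> nat) (X : int -> Omega -> 'rV[R]_dx)
  (thetas : 'rV[R]_d) (w : Omega) : path :=
  fun t => (Y t w, lam f Y X thetas t w, X t w).

Definition pshift (p : path) : path := fun t => p (t + 1).

Definition arg_sigma : set (set ((nat -> nat) * (nat -> 'rV[R]_dx))) :=
  <<s [set A | exists k : nat,
        (exists y : nat, A = [set p : (nat -> nat) * (nat -> 'rV[R]_dx) | p.1 k = y]) \/
        (exists (i : 'I_dx) (B : set R), measurable B /\
             A = [set p : (nat -> nat) * (nat -> 'rV[R]_dx) | B (p.2 k 0 i)])] >>.

(* sup over Theta, as an extended real: ||h||_Theta for h >= 0 *)
Definition supTheta (Theta : set 'rV[R]_d) (h : 'rV[R]_d -> \bar R) : \bar R :=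
  ereal_sup [set h theta | theta in Theta].

Definition dpd_loss (g : nat -> R -> R) (alpha eta : R) (y : nat) : R :=
  if alpha == 0 then - ln (g y eta)
  else \big[+%R/0%R]_(0 <= z <oo) (g z eta `^ (1 + alpha))
       - (1 + alpha^-1) * g y eta `^ alpha.

Definition Hhat (f : model) (g : nat -> R -> R) (eta : R -> R) (alpha : R)
  (Y : int -> Omega -> nat) (X : int -> Omega -> 'rV[R]_dx)
  (n : nat) (theta : 'rV[R]_d) (w : Omega) : R :=
  n%:R^-1 * \sum_(1 <= t < n.+1)
     dpd_loss g alpha (eta (lamhat f Y X theta t w)) (Y t%:Z w).

Definition phi_g (g : nat -> R -> R) (e : R) : \bar R :=
  (\sum_(y <oo) (`|derive1 (g y) e|)%:E)%E.

Definition psi_g (g : nat -> R -> R) (y : nat) (e : R) : R :=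
  `|derive1 (g y) e / g y e|.

End defs.

(* Main.v *)
Require Import Defs.
From mathcomp Require Import all_boot all_order all_algebra finmap.
From mathcomp Require Import all_classical all_reals all_analysis measurable_realfun.
From mathcomp Require Import ring lra.
Import Order.TTheory GRing.Theory Num.Theory numFieldNormedType.Exports.
Local Open Scope ring_scope.
Local Open Scope classical_set_scope.

(** Wald's argument. Write [l_t] for the loss computed from the infinite past and
    [l^_t] for the observable one.

    The increments of [ln g] and of [sum_y g(y | .)] between the two natural
    parameters are bounded by Riemann sums of [psi] and [phi] along the segment
    joining them, so AM-GM and Fatou's lemma bound the expectation of
    [sup_theta |l_t - l^_t|] by a multiple of [t^(1 - gamma) max(phibar_t, psibar_t)].
    Divided by [t] this is summable, and Kronecker's lemma shows that the average of
    the suprema vanishes almost surely; hence [l^_t] may be replaced by [l_t].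

    The mean of [l_1(theta)] is uniquely minimal at the true parameter: conditionally
    on the past, the excess is a Kullback-Leibler divergence ([alpha = 0]) or a sum of
    gaps in Young's inequality ([alpha > 0]). For [theta] different from the true
    parameter, the infimum of [min (k, l_1)] over a small ball around [theta] has by
    monotone convergence a mean which is still larger, and Birkhoff's theorem turns
    this into an almost sure inequality between the averaged losses, uniform over the
    ball. Finitely many such balls cover the complement of a neighbourhood of the true
    parameter. *)

(** * Birkhoff's ergodic theorem *)

(** Two obstacles shape the proof. The bounds on [phi_g] and [psi_g] hold in mean square for each
    fixed [delta], whereas the intermediate point of a mean value theorem would depend on the
    outcome and on the parameter. Hence the detour through Riemann sums: their nodes [i / N] are
    deterministic, and Fatou's lemma removes [N]. The other obstacle is measurability. A supremum
    over [Theta] is not known to be measurable, so the integrals of [supTheta] are read as lower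
    integrals; every supremum or infimum that has to be measurable is taken over a dense sequence
    [q] in [Theta], and continuity of the loss in the parameter recovers the other points. The
    conditional law enters as a density on the events of the past, in integrated form. The loss is
    shifted by [1 + alpha^-1] to become nonnegative, so that its mean always makes sense, infinite
    or not. The ergodic theorem is proved in a one-sided form: averages are eventually below any
    number exceeding the mean. Lower bounds follow by changing the sign of the function. *)

Section birkhoff.
Set Implicit Arguments.
Unset Strict Implicit.
Context {dT : measure_display} {T : measurableType dT} {R : realType}.
Variables (mu : probability T R) (tau : T -> T).
Hypothesis mtau : measurable_fun setT tau.
Hypothesis tau_pres : forall B, measurable B -> mu (tau @^-1` B) = mu B.
Hypothesis tau_erg : forall B, measurable B -> tau @^-1` B = B -> mu B = 0%E \/ mu B = 1%E.

Lemma integrable_preserving (h : T -> R) :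
  mu.-integrable setT (EFin \o h) -> mu.-integrable setT (EFin \o (h \o tau)).
Proof.
move=> ih; have /integrableP [mh fh] := ih.
apply/integrableP; split; first exact: (measurableT_comp mh mtau).
apply: le_lt_trans fh.
rewrite -[leLHS](ge0_integral_pushforward mtau mu measurableT
  (f := fun x => `|(h x)%:E|%E)) //; last exact: measurableT_comp.
rewrite le_eqVlt; apply/orP; left; apply/eqP.
by apply: eq_measure_integral => B mB _; rewrite /= /pushforward; exact: tau_pres.
Qed.

Lemma integral_preserving (h : T -> R) : mu.-integrable setT (EFin \o h) ->
  (\int[mu]_x (h (tau x))%:E = \int[mu]_x (h x)%:E)%E.
Proof.
move=> ih; have /integrableP [mh fh] := ih.
have := integral_pushforward mtau mh (integrable_preserving ih) measurableT.
rewrite preimage_setT => <-.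
by apply: eq_measure_integral => B mB _; rewrite /= /pushforward; exact: tau_pres.
Qed.

Variable g : T -> R.
Hypothesis ig : mu.-integrable setT (EFin \o g).

Let mg : measurable_fun setT g.
Proof. by apply/measurable_EFinP; case/integrableP : ig. Qed.

(* [M n x] is the maximum of the first [n.+1] nonempty Birkhoff sums at [x]. *)
Let M := fix M (n : nat) (x : T) : R :=
  if n is m.+1 then g x + Num.max 0 (M m (tau x)) else g x.

Let M_int n : mu.-integrable setT (EFin \o M n).
Proof.
elim: n => [//|n IH].
have mM : measurable_fun setT (M n) by apply/measurable_EFinP; case/integrableP : IH.
rewrite (_ : EFin \o _ = (EFin \o g) \+ (EFin \o (fun x => Num.max 0%R (M n (tau x)))))%E //.
apply: integrableD => //.
apply: (le_integrable measurableT _ _ (integrable_preserving IH)).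
  apply/measurable_EFinP; apply: measurable_maxr => //.
  exact: measurableT_comp.
move=> x _ /=; rewrite lee_fin; case: (lerP 0 (M n (tau x))) => // ?.
by rewrite normr0.
Qed.

Let mM n : measurable_fun setT (M n).
Proof. by apply/measurable_EFinP; case/integrableP : (M_int n). Qed.

Let M_homo n x : M n x <= M n.+1 x.
Proof.
elim: n x => [|n IH] x; first by rewrite /= lerDl le_max lexx.
rewrite [leLHS]/= [leRHS]/= lerD2l.
by rewrite ge_max !le_max lexx /= IH orbT.
Qed.

Let M_ge0 m n x : (m <= n)%N -> M m x <= M n x.
Proof.
move=> /subnK <-; elim: (n - m)%N => [//|k IH].
by rewrite addSn; apply: le_trans IH _; exact: M_homo.
Qed.

Let sum_le_M n x : \sum_(i < n.+1) g (iter i tau x) <= M n x.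
Proof.
elim: n x => [|n IH] x; first by rewrite big_ord_recl big_ord0 addr0.
rewrite big_ord_recl /= lerD2l le_max; apply/orP; right.
apply: le_trans (IH (tau x)); apply: ler_sum => i _.
by rewrite -iterSr.
Qed.

(** The outcomes whose Birkhoff sums are unbounded above. Adding or dropping one term does not
    affect unboundedness, so [A] is exactly invariant, not only up to a null set, and ergodicity
    applies to it. *)
Let A : set T := \bigcap_(K : nat) \bigcup_n [set x | K%:R < M n x].

Let mA : measurable A.
Proof.
apply: bigcap_measurable => [|K _]; first by exists 0%N.
apply: bigcup_measurable => n _.
rewrite (_ : [set x | _] = M n @^-1` `]K%:R, +oo[%classic); last first.
  by apply/seteqP; split => x /=; rewrite in_itv/= andbT.
by rewrite -[X in measurable X]setTI; apply: mM.
Qed.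

Let A_inv : tau @^-1` A = A.
Proof.
apply/seteqP; split => x Ax K _.
- have [K' KK'] : exists K' : nat, K%:R + `|g x| <= K'%:R.
    exists (Num.bound (K%:R + `|g x|)).
    by apply/ltW; rewrite archi_boundP// addr_ge0.
  have [n _ /= Kn] := Ax K' I; exists n.+1 => //=.
  have h : M n (tau x) <= Num.max 0 (M n (tau x)) by rewrite le_max lexx orbT.
  have := ler_norm (- g x); rewrite normrN; lra.
- have [K' KK'] : exists K' : nat, K%:R + `|g x| <= K'%:R.
    exists (Num.bound (K%:R + `|g x|)).
    by apply/ltW; rewrite archi_boundP// addr_ge0.
  have [[|n] _ /= Kn] := Ax K' I.
    have := ler_norm (g x); have := ler0n R K; lra.
  exists n => //=.
  have := ler_norm (g x); have := ler0n R K; move: Kn.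
  by case: (lerP 0 (M n (tau x))); lra.
Qed.

(** Where [M n (tau x)] is nonnegative, [F n x] equals [g x]; on [A] this holds for all large [n].
    Its mean is nonnegative in any case, because [M n] and its composition with [tau] have the same
    mean and [M] increases with [n]. *)
Let F n x := M n.+1 x - M n (tau x).

Let F_abs n x : `|F n x| <= `|g x| + `|g (tau x)|.
Proof.
rewrite /F /=; have : g (tau x) <= M n (tau x) by exact: (M_ge0 (tau x) (leq0n n)).
have := ler_norm (g x); have := ler_norm (- g x).
have := ler_norm (g (tau x)); have := ler_norm (- g (tau x)).
rewrite !normrN ler_norml.
by case: (lerP 0 (M n (tau x))) => *; apply/andP; split; lra.
Qed.

Let int_F_ge0 n : (0 <= \int[mu]_x (F n x)%:E)%E.
Proof.
rewrite /F.
under eq_integral do rewrite EFinB.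
rewrite integralB_EFin//; last exact: integrable_preserving (M_int n).
rewrite (integral_preserving (M_int n)).
rewrite sube_ge0//; last first.
  by rewrite (integrable_fin_num measurableT)//; exact: M_int.
apply: (le_integral measurableT (M_int n) (M_int n.+1)) => x _.
by rewrite lee_fin; exact: M_homo.
Qed.

(** Garsia's argument: were [A] of full measure, [F n] would converge to [g] almost everywhere under
    the integrable bound [F_abs], and the mean of [g] would be nonnegative. By ergodicity [A] is
    therefore null. *)
Lemma birkhoff_sum_bounded : (\int[mu]_x (g x)%:E < 0)%E ->
  {ae mu, forall x, exists K : R, forall n, \sum_(i < n) g (iter i tau x) <= K}.
Proof.
move=> g0.
have nA x : ~ A x -> exists K : R, forall n, \sum_(i < n) g (iter i tau x) <= K.
  move=> /existsNP [K] /not_implyP [_ nK]; exists K%:R => -[|n].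
    by rewrite big_ord0.
  apply: le_trans (sum_le_M n x) _; rewrite leNgt; apply/negP => KM.
  by apply: nK; exists n.
have [A0|A1] := tau_erg mA A_inv.
  exists A; split => // x /= nPx; apply: contrapT => Ax.
  by apply: nPx; exact: nA.
exfalso.
have aeA : {ae mu, forall x, A x}.
  exists (~` A); split; [exact: measurableC| |by []].
  by rewrite probability_setC// A1 subee.
have ae_cvg : {ae mu, forall x, setT x -> (F n x)%:E @[n --> \oo] --> (EFin \o g) x}.
  apply: filterS aeA => x Ax _.
  have [n _ Mn] : (\bigcup_n [set y | 0%:R < M n y]) (tau x).
    have : (tau @^-1` A) x by rewrite A_inv.
    by move=> h; exact: (h 0%N I).
  apply: cvg_near_cst; exists n => // m /= nm; congr (_%:E).
  have h := lt_le_trans Mn (M_ge0 (tau x) nm).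
  by rewrite /F /= max_r ?addrK// ltW.
have mF n : measurable_fun setT (fun x => (F n x)%:E).
  by apply/measurable_EFinP; apply: measurable_funB => //; exact: measurableT_comp.
have ibd : mu.-integrable setT (fun x => (`|g x| + `|g (tau x)|)%:E).
  have i1 : mu.-integrable setT (EFin \o (fun x => `|g x|)) by exact: integrable_norm.
  have i2 : mu.-integrable setT (EFin \o (fun x => `|g (tau x)|)).
    exact: (integrable_norm (integrable_preserving ig)).
  exact: (integrableD measurableT i1 i2).
have [_ _ Fg] := dominated_convergence measurableT mF
  (measurableT_comp (@EFin_measurable R setT) mg) ae_cvg ibd
  (aeW _ (fun x n _ => F_abs n x)).
have : (0 <= \int[mu]_x (g x)%:E)%E.
  rewrite -(cvg_lim _ Fg)//; apply: lime_ge.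
    by apply/cvg_ex; eexists; exact: Fg.
  by apply: nearW => n; exact: int_F_ge0.
by rewrite leNgt g0.
Qed.
End birkhoff.

Section birkhoff_average.
Set Implicit Arguments.
Unset Strict Implicit.

Lemma birkhoff_average_lt {dT : measure_display} {T : measurableType dT}
    {R : realType} (mu : probability T R) (tau : T -> T) (h : T -> R) (c : R) :
  measurable_fun setT tau ->
  (forall B, measurable B -> mu (tau @^-1` B) = mu B) ->
  (forall B, measurable B -> tau @^-1` B = B -> mu B = 0%E \/ mu B = 1%E) ->
  mu.-integrable setT (EFin \o h) -> (\int[mu]_x (h x)%:E < c%:E)%E ->
  {ae mu, forall x, \forall n \near \oo,
     n%:R^-1 * \sum_(i < n) h (iter i tau x) < c}.
Proof.
move=> mtau pres erg ih hc.
have hfin : (\int[mu]_x (h x)%:E)%E \is a fin_num by exact: integrable_fin_num.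
pose e := fine (\int[mu]_x (h x)%:E)%E.
have ec : e < c by rewrite -lte_fin fineK.
(* With [c'] strictly between the mean and [c], the sums of [h - c'] are bounded by some [K], and
   [K / n] finally drops below [c - c']. *)
pose c' := (e + c) / 2.
have ic : mu.-integrable setT (EFin \o cst c').
  by apply: finite_measure_integrable_cst.
have ig : mu.-integrable setT (EFin \o (fun x => h x - c')).
  exact: (integrableB measurableT ih ic).
have : (\int[mu]_x (h x - c')%:E < 0)%E.
  under eq_integral do rewrite EFinB.
  rewrite (integralB_EFin measurableT ih ic).
  have -> : (\int[mu]_x (cst c' x)%:E = c'%:E)%E.
    by rewrite -[LHS]/(\int[mu]_x (cst c'%:E) x)%E integral_cst//= probability_setT mule1.
  by rewrite -(fineK hfin) -EFinB lte_fin /c' -/e; lra.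
move/(birkhoff_sum_bounded mtau pres erg ig); apply: filterS => x [K Kx].
near=> n.
have n0 : 0 < n%:R :> R by rewrite ltr0n; near: n; exists 1%N.
rewrite ltr_pdivrMl//.
have := Kx n; rewrite sumrB sumr_const card_ord -mulr_natl => Kn.
have : K < n%:R * (c - c').
  rewrite -ltr_pdivrMr ?subr_gt0; last by rewrite /c'; lra.
  near: n; exact: nbhs_infty_gtr.
by rewrite mulrBr; lra.
Unshelve. all: by end_near. Qed.

End birkhoff_average.

(** * Real analysis *)

Section real_lemmas.
Set Implicit Arguments.
Unset Strict Implicit.
Context {R : realType}.

Lemma near_segment_unif_continuous (f : R -> R) (e : R) :
  continuous f -> 0 < e ->
  \forall N \near \oo, forall x, 0 <= x <= 1 ->
    forall y, `|y - x| <= (N : nat)%:R^-1 -> `|f y - f x| < e.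
Proof.
move=> cf e0.
have /compact_near_coveringP cpt := @segment_compact R 0 1.
have H : forall x : R, `[0, 1]%classic x -> \forall x' \near x & i \near \oo,
    forall y, `|y - x'| <= (i : nat)%:R^-1 -> `|f y - f x'| < e.
  move=> x _.
  have e2 : 0 < e / 2 by rewrite divr_gt0.
  have /cvgrPdist_lt /(_ _ e2) [d /= d0 hd] := cf x.
  have d2 : 0 < d / 2 by rewrite divr_gt0.
  exists ([set z | `|x - z| < d / 2], [set n | (n%:R^-1 : R) < d / 2]) => /=.
    split; first by exists (d / 2).
    near=> n; rewrite /= invf_plt ?posrE ?ltr0n//.
      near: n; exact: nbhs_infty_gtr.
    near: n; exists 1%N => //.
  move=> [z n] /= [xz nd] y yz.
  have hz : `|f x - f z| < e / 2 by apply: hd => /=; lra.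
  have hy : `|f x - f y| < e / 2.
    apply: hd => /=; rewrite -(subrK z x) -addrA.
    by apply: le_lt_trans (ler_normD _ _) _; rewrite (distrC z y); lra.
  rewrite -(subrK (f x) (f y)) -addrA.
  by apply: le_lt_trans (ler_normD _ _) _; rewrite distrC; lra.
have hc : \forall N \near \oo, (`[0, 1]%classic : set R) `<=`
    (fun x => forall y, `|y - x| <= (N : nat)%:R^-1 -> `|f y - f x| < e).
  by apply: cpt => x; exact: H.
apply: filterS hc => N hN x x01; apply: hN.
by rewrite /= in_itv.
Unshelve. all: by end_near. Qed.

(* A Riemann sum bound for the fundamental theorem of calculus: it only involves
   the values of the derivative at the rational points [i / N]. *)
Lemma near_increment_le_riemann_sum (F : R -> R) (e : R) :
  (forall x, derivable F x 1) -> continuous (derive1 F) -> 0 < e ->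
  \forall N \near \oo,
    `|F 1 - F 0| <= (N : nat)%:R^-1 * \sum_(i < N) `|derive1 F (i%:R / N%:R)| + e.
Proof.
move=> dF cF e0.
have := near_segment_unif_continuous cF e0; apply: filter_app.
near=> N => hN.
have N0 : 0 < N%:R :> R by rewrite ltr0n; near: N; exists 1%N.
have cont : continuous F by move=> x; exact/differentiable_continuous/derivable1_diffP.
have -> : F 1 - F 0 = \sum_(i < N) (F (i.+1%:R / N%:R) - F (i%:R / N%:R)).
  rewrite -(big_mkord xpredT (fun i => F (i.+1%:R / N%:R) - F (i%:R / N%:R))).
  by rewrite (telescope_sumr (fun i => F (i%:R / N%:R)))// mul0r divff// gt_eqF.
rewrite [X in _ + X](_ : e = N%:R^-1 * \sum_(i < N) e); last first.
  by rewrite sumr_const card_ord -[e *+ N]mulr_natl mulrA mulVf ?mul1r// gt_eqF.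
rewrite -mulrDr -big_split mulr_sumr /=.
apply: le_trans (ler_norm_sum _ _ _) _; apply: ler_sum => i _.
have iN : i%:R / N%:R < i.+1%:R / N%:R :> R.
  by rewrite ltr_pM2r ?invr_gt0// ltr_nat.
have [x xi ->] := @MVT R F (derive1 F) (i%:R / N%:R) (i.+1%:R / N%:R) iN
  (fun x _ => DeriveDef (dF x) (esym (derive1E F x))) (continuous_subspaceT cont).
rewrite -mulrBl -natrB// subSnn mul1r normrM mulrC (@ger0_norm _ N%:R^-1) ?invr_ge0 ?ler0n//.
rewrite ler_wpM2l ?invr_ge0 ?ler0n//.
have /andP[x1 x2] : i%:R / N%:R < x < i.+1%:R / N%:R by move: xi; rewrite in_itv.
have : `|derive1 F x - derive1 F (i%:R / N%:R)| < e.
  apply: hN.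
    rewrite divr_ge0 ?ler0n//= ler_pdivrMr// mul1r ler_nat; exact: ltnW.
  rewrite ger0_norm ?subr_ge0 ?(ltW x1)// lerBlDr (le_trans (ltW x2))//.
  by rewrite -[X in _ <= X + _]mul1r -mulrDl -natr1 addrC.
have := ler_distD 0 (derive1 F x) (derive1 F (i%:R / N%:R)).
have := lerB_dist (derive1 F x) (derive1 F (i%:R / N%:R)); lra.
Unshelve. all: by end_near. Qed.

End real_lemmas.

(** * Inequalities for powers and logarithms *)

Section power_lemmas.
Set Implicit Arguments.
Unset Strict Implicit.
Context {R : realType}.
Implicit Types a b c p x y : R.

Lemma ln_lt_sub1 x : 0 < x -> x != 1 -> ln x < x - 1.
Proof.
move=> x0 x1; have := @expR_gt1Dx R (ln x).
rewrite ln_eq0// x1 lnK ?posrE// => /(_ isT); lra.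
Qed.

Lemma ln_le_sub1 x : 0 < x -> ln x <= x - 1.
Proof. by move=> x0; have := @expR_ge1Dx R (ln x); rewrite lnK ?posrE//; lra. Qed.

Lemma powR_MVT a b p : 0 < a -> a < b ->
  exists2 z, a < z < b & b `^ p - a `^ p = p * z `^ (p - 1) * (b - a).
Proof.
move=> a0 ab.
have pos z : a <= z -> z \in `]0, +oo[%R.
  by move=> az; rewrite in_itv/= andbT; exact: lt_le_trans az.
have dpow z : z \in `]a, b[%R -> is_derive z 1 (fun x => x `^ p) (p * z `^ (p - 1)).
  rewrite in_itv/= => /andP[az _]; have zpos := pos z (ltW az).
  apply: DeriveDef; first exact: derivable_powR.
  by rewrite -derive1E powR_derive1.
have cpow : {within `[a, b], continuous (fun x => x `^ p)}.
  apply: continuous_in_subspaceT => z; rewrite inE/= in_itv/= => /andP[az _].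
  apply: differentiable_continuous.
  by apply/derivable1_diffP; apply: derivable_powR; exact: pos.
have [z zin ->] := MVT ab dpow cpow.
by exists z => //; move: zin; rewrite in_itv.
Qed.

Lemma powR_lipschitz a b p : 1 <= p -> 0 <= a <= 1 -> 0 <= b <= 1 ->
  `|a `^ p - b `^ p| <= p * `|a - b|.
Proof.
move=> p1; wlog ba : a b / b < a.
  move=> H a01 b01; case: (ltgtP a b) => [ab|ba|->].
  - by rewrite (distrC (a `^ p)) (distrC a b); exact: H.
  - exact: H.
  - by rewrite !subrr normr0 mulr0.
move=> /andP[a0 a1] /andP[b0 b1].
have p0 : 0 < p by lra.
rewrite (ger0_norm (x := a - b)) ?subr_ge0 ?(ltW ba)//.
rewrite ger0_norm; last first.
  by rewrite subr_ge0 ge0_ler_powR// ?nnegrE ?(ltW ba)// ltW.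
(* The mean value theorem is available for a positive left end only; at [b = 0] the claim follows
   from [a <= 1 <= p]. *)
have [b00|b00] := eqVneq b 0.
  have agt0 : 0 < a by lra.
  rewrite b00 powR0 ?gt_eqF// !subr0.
  apply: (@le_trans _ _ a); first by rewrite ge1r_powR// agt0.
  by rewrite ler_peMl.
have bgt0 : 0 < b by rewrite lt_neqAle eq_sym b00.
have [z zin ->] := powR_MVT p bgt0 ba.
rewrite ler_wpM2r ?subr_ge0 ?(ltW ba)// ler_piMr ?(ltW p0)//.
move: zin => /andP[bz za].
have : z `^ (p - 1) <= 1 `^ (p - 1).
  by apply: ge0_ler_powR; rewrite ?nnegrE ?subr_ge0//; lra.
by rewrite powR1.
Qed.

(** As a function of the logarithm a power is an exponential, which is 1-Lipschitz on the negative
    half-line. For [p < 1] powers are not Lipschitz near [0]; this is why increments of [ln g],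
    which [psi_g] controls, appear on the right. *)
Lemma powR_le_lnB a b p : 0 <= p -> 0 < a <= 1 -> 0 < b <= 1 ->
  `|a `^ p - b `^ p| <= p * `|ln a - ln b|.
Proof.
move=> p0; wlog ba : a b / b < a.
  move=> H a01 b01; case: (ltgtP a b) => [ab|ba|->].
  - by rewrite (distrC (a `^ p)) (distrC (ln a)); exact: H.
  - exact: H.
  - by rewrite !subrr normr0 mulr0.
move=> /andP[a0 a1] /andP[b0 b1].
have lnab : ln b <= ln a by rewrite ler_ln ?posrE ?(ltW ba).
have ln1 : p * ln a <= 0 by rewrite mulr_ge0_le0// ln_le0.
rewrite (ger0_norm (x := ln a - ln b)) ?subr_ge0//.
rewrite ger0_norm; last first.
  by rewrite subr_ge0 ge0_ler_powR// ?nnegrE ?(ltW ba)// ltW.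
rewrite /powR !gt_eqF//.
have -> : expR (p * ln b) = expR (p * ln a) * expR (p * ln b - p * ln a).
  by rewrite -expRD; congr expR; lra.
have := @expR_ge1Dx R (p * ln b - p * ln a).
have e1 : expR (p * ln a) <= 1 by rewrite -expR0 ler_expR.
have e2 : expR (p * ln b - p * ln a) <= 1.
  by rewrite -expR0 ler_expR subr_le0 ler_wpM2l.
have := expR_gt0 (p * ln a); nra.
Qed.

(** For positive [a] and [b], put [s = ln (b / a)]. Up to the positive factor
    [a ^ alpha * b / alpha] the gap is [exp (alpha s) + alpha exp (- s) - (1 + alpha)], and
    [1 + x < exp x] for nonzero [x] makes it positive unless [s = 0]. *)
Lemma young_gap_ge0 a b (alpha : R) : 0 < alpha -> 0 <= a -> 0 <= b ->
  0 <= a `^ (1 + alpha) + alpha^-1 * b `^ (1 + alpha)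
       - (1 + alpha^-1) * (a `^ alpha * b)
  /\ (a `^ (1 + alpha) + alpha^-1 * b `^ (1 + alpha)
       - (1 + alpha^-1) * (a `^ alpha * b) = 0 -> a = b).
Proof.
move=> al0; rewrite le_eqVlt => /predU1P[<-|a0]; rewrite le_eqVlt => /predU1P[<-|b0].
- by rewrite !powR0 ?gt_eqF//; [split=> //; lra|lra].
- rewrite !powR0 ?gt_eqF//; [|lra].
  have : 0 < alpha^-1 * b `^ (1 + alpha) by rewrite mulr_gt0 ?invr_gt0// powR_gt0.
  by split; lra.
- rewrite !powR0 ?gt_eqF//; [|lra].
  have : 0 < a `^ (1 + alpha) by rewrite powR_gt0.
  by split; lra.
have pD c : 0 < c -> c `^ (1 + alpha) = c * c `^ alpha.
  by move=> c0; rewrite powRD ?powRr1// ?ltW// (gt_eqF c0) implybT.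
have fact : a `^ (1 + alpha) + alpha^-1 * b `^ (1 + alpha)
       - (1 + alpha^-1) * (a `^ alpha * b) =
   a `^ alpha * b * alpha^-1 * ((b / a) `^ alpha + alpha * (a / b) - (1 + alpha)).
  have ai : a^-1 `^ alpha = (a `^ alpha)^-1.
    by rewrite -(powR_inv1 (ltW a0)) -powRrM mulN1r powRN.
  rewrite !pD// powRM ?invr_ge0 ?ltW// ai.
  have := powR_gt0 alpha a0; set A := a `^ alpha => A0.
  field; by rewrite !gt_eqF.
rewrite fact.
have c0 : 0 < a `^ alpha * b * alpha^-1.
  by rewrite !mulr_gt0 ?invr_gt0// powR_gt0.
set s := ln (b / a).
have e1 : (b / a) `^ alpha = expR (alpha * s).
  by rewrite /powR gt_eqF// divr_gt0.
have e2 : a / b = expR (- s).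
  by rewrite -lnV ?posrE ?divr_gt0// lnK ?posrE ?invr_gt0 ?divr_gt0// invf_div.
rewrite e1 e2.
have [s0|s0] := eqVneq s 0.
  rewrite s0 mulr0 oppr0 expR0 mulr1; split; first by rewrite subrr mulr0.
  move=> _; apply/esym/divr1_eq.
  by apply/eqP; rewrite -ln_eq0 ?divr_gt0// -/s s0.
have h1 : 1 + alpha * s < expR (alpha * s) by rewrite expR_gt1Dx// mulf_neq0// gt_eqF.
have h2 : 1 - s < expR (- s) by rewrite expR_gt1Dx// oppr_eq0.
have : 0 < a `^ alpha * b / alpha * (expR (alpha * s) + alpha * expR (- s) - (1 + alpha)).
  rewrite mulr_gt0//; nra.
by split; lra.
Qed.

Lemma continuous_powR_comp (u : R -> R) p : 0 < p -> (forall x, 0 <= u x) ->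
  continuous u -> continuous (fun x => u x `^ p).
Proof.
move=> p0 u0 cu x; have := u0 x; rewrite le_eqVlt => /predU1P[ux0|ux0]; last first.
  apply: (@continuous_comp _ _ _ u (fun z => z `^ p)); first exact: cu.
  apply: differentiable_continuous; apply/derivable1_diffP; apply: derivable_powR.
  by rewrite in_itv/= andbT.
(* Where [u] vanishes the power need not be differentiable. The radius [e ^ (1 / p)] is the number
   whose power is [e]. *)
apply/cvgrPdist_lt => e e0; rewrite -ux0 powR0 ?gt_eqF//.
have d0 : 0 < e `^ p^-1 by rewrite powR_gt0.
have /cvgrPdist_lt /(_ _ d0) := cu x; apply: filterS => y.
rewrite -ux0 !sub0r !normrN !ger0_norm ?powR_ge0// => h.
rewrite -[ltRHS]powRr1 ?ltW// -(mulVf (lt0r_neq0 p0)) powRrM.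
by rewrite gt0_ltr_powR// nnegrE ?powR_ge0.
Qed.

Lemma sum_powRN_le (gamma : R) : 1 < gamma -> exists2 K : R, 0 <= K &
  forall t m : nat, (0 < t)%N ->
    \sum_(t <= k < t + m) (k%:R : R) `^ (- gamma) <= K * t%:R `^ (1 - gamma).
Proof.
(* The mean value theorem writes [k ^ (1 - gamma) - (k + 1) ^ (1 - gamma)] as
   [(gamma - 1) z ^ (- gamma)] with [k < z < k + 1 <= 2 k]; the factor [2 ^ gamma] pays for
   replacing [z] by [k]. The differences telescope. *)
move=> g1; exists (2 `^ gamma / (gamma - 1)).
  by rewrite divr_ge0 ?powR_ge0//; lra.
set K := _ / _ => t m t0.
have K0 : 0 <= K by rewrite divr_ge0 ?powR_ge0//; lra.
have step (k : nat) : (0 < k)%N ->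
    (k%:R : R) `^ (- gamma) <= K * (k%:R `^ (1 - gamma) - k.+1%:R `^ (1 - gamma)).
  move=> k0; have kp : 0 < k%:R :> R by rewrite ltr0n.
  have kS : k%:R < k.+1%:R :> R by rewrite ltr_nat.
  have [z /andP[kz zk] e] := powR_MVT (1 - gamma) kp kS.
  have -> : k%:R `^ (1 - gamma) - k.+1%:R `^ (1 - gamma) = (gamma - 1) * z `^ (- gamma).
    move: e; rewrite -natrB ?leqnSn// subSnn mulr1 (_ : 1 - gamma - 1 = - gamma); last lra.
    by move=> e; lra.
  rewrite /K mulrA mulfVK; last by rewrite gt_eqF// subr_gt0.
  have z0 : 0 < z by lra.
  rewrite !powRN ler_pdivlMr ?powR_gt0// mulrC ler_pdivrMr ?powR_gt0//.
  rewrite -powRM ?ler0n//.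
  apply: ge0_ler_powR; rewrite ?nnegrE ?mulr_ge0 ?ler0n ?(ltW z0)//; first lra.
  apply: le_trans (ltW zk) _; rewrite -natr1.
  have : 1 <= k%:R :> R by rewrite ler1n.
  lra.
have tel : forall m, \sum_(t <= k < t + m) (k%:R : R) `^ (- gamma)
    <= K * (t%:R `^ (1 - gamma) - (t + m)%:R `^ (1 - gamma)).
  elim=> [|n IH]; first by rewrite addn0 big_geq// subrr mulr0.
  rewrite addnS big_nat_recr/= ?leq_addr//.
  have := step (t + n)%N; rewrite addn_gt0 t0/= => /(_ isT) h.
  by apply: le_trans (lerD IH h) _; rewrite -mulrDr; apply: ler_wpM2l => //; lra.
apply: le_trans (tel m) _; apply: ler_wpM2l => //.
by rewrite lerBlDr lerDl powR_ge0.
Qed.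
End power_lemmas.

(** * Series *)

Section series_lemmas.
Set Implicit Arguments.
Unset Strict Implicit.
Context {R : realType}.

(** Finite nets of radius [1 / (n + 1)] are strung together by [unpickle]; the default [x0] lies in
    [K], so every index yields a point of [K]. *)
Lemma compact_dense_sequence (X : normedModType R) (K : set X) (x0 : X) :
  compact K -> K x0 -> exists q : nat -> X, (forall i, K (q i)) /\
    forall x e, K x -> 0 < e -> exists i, ball x e (q i).
Proof.
move=> cK Kx0.
have h (n : nat) : finite_subset_cover K (fun x => (ball x n.+1%:R^-1)°) K.
  move: cK; rewrite compact_cover; apply.
  - by move=> z _; exact: open_interior.
  - move=> z Kz; exists z => //; apply: nbhsx_ballx.
    by rewrite invr_gt0 ltr0n.
have [D hD] : exists D : nat -> {fset X}, forall n, {subset D n <= K} /\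
    K `<=` cover [set` D n] (fun x => (ball x n.+1%:R^-1)°).
  have [D HD] := @choice _ _ (fun (n : nat) (E : {fset X}) => {subset E <= K} /\
    K `<=` cover [set` E] (fun x => (ball x n.+1%:R^-1)°))
    (fun n => let: ex_intro2 E EK cE := h n in ex_intro _ E (conj EK cE)).
  by exists D.
exists (fun j : nat => if @choice.unpickle (nat * nat)%type j is Some ni
  then nth x0 (D ni.1) ni.2 else x0); split.
  move=> j; case: (choice.unpickle j) => [[n i]|//] /=.
  have [iD|iD] := ltnP i (size (D n)); last by rewrite nth_default.
  have := (hD n).1 (nth x0 (D n) i); rewrite inE; apply.
  by rewrite mem_nth.
move=> x e Kx e0.
have [n ne] : exists n : nat, (n.+1%:R^-1 : R) < e.
  have [//|n] := @ltr_add_invr R 0 e _; rewrite add0r => ?; by exists n.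
have [z zD /interior_subset xz] := (hD n).2 x Kx.
exists (choice.pickle (n, index z (D n))); rewrite choice.pickleK /= nth_index//.
by apply: ball_sym; apply: le_ball xz; exact: ltW.
Qed.

(** The power sum in [dpd_loss] is a limit of reals, meaningful once convergence is known; this
    passes between it and the extended-real series that can be integrated. *)
Lemma EFin_nneseries (u : nat -> R) : (forall i, 0 <= u i) ->
  (\sum_(i <oo) (u i)%:E < +oo)%E ->
  cvgn (fun n => \sum_(0 <= i < n) u i) /\
  ((\big[+%R/0%R]_(0 <= i <oo) u i)%:E = \sum_(i <oo) (u i)%:E)%E.
Proof.
move=> u0 us.
have fs : (\sum_(i <oo) (u i)%:E)%E \is a fin_num.
  by rewrite ge0_fin_numE// nneseries_ge0// => i _ _; rewrite lee_fin.
have c : cvgn (fun n => \sum_(0 <= i < n) u i).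
  apply: nondecreasing_is_cvgn.
    by apply: nondecreasing_series => n _ _; exact: u0.
  exists (fine (\sum_(i <oo) (u i)%:E)%E) => _ [n _ <-].
  rewrite -lee_fin fineK// -sumEFin.
  by apply: nneseries_lim_ge => i _ _; rewrite lee_fin.
split => //; rewrite -EFin_lim//; congr (limn _).
by apply/funext => n /=; rewrite sumEFin.
Qed.

Lemma le_partial_nneseries (u : nat -> R) (n : nat) : (forall i, 0 <= u i) ->
  ((\sum_(0 <= i < n) u i)%:E <= \sum_(i <oo) (u i)%:E)%E.
Proof.
by move=> u0; rewrite -sumEFin; apply: nneseries_lim_ge => i _ _; rewrite lee_fin.
Qed.

Lemma nneseries_le (u : nat -> \bar R) (c : \bar R) : (forall i, 0 <= u i)%E ->
  (forall n, \sum_(0 <= i < n) u i <= c)%E -> (\sum_(i <oo) u i <= c)%E.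
Proof.
move=> u0 uc; apply: lime_le; last exact: nearW.
by apply: is_cvg_nneseries => i _ _; exact: u0.
Qed.

(* The tails of [u] are dominated by those of the series [v], which tend to
   [0] locally uniformly since the sum of [v] is constant. *)
Lemma continuous_dominated_series (u v : nat -> R -> R) :
  (forall i e, 0 <= u i e <= v i e) ->
  (forall i, continuous (u i)) -> (forall i, continuous (v i)) ->
  (forall e, \sum_(i <oo) (v i e)%:E = 1)%E ->
  continuous (fun e => \big[+%R/0%R]_(0 <= i <oo) u i e).
Proof.
move=> uv cu cv v1.
have u0 i e : 0 <= u i e by have /andP[] := uv i e.
have v0 i e : 0 <= v i e by have /andP[h1 h2] := uv i e; exact: le_trans h2.
have us e : (\sum_(i <oo) (u i e)%:E < +oo)%E.
  apply: (@le_lt_trans _ _ 1%E); last by rewrite ltry.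
  rewrite -(v1 e); apply: lee_nneseries => [i _ _|i _]; rewrite lee_fin//.
  by have /andP[] := uv i e.
have csum (w : nat -> R -> R) n : (forall i, continuous (w i)) ->
    continuous (fun e => \sum_(0 <= i < n) w i e).
  move=> cw; elim: n => [|n IH] e.
    by under eq_fun do rewrite big_geq//; exact: cvg_cst.
  under eq_fun do rewrite big_nat_recr//=.
  by apply: cvgD; [exact: IH|exact: cw].
have tail n e : \sum_(0 <= i < n) u i e <= \big[+%R/0%R]_(0 <= i <oo) u i e
    <= \sum_(0 <= i < n) u i e + (1 - \sum_(0 <= i < n) v i e).
  have [c E] := EFin_nneseries (fun i => u0 i e) (us e).
  rewrite -!lee_fin E; apply/andP; split.
    by apply: le_partial_nneseries => i; exact: u0.
  rewrite -E lee_fin; apply: limr_le => //; exists n => // k /= nk.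
  rewrite (@big_cat_nat _ _ _ n 0 k)//= lerD2l.
  apply: (@le_trans _ _ (\sum_(n <= i < k) v i e)).
    by apply: ler_sum => i _; have /andP[] := uv i e.
  have := le_partial_nneseries k (fun i => v0 i e).
  by rewrite v1 lee_fin (@big_cat_nat _ _ _ n 0 k)//=; lra.
move=> e; apply/cvgrPdist_lt => eps eps0.
have e3 : 0 < eps / 3 by rewrite divr_gt0.
have [n hn] : exists n, 1 - \sum_(0 <= i < n) v i e < eps / 3.
  have vs : (\sum_(i <oo) (v i e)%:E < +oo)%E by rewrite v1 ltry.
  have [c E] := EFin_nneseries (fun i => v0 i e) vs.
  move/cvgrPdist_lt : c => /(_ _ e3) [n _ hn]; exists n.
  apply: le_lt_trans (hn n (leqnn n)) => /=.
  move: E; rewrite v1 => -[->]; exact: ler_norm.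
have ce := csum v n cv e; have cue := csum u n cu e.
near=> y.
have h1 : `|\sum_(0 <= i < n) u i e - \sum_(0 <= i < n) u i y| < eps / 3.
  by near: y; move/cvgrPdist_lt : cue; apply.
have h2 : 1 - \sum_(0 <= i < n) v i y < eps / 3.
  near: y; have d0 : 0 < eps / 3 - (1 - \sum_(0 <= i < n) v i e) by rewrite subr_gt0.
  move/cvgrPdist_lt : ce => /(_ _ d0); apply: filterS => y.
  by move=> /ltr_normlW; lra.
have /andP[t1 t2] := tail n e; have /andP[t3 t4] := tail n y.
by move: h1; rewrite !ltr_norml => /andP[h3 h4]; apply/andP; split; lra.
Unshelve. all: by end_near. Qed.

(** For [i < n] the factor [1 / n] is at most [1 / (i + 1)]. As the terms are nonnegative, the part
    of the average beyond a fixed [T] is bounded by a tail of the convergent series, and the part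
    before [T] is a constant divided by [n]. *)
Lemma kronecker_nneseries (D : nat -> R) : (forall n, 0 <= D n) ->
  (\sum_(n <oo) (n.+1%:R^-1 * D n)%:E < +oo)%E ->
  n%:R^-1 * \sum_(0 <= i < n) D i @[n --> \oo] --> (0 : R).
Proof.
move=> D0 fin.
have u0 n : 0 <= n.+1%:R^-1 * D n by rewrite mulr_ge0 ?invr_ge0.
have [c _] := EFin_nneseries u0 fin.
apply/cvgrPdist_lt => e e0.
have e2 : 0 < e / 2 by rewrite divr_gt0.
have /cvgrPdist_lt /(_ _ e2) [T _ hT] := c.
near=> n.
have Tn : (T <= n)%N by near: n; exists T.
have n0 : 0 < n%:R :> R by rewrite ltr0n; near: n; exists 1%N.
rewrite sub0r normrN ger0_norm; last first.
  by rewrite mulr_ge0 ?invr_ge0 ?ler0n// sumr_ge0.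
rewrite (@big_cat_nat _ _ _ T 0 n)//= mulrDr.
have h1 : n%:R^-1 * \sum_(0 <= i < T) D i < e / 2.
  rewrite ltr_pdivrMl// mulrC -ltr_pdivrMl// mulrC.
  by near: n; exact: nbhs_infty_gtr.
have h2 : n%:R^-1 * \sum_(T <= i < n) D i <= \sum_(T <= i < n) i.+1%:R^-1 * D i.
  rewrite mulr_sumr !big_nat; apply: ler_sum => i /andP[_ i_n].
  by rewrite ler_wpM2r// lef_pV2 ?posrE// ler_nat.
have h3 : \sum_(T <= i < n) i.+1%:R^-1 * D i < e / 2.
  apply: le_lt_trans _ (hT T (leqnn T)).
  apply: le_trans (ler_norm _); rewrite lerBrDl.
  rewrite -(@big_cat_nat _ _ _ T 0 n)//=; apply: nondecreasing_cvgn_le => //.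
  by apply: nondecreasing_series => k _ _; exact: u0.
lra.
Unshelve. all: by end_near. Qed.
End series_lemmas.

(** * Integration *)

Section integral_lemmas.
Set Implicit Arguments.
Unset Strict Implicit.
Context {d : measure_display} {T : measurableType d} {R : realType}.

Lemma measurable_fun_nat_family (N : T -> nat) (d' : measure_display)
    (S : measurableType d') (h : nat -> T -> S) :
  (forall n, measurable (N @^-1` [set n])) ->
  (forall n, measurable_fun setT (h n)) -> measurable_fun setT (fun x => h (N x) x).
Proof.
move=> mN mh _ B mB; rewrite setTI.
rewrite (_ : _ @^-1` _ = \bigcup_n (N @^-1` [set n] `&` h n @^-1` B)).
  apply: bigcup_measurable => n _; apply: measurableI => //.
  by rewrite -[X in measurable X]setTI; exact: mh.
by apply/seteqP; split => [x /= Bx|x [n _ [/= <-]]//]; exists (N x).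
Qed.

(* The integral of a nonnegative function is a supremum over the simple
   functions below it, so no measurability is needed. *)
Lemma ge0_le_lower_integral (mu : {measure set T -> \bar R}) (f1 f2 : T -> \bar R) :
  (forall x, 0 <= f1 x)%E -> (forall x, f1 x <= f2 x)%E ->
  (\int[mu]_x f1 x <= \int[mu]_x f2 x)%E.
Proof.
move=> f0 f12; rewrite !ge0_integralTE//; last first.
  by move=> x; exact: le_trans (f12 x).
apply: le_ereal_sup => _ [h /= hf <-]; exists h => //= x.
exact: le_trans (f12 x).
Qed.

Variable mu : probability T R.
Variable C : set (set T).
Hypothesis C_meas : <<s C >> `<=` @measurable _ T.

Lemma measurable_fun_sub_sigma (d' : measure_display) (S : measurableType d')
    (F : T -> S) :
  measurable_fun (setT : set (g_sigma_algebraType C)) F -> measurable_fun setT F.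
Proof. by move=> mF _ B mB; apply: C_meas; exact: mF. Qed.

Import HBNNSimple.

(** The approximating simple functions are built on [g_sigma_algebraType C], so that their level
    sets are events of the smaller sigma-algebra, where the density identity is given; monotone
    convergence does the rest. *)
Lemma integral_sub_sigma_density (E : set T) (k : T -> R) :
  measurable E -> measurable_fun setT k -> (forall x, 0 <= k x) ->
  (forall A, <<s C >> A -> mu (A `&` E) = \int[mu]_(x in A) (k x)%:E)%E ->
  forall F : g_sigma_algebraType C -> \bar R,
  measurable_fun setT F -> (forall x, 0 <= F x)%E ->
  (\int[mu]_(x in E) F x = \int[mu]_x (F x * (k x)%:E))%E.
Proof.
move=> mE mk k0 EA F mF F0.
pose f := @nnsfun_approx _ (g_sigma_algebraType C) R setT measurableT F mF.
have mf n : measurable_fun (setT : set T) (f n).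
  by apply: (measurable_fun_sub_sigma (F := f n)); exact: measurable_funP.
have mset n y : <<s C >> (f n @^-1` [set y]).
  by have := measurable_sfunP (f n) (measurable_set1 y).
have fF x : (f n x)%:E @[n --> \oo] --> F x.
  by have := cvg_nnsfun_approx measurableT mF (fun x _ => F0 x) (x := x) I.
have f0 n x : 0 <= f n x by [].
have fnd x : {homo (fun n => f n x) : n m / (n <= m)%N >-> n <= m}.
  by move=> n m nm; exact/lefP/nd_nnsfun_approx.
have main n : (\int[mu]_(x in E) (f n x)%:E = \int[mu]_x ((f n x)%:E * (k x)%:E))%E.
  pose A y : set T := f n @^-1` [set y].
  have mA y : measurable (A y) by apply: C_meas; exact: mset.
  have fE x : (f n x)%:E = (\sum_(y \in range (f n)) y%:E * (\1_(A y) x)%:E)%E.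
    by rewrite fimfunE -fsumEFin//; apply: eq_fsbigr => y _.
  have ge0 y x : (0 <= y%:E * (\1_(A y) x)%:E)%E by rewrite nnfun_muleindic_ge0.
  have mI y : measurable_fun setT (\1_(A y) : T -> R) by exact: measurable_indic.
  under eq_integral do rewrite fE.
  rewrite (ge0_integral_fsum mu mE)//; last first.
    move=> y; apply: measurable_funTS; apply/measurable_EFinP.
    exact: measurable_funM.
  have fkE x : ((f n x)%:E * (k x)%:E =
      \sum_(y \in range (f n)) y%:E * (\1_(A y) x)%:E * (k x)%:E)%E.
    by rewrite fE ge0_mule_fsuml.
  under [RHS]eq_integral do rewrite fkE.
  rewrite (ge0_integral_fsum mu measurableT)//; last 2 first.
  - move=> y; apply: (emeasurable_funM (f := fun x => (y%:E * (\1_(A y) x)%:E)%E)).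
      by apply/measurable_EFinP; exact: measurable_funM.
    exact/measurable_EFinP.
  - by move=> y x _; rewrite mule_ge0// lee_fin.
  apply: eq_fsbigr => y; rewrite inE => -[x _ xy].
  have y0 : 0 <= y by rewrite -xy.
  have yE : (0 <= y%:E)%E by rewrite lee_fin.
  have mIE : measurable_fun (setT : set T) (fun z => (\1_(A y) z)%:E : \bar R).
    exact/measurable_EFinP.
  have I0 z : (0 <= (\1_(A y) z)%:E :> \bar R)%E by rewrite lee_fin.
  rewrite (ge0_integralZl mu mE (measurable_funTS mIE) (fun z _ => I0 z) yE).
  rewrite integral_indic// [X in (_ * X)%E = _](EA _ (mset n y)).
  under [RHS]eq_integral do rewrite -muleA.
  have mkE : measurable_fun (setT : set T) (fun z => (k z)%:E).
    exact/measurable_EFinP.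
  have Ik0 z : (0 <= (\1_(A y) z)%:E * (k z)%:E)%E by rewrite mule_ge0// lee_fin.
  rewrite (ge0_integralZl mu measurableT (emeasurable_funM mIE mkE) (fun z _ => Ik0 z) yE).
  rewrite [in LHS]integral_mkcond; congr (_ * _)%E; apply: eq_integral => z _.
  by rewrite patchE indicE; case: ifPn => _; rewrite ?mul1e ?mul0e.
transitivity (limn (fun n => \int[mu]_(x in E) (f n x)%:E)%E).
  rewrite -monotone_convergence//.
  - by apply: eq_integral => x _; apply/esym/cvg_lim.
  - by move=> n; apply/measurable_EFinP; exact: measurable_funTS.
  - by move=> n x _; rewrite lee_fin.
  - by move=> x _ n m nm; rewrite lee_fin; exact: fnd.
under eq_fun do rewrite main.
rewrite -monotone_convergence//.
- apply: eq_integral => x _; apply/cvg_lim => //.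
  by apply: cvgeZr => //; exact: fF.
- move=> n; apply/measurable_EFinP; exact: measurable_funM.
- by move=> n x _; rewrite -EFinM lee_fin mulr_ge0.
- move=> x _ n m nm; rewrite -!EFinM lee_fin ler_wpM2r//; exact: fnd.
Qed.

(** The tower property in integrated form: split the space along the values of [N] and use the
    conditional density on each piece. *)
Lemma integral_conditional_pmf (N : T -> nat) (p : nat -> T -> R)
    (F : nat -> g_sigma_algebraType C -> \bar R) :
  (forall n, measurable (N @^-1` [set n])) ->
  (forall n, measurable_fun setT (p n)) -> (forall n x, 0 <= p n x) ->
  (forall A, <<s C >> A -> forall n,
     mu (A `&` N @^-1` [set n]) = \int[mu]_(x in A) (p n x)%:E)%E ->
  (forall n, measurable_fun setT (F n)) -> (forall n x, 0 <= F n x)%E ->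
  (\int[mu]_x F (N x) x = \int[mu]_x (\sum_(n <oo) F n x * (p n x)%:E))%E.
Proof.
move=> mN mp p0 cond mF F0.
have mFT n : measurable_fun (setT : set T) (F n) by exact: measurable_fun_sub_sigma.
rewrite integral_nneseries//; last 2 first.
- by move=> n; apply: emeasurable_funM => //; exact/measurable_EFinP.
- by move=> n x _; rewrite mule_ge0// lee_fin.
have UT : \bigcup_n (N @^-1` [set n]) = setT.
  by apply/seteqP; split => // x _; exists (N x).
have tN : trivIset setT (fun n => N @^-1` [set n]).
  by apply/trivIsetP => i j _ _ ij; apply/seteqP; split => // x [/= Ni Nj];
    move: ij; rewrite -Ni -Nj eqxx.
have := @ge0_integral_bigcup _ _ _ mu (fun n => N @^-1` [set n])
  (fun x => F (N x) x) mN; rewrite UT => -> //.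
- apply: eq_eseriesr => n _.
  rewrite -(integral_sub_sigma_density (mN n) (mp n) (p0 n) (fun A CA => cond A CA n))//.
  by apply: eq_integral => x; rewrite inE => /= ->.
- exact: measurable_fun_nat_family.
Qed.

End integral_lemmas.

(** * The density power loss *)

Section increment.
Set Implicit Arguments.
Unset Strict Implicit.
Context {R : realType}.

(** The Riemann bound, moved to the segment from [e'] to [e]. The nodes become convex combinations
    with weights [i / N], the form in which the mean-square bounds on the derivatives are given. *)
Lemma near_increment_le (F : R -> R) (e e' eps : R) :
  (forall x, derivable F x 1) -> continuous (derive1 F) -> 0 < eps ->
  \forall N \near \oo, `|F e - F e'| <=
    `|e - e'| * ((N : nat)%:R^-1 * \sum_(i < N)
      `|derive1 F (i%:R / N%:R * e + (1 - i%:R / N%:R) * e')|) + eps.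
Proof.
move=> dF cF eps0.
pose p (x : R) := x * e + (1 - x) * e'.
have dp (x : R) : is_derive x 1 p (e - e').
  rewrite (_ : p = id * cst (e - e') + cst e'); last first.
    by apply/funext => z; rewrite /p/= !fctE; ring.
  apply: is_derive_eq; rewrite /GRing.scale/= /cst; ring.
have dG (x : R) : is_derive x 1 (F \o p) (derive1 F (p x) * (e - e')).
  by apply: is_derive1_comp; rewrite derive1E; exact: DeriveDef.
have G' : derive1 (F \o p) = (fun x => derive1 F (p x) * (e - e')).
  by apply/funext => x; rewrite derive1E derive_val.
have cp : continuous p.
  by move=> x; apply/differentiable_continuous/derivable1_diffP; have [] := dp x.
have cG : continuous (derive1 (F \o p)).
  rewrite G' => x; apply: cvgMl; apply: (continuous_comp (cp x)); exact: cF.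
have dG1 (x : R) : derivable (F \o p) x 1 by have [] := dG x.
apply: filterS (near_increment_le_riemann_sum dG1 cG eps0) => N.
rewrite /= /p mul1r mul0r subrr mul0r addr0 subr0 add0r mul1r G' => h.
apply: le_trans h _; rewrite lerD2r mulrCA ler_wpM2l ?invr_ge0 ?ler0n// mulr_sumr.
by apply: ler_sum => i _; rewrite normrM mulrC.
Qed.
End increment.

Section loss.
Set Implicit Arguments.
Unset Strict Implicit.
Context {R : realType}.
Variables (g : nat -> R -> R) (alpha : R).
Hypothesis alpha_ge0 : 0 <= alpha.
Hypothesis g_ge0 : forall e y, 0 <= g y e.
Hypothesis g_sum1 : forall e, (\sum_(y <oo) (g y e)%:E)%E = 1%E.
Hypothesis g_derivable : forall y e, derivable (g y) e 1.
Hypothesis g_C1 : forall y, continuous (derive1 (g y)).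

Lemma pmf_le1 y e : g y e <= 1.
Proof.
rewrite -lee_fin -(g_sum1 e); apply: le_trans (le_partial_nneseries y.+1 (g_ge0 e)).
by rewrite lee_fin big_nat_recr//= lerDr sumr_ge0.
Qed.

Lemma pmf_continuous y : continuous (g y).
Proof. by move=> e; exact/differentiable_continuous/derivable1_diffP. Qed.

Let al1_gt0 : 0 < 1 + alpha. Proof. by rewrite ltr_pwDl. Qed.

Let powS := fun e => \big[+%R/0%R]_(0 <= z <oo) (g z e `^ (1 + alpha)).

Let pow_bound y e : 0 <= g y e `^ (1 + alpha) <= g y e.
Proof.
rewrite powR_ge0/=; have := g_ge0 e y; rewrite le_eqVlt => /predU1P[<-|h].
  by rewrite powR0 ?lexx// gt_eqF.
by apply: ge1r_powR; [rewrite h pmf_le1|by rewrite lerDl].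
Qed.

Let pow_sum e : (\sum_(y <oo) (g y e `^ (1 + alpha))%:E < +oo)%E.
Proof.
apply: (@le_lt_trans _ _ 1%E); last by rewrite ltry.
rewrite -(g_sum1 e); apply: lee_nneseries => [i _ _|i _]; rewrite lee_fin//.
  exact: powR_ge0.
by have /andP[] := pow_bound i e.
Qed.

Lemma EFin_pmf_pow_sum e :
  ((powS e)%:E = \sum_(y <oo) (g y e `^ (1 + alpha))%:E)%E.
Proof. by have [_ ->] := EFin_nneseries (fun i => powR_ge0 (g i e) (1 + alpha)) (pow_sum e). Qed.

Lemma pmf_pow_sum_bounds e : 0 <= powS e <= 1.
Proof.
rewrite -!lee_fin EFin_pmf_pow_sum; apply/andP; split.
  by apply: nneseries_ge0 => i _ _; rewrite lee_fin powR_ge0.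
rewrite -(g_sum1 e); apply: lee_nneseries => [i _ _|i _]; rewrite lee_fin//.
  exact: powR_ge0.
by have /andP[] := pow_bound i e.
Qed.

Lemma pmf_pow_sum_continuous : continuous powS.
Proof.
apply: (@continuous_dominated_series _ (fun z e => g z e `^ (1 + alpha)) g) => //.
- move=> i; apply: continuous_powR_comp => //.
  exact: pmf_continuous.
- exact: pmf_continuous.
Qed.

(** One bound for both cases: since [0^-1 = 0], it reads [-1] when [alpha = 0], where the loss is
    even nonnegative. *)
Lemma dpd_loss_ge y e : - (1 + alpha^-1) <= dpd_loss g alpha e y.
Proof.
rewrite /dpd_loss; have [->|al0] := eqVneq alpha 0.
  rewrite invr0 addr0 lerN2; apply: (@le_trans _ _ 0) => //.
  by apply: ln_le0; exact: pmf_le1.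
have /andP[h _] := pmf_pow_sum_bounds e.
have : g y e `^ alpha <= 1 `^ alpha.
  by apply: ge0_ler_powR; rewrite ?nnegrE// pmf_le1.
rewrite powR1 => h1.
have : 0 <= alpha^-1 by rewrite invr_ge0.
move: h; rewrite /powS; nra.
Qed.

Lemma dpd_loss_le y e : alpha != 0 -> dpd_loss g alpha e y <= 1.
Proof.
move=> al0; rewrite /dpd_loss (negPf al0).
have /andP[_ h] := pmf_pow_sum_bounds e.
have := powR_ge0 (g y e) alpha; have : 0 <= alpha^-1 by rewrite invr_ge0.
move: h; rewrite /powS; nra.
Qed.

Lemma dpd_loss_continuous y : (forall e, g y e != 0) ->
  continuous (fun e => dpd_loss g alpha e y).
Proof.
move=> gn0; rewrite /dpd_loss; have [al0|al0] := eqVneq alpha 0.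
  move=> e; apply: cvgN.
  apply: (@continuous_comp _ _ _ (g y) (@ln R)); first exact: pmf_continuous.
  by apply: continuous_ln; rewrite lt_neqAle eq_sym gn0 g_ge0.
move=> e; apply: cvgB; first exact: pmf_pow_sum_continuous.
apply: cvgM; first exact: cvg_cst.
apply: continuous_powR_comp => //; last exact: pmf_continuous.
by rewrite lt_neqAle eq_sym al0.
Qed.

Lemma dpd_loss_measurable y : measurable_fun setT (fun e => dpd_loss g alpha e y).
Proof.
have mg : measurable_fun setT (g y).
  by apply: continuous_measurable_fun; exact: pmf_continuous.
rewrite /dpd_loss; case: eqP => _.
  by apply: measurable_funN; exact: measurableT_comp.
apply: measurable_funB.
  by apply: continuous_measurable_fun; exact: pmf_pow_sum_continuous.
apply: measurable_funM => //.
exact: (measurableT_comp (measurable_powR alpha) mg).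
Qed.

(** The power sum moves by at most [(1 + alpha) * B1], because the exponent [1 + alpha] is at least
    [1]. The power at the observed value moves by at most [alpha * B2], and its coefficient
    [1 + alpha^-1] turns this into [(1 + alpha) * B2]. The constant stays bounded as [alpha] tends
    to [0]. *)
Lemma dpd_loss_dist_le y e e' B1 B2 : (forall e, g y e != 0) ->
  (forall M, \sum_(0 <= z < M) `|g z e - g z e'| <= B1) ->
  `|ln (g y e) - ln (g y e')| <= B2 ->
  `|dpd_loss g alpha e y - dpd_loss g alpha e' y| <= (1 + alpha) * (B1 + B2).
Proof.
move=> gn0 H1 H2.
have B10 : 0 <= B1 by have := H1 0%N; rewrite big_geq.
have B20 : 0 <= B2 by exact: le_trans H2.
have gp u : 0 < g y u <= 1 by rewrite pmf_le1 andbT lt_neqAle eq_sym gn0 g_ge0.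
rewrite /dpd_loss; have [al0|al0] := eqVneq alpha 0.
  by rewrite al0 addr0 mul1r -opprD normrN; lra.
have alp : 0 < alpha by rewrite lt_neqAle eq_sym al0.
have h1 : `|powS e - powS e'| <= (1 + alpha) * B1.
  have c u : cvgn (fun n => \sum_(0 <= z < n) g z u `^ (1 + alpha)).
    by have [] := EFin_nneseries (fun i => powR_ge0 (g i u) (1 + alpha)) (pow_sum u).
  have cB : (\sum_(0 <= z < n) g z e `^ (1 + alpha)) -
      \sum_(0 <= z < n) g z e' `^ (1 + alpha) @[n --> \oo] --> powS e - powS e'.
    by apply: cvgB; exact: c.
  have bd n : `|(\sum_(0 <= z < n) g z e `^ (1 + alpha)) -
      \sum_(0 <= z < n) g z e' `^ (1 + alpha)| <= (1 + alpha) * B1.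
    rewrite -sumrB; apply: le_trans (ler_norm_sum _ _ _) _.
    apply: le_trans (ler_wpM2l (ltW al1_gt0) (H1 n)).
    rewrite mulr_sumr; apply: ler_sum => z _.
    by apply: powR_lipschitz; rewrite ?g_ge0 ?pmf_le1 ?lerDl.
  rewrite -(cvg_lim (@Rhausdorff R) cB) ler_norml.
  have cB' := cvgP _ cB.
  by apply/andP; split; [apply: (limr_ge cB')|apply: (limr_le cB')];
    exists 0%N => // n _; have := bd n; rewrite ler_norml => /andP[].
have h2 : `|g y e `^ alpha - g y e' `^ alpha| <= alpha * B2.
  by apply: le_trans (powR_le_lnB alpha_ge0 (gp e) (gp e')) _; rewrite ler_wpM2l.
rewrite -/powS.
have -> : powS e - (1 + alpha^-1) * g y e `^ alpha -
   (powS e' - (1 + alpha^-1) * g y e' `^ alpha) =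
   (powS e - powS e') - (1 + alpha^-1) * (g y e `^ alpha - g y e' `^ alpha) by ring.
apply: le_trans (ler_normB _ _) _; rewrite normrM mulrDr.
apply: lerD => //.
have ap : 0 < 1 + alpha^-1 by rewrite addr_gt0// invr_gt0.
rewrite gtr0_norm// -ler_pdivlMl//; apply: le_trans h2 _.
rewrite ler_pdivlMl// mulrA mulrDl mul1r mulVf//; lra.
Qed.

(** The mesh from which the Riemann bound holds depends on the value [z], so finitely many values
    are treated at once; halving [eps] pays for one more value. *)
Lemma near_pmf_increment_le (M : nat) (e e' eps : R) : 0 < eps ->
  \forall N \near \oo, \sum_(0 <= z < M) `|g z e - g z e'| <=
    `|e - e'| * ((N : nat)%:R^-1 * \sum_(i < N)
      \sum_(0 <= z < M) `|derive1 (g z) (i%:R / N%:R * e + (1 - i%:R / N%:R) * e')|) + eps.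
Proof.
elim: M eps => [|M IH] eps eps0.
  apply: nearW => N; rewrite big_geq//.
  rewrite addr_ge0 ?(ltW eps0)// mulr_ge0// mulr_ge0 ?invr_ge0 ?ler0n//.
  by apply: sumr_ge0 => i _; rewrite big_geq.
have e2 : 0 < eps / 2 by rewrite divr_gt0.
near=> N; rewrite big_nat_recr//=.
under [X in _ <= _ * (_ * X) + _]eq_bigr do rewrite big_nat_recr//=.
rewrite big_split/= !mulrDr (splitr eps) addrACA; apply: lerD.
  by near: N; exact: IH.
by near: N; apply: near_increment_le => //; exact: g_C1.
Unshelve. all: by end_near. Qed.

Lemma near_ln_pmf_increment_le (y : nat) (e e' eps : R) :
  (forall e, g y e != 0) -> 0 < eps ->
  \forall N \near \oo, `|ln (g y e) - ln (g y e')| <=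
    `|e - e'| * ((N : nat)%:R^-1 * \sum_(i < N)
      psi_g g y (i%:R / N%:R * e + (1 - i%:R / N%:R) * e')) + eps.
Proof.
move=> gn0 eps0.
have gp x : 0 < g y x by rewrite lt_neqAle eq_sym gn0 g_ge0.
have dL (x : R) : is_derive x 1 (@ln R \o g y) ((g y x)^-1 * derive1 (g y) x).
  apply: is_derive1_comp; first exact: is_derive1_ln.
  by rewrite derive1E; exact: DeriveDef.
have L' : derive1 (@ln R \o g y) = (fun x => (g y x)^-1 * derive1 (g y) x).
  by apply/funext => x; rewrite derive1E derive_val.
have cL : continuous (derive1 (@ln R \o g y)).
  rewrite L' => x; apply: cvgM; last exact: g_C1.
  by apply: cvgV; [exact: gn0|exact: pmf_continuous].
have dL1 (x : R) : derivable (@ln R \o g y) x 1 by have [] := dL x.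
have := near_increment_le e e' dL1 cL eps0; apply: filterS => N.
by rewrite L' /psi_g; under eq_bigr do rewrite mulrC.
Qed.

End loss.

Section liminf.
Set Implicit Arguments.
Unset Strict Implicit.
Context {R : realType}.

Lemma limn_einf_ge (u : nat -> \bar R) (x : \bar R) :
  (\forall n \near \oo, x <= u n)%E -> (x <= limn_einf u)%E.
Proof.
move=> [N _ xu]; rewrite limn_einf_lim; apply: lime_ge; first exact: is_cvg_einfs.
exists N => // n /= Nn; apply: le_ereal_inf_tmp => _ [k /= nk <-].
by apply: xu => /=; exact: leq_trans nk.
Qed.

(** Termwise [w U <= s U^2 / 2 + w^2 / (2 s)]. This separates the distance between the natural
    parameters, bounded by the series of [a U], from the size [w] of the derivatives: both are
    random, possibly dependent, and controlled in mean square. The weight [s] is left free to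
    balance the two. *)
Lemma weighted_AMGM_nneseries (a U : nat -> R) (A s w x : R) :
  (forall k, 0 <= a k) -> (forall k, 0 <= U k) -> 0 < s -> 0 <= w ->
  (\sum_(k <oo) (a k)%:E = A%:E)%E ->
  (x%:E <= \sum_(k <oo) (a k * U k)%:E)%E ->
  ((x * w)%:E <= (s / 2)%:E * \sum_(k <oo) (a k * U k ^+ 2)%:E
     + (A * w ^+ 2 / (2 * s))%:E)%E.
Proof.
move=> a0 U0 s0 w0 aA xU.
have s2 : 0 <= s / 2 by rewrite divr_ge0// ltW.
have ws0 : 0 <= w ^+ 2 / (2 * s).
  by rewrite divr_ge0 ?sqr_ge0// mulr_ge0// ltW.
apply: (@le_trans _ _ (w%:E * \sum_(k <oo) (a k * U k)%:E)%E).
  by rewrite mulrC EFinM lee_wpmul2l// lee_fin.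
rewrite -nneseriesZl; last by move=> k _; rewrite lee_fin mulr_ge0.
have -> : ((A * w ^+ 2 / (2 * s))%:E = (w ^+ 2 / (2 * s))%:E * A%:E :> \bar R)%E.
  by rewrite -EFinM -mulrA mulrC.
rewrite -aA -nneseriesZl; last by move=> k _; rewrite lee_fin mulr_ge0// sqr_ge0.
rewrite -nneseriesZl; last by move=> k _; rewrite lee_fin.
rewrite -nneseriesD; last 2 first.
- by move=> k _ _; rewrite -EFinM lee_fin mulr_ge0// mulr_ge0// sqr_ge0.
- by move=> k _ _; rewrite -EFinM lee_fin mulr_ge0.
apply: lee_nneseries => [k _ _|k _]; first by rewrite -EFinM lee_fin !mulr_ge0.
rewrite -!EFinM -EFinD lee_fin.
have -> : s / 2 * (a k * U k ^+ 2) + w ^+ 2 / (2 * s) * a k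
  = a k * (w * U k + (s * U k - w) ^+ 2 / (2 * s)).
  by field; rewrite gt_eqF.
by rewrite mulrCA ler_wpM2l// lerDl divr_ge0 ?sqr_ge0// mulr_ge0// ltW.
Qed.
End liminf.

(** * A bound on the change of the loss that is uniform in the parameter *)

Section loss_bound.
Set Implicit Arguments.
Unset Strict Implicit.
Context {R : realType}.
Variables (g : nat -> R -> R) (alpha : R).
Hypothesis alpha_ge0 : 0 <= alpha.
Hypothesis g_ge0 : forall e y, 0 <= g y e.
Hypothesis g_sum1 : forall e, (\sum_(y <oo) (g y e)%:E)%E = 1%E.
Hypothesis g_derivable : forall y e, derivable (g y) e 1.
Hypothesis g_C1 : forall y, continuous (derive1 (g y)).

(** The right-hand side contains only the majorants [U], [Phi] and [Psi], not [e] and [e'], so that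
    one bound serves all parameters. The limit inferior allows the error [eps] of the Riemann sums
    to be sent to [0] and has the form required by Fatou's lemma. *)
Lemma dpd_loss_dist_le_liminf (y : nat) (e e' c s A : R) (a U : nat -> R)
    (Phi Psi : R -> \bar R) :
  (forall x, g y x != 0) -> 0 < c -> 0 < s ->
  (forall k, 0 <= a k) -> (forall k, 0 <= U k) ->
  (\sum_(k <oo) (a k)%:E = A%:E)%E ->
  ((`|e - e'|%R)%:E <= c%:E * \sum_(k <oo) (a k * U k)%:E)%E ->
  (forall dl, 0 <= dl <= 1 ->
    (phi_g g (dl * e + (1 - dl) * e') <= Phi dl)%E /\
    ((psi_g g y (dl * e + (1 - dl) * e'))%:E <= Psi dl)%E) ->
  ((`|dpd_loss g alpha e y - dpd_loss g alpha e' y|%R)%:E <=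
    limn_einf (fun N : nat => ((1 + alpha) * c * N%:R^-1)%:E * \sum_(i < N)
      ((s / 2)%:E * \sum_(k <oo) (a k * U k ^+ 2)%:E +
       (A / s)%:E * (Phi (i%:R / N%:R)%R ^+ 2 + Psi (i%:R / N%:R)%R ^+ 2))))%E.
Proof.
move=> gn0 c0 s0 a0 U0 aA eU H.
set S := (\sum_(k <oo) (a k * U k ^+ 2)%:E)%E.
pose B (i N : nat) : \bar R := ((s / 2)%:E * S +
  (A / s)%:E * (Phi (i%:R / N%:R)%R ^+ 2 + Psi (i%:R / N%:R)%R ^+ 2))%E.
set u : nat -> \bar R := fun N => (((1 + alpha) * c * N%:R^-1)%:E * \sum_(i < N) B i N)%E.
rewrite -[X in limn_einf X]/u.
have al0 : 0 < 1 + alpha by rewrite ltr_pwDl.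
have A0 : 0 <= A.
  by rewrite -lee_fin -aA; apply: nneseries_ge0 => k _ _; rewrite lee_fin.
have B0 i N : (0 <= B i N)%E.
  rewrite /B adde_ge0// mule_ge0 ?lee_fin ?divr_ge0 ?(ltW s0)//.
    by apply: nneseries_ge0 => k _ _; rewrite lee_fin mulr_ge0// sqr_ge0.
  by rewrite adde_ge0// sqre_ge0.
have main M eps : 0 < eps ->
  (((1 + alpha) * (\sum_(0 <= z < M) `|g z e - g z e'|
     + `|ln (g y e) - ln (g y e')| - eps))%:E <= limn_einf u)%E.
  move=> eps0; apply: limn_einf_ge.
  have e2 : 0 < eps / 2 by rewrite divr_gt0.
  near=> N.
  have h1 : \sum_(0 <= z < M) `|g z e - g z e'| <=
    `|e - e'| * ((N : nat)%:R^-1 * \sum_(i < N)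
      \sum_(0 <= z < M) `|derive1 (g z) (i%:R / N%:R * e + (1 - i%:R / N%:R) * e')|) + eps / 2.
    by near: N; exact: near_pmf_increment_le.
  have h2 : `|ln (g y e) - ln (g y e')| <=
    `|e - e'| * ((N : nat)%:R^-1 * \sum_(i < N)
      psi_g g y (i%:R / N%:R * e + (1 - i%:R / N%:R) * e')) + eps / 2.
    by near: N; exact: near_ln_pmf_increment_le.
  have N0 : (0 < N)%N by near: N; exists 1%N.
  have -> : (u N = (1 + alpha)%:E * ((N%:R^-1)%:E * (c%:E * \sum_(i < N) B i N)))%E.
    by rewrite /u !muleA -!EFinM mulrAC.
  rewrite EFinM lee_wpmul2l ?lee_fin ?(ltW al0)//.
  pose w (i : nat) := \sum_(0 <= z < M) `|derive1 (g z) (i%:R / N%:R * e + (1 - i%:R / N%:R) * e')|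
      + psi_g g y (i%:R / N%:R * e + (1 - i%:R / N%:R) * e').
  apply: (@le_trans _ _ (N%:R^-1 * \sum_(i < N) `|e - e'| * w i)%:E).
    rewrite lee_fin -mulr_sumr mulrCA /w big_split/= 2!mulrDr; lra.
  rewrite EFinM lee_wpmul2l ?lee_fin ?invr_ge0 ?ler0n//.
  rewrite ge0_sume_distrr; last by move=> i _; exact: B0.
  rewrite -sumEFin; apply: lee_sum => i _.
  have iN : 0 <= (i%:R / N%:R : R) <= 1.
    by rewrite divr_ge0 ?ler0n//= ler_pdivrMr ?ltr0n// mul1r ler_nat ltnW.
  have [hp hs] := H _ iN.
  have hph : ((\sum_(0 <= z < M) `|derive1 (g z) (i%:R / N%:R * e + (1 - i%:R / N%:R) * e')|)%:E
      <= Phi (i%:R / N%:R)%R)%E.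
    by apply: le_trans hp; exact: le_partial_nneseries.
  move: hph hs; rewrite /w.
  set ph := \sum_(0 <= z < M) _; set ps := psi_g g y _ => hph hs.
  have ph0 : 0 <= ph by exact: sumr_ge0.
  have ps0 : 0 <= ps by rewrite /ps /psi_g.
  have c0' : (0 <= c%:E)%E by rewrite lee_fin ltW.
  have eU' : ((`|e - e'|%R / c)%:E <= \sum_(k <oo) (a k * U k)%:E)%E.
    rewrite -(@lee_pmul2l _ c%:E) ?lte_fin// -EFinM mulrC divfK//.
    by rewrite gt_eqF.
  rewrite (_ : `|e - e'| * (ph + ps) = c * (`|e - e'| / c * (ph + ps))); last first.
    by field; rewrite gt_eqF.
  rewrite EFinM lee_wpmul2l//.
  have phs0 : 0 <= ph + ps by rewrite addr_ge0.
  apply: le_trans (weighted_AMGM_nneseries a0 U0 s0 phs0 aA eU') _.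
  rewrite -/S leeD2l//.
  (* Here [(ph + ps)^2 <= 2 (ph^2 + ps^2)] uses up the [2] in the denominator [2 * s]. *)
  apply: (@le_trans _ _ ((A / s) * (ph ^+ 2 + ps ^+ 2))%:E).
    rewrite lee_fin invfM (mulrC 2^-1) mulrA (mulrAC A) -!mulrA ler_wpM2l//.
    rewrite ler_wpM2l ?invr_ge0 ?(ltW s0)//.
    have := sqr_ge0 (ph - ps); lra.
  rewrite EFinM lee_wpmul2l ?lee_fin ?divr_ge0 ?(ltW s0)//.
  have ph0' : (0 <= ph%:E)%E by rewrite lee_fin.
  have ps0' : (0 <= ps%:E)%E by rewrite lee_fin.
  rewrite EFinD leeD// EFin_expe lee_sqr//.
    exact: le_trans hph.
  exact: le_trans hs.
have L0 : (0 <= limn_einf u)%E.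
  apply: limn_einf_ge; apply: nearW => N; rewrite mule_ge0//.
    by rewrite lee_fin !mulr_ge0 ?invr_ge0 ?ler0n// ltW.
  by apply: sume_ge0 => i _; exact: B0.
have [->|Lfin] := eqVneq (limn_einf u) +oo%E; first by rewrite leey.
have {Lfin}/fineK Lr : limn_einf u \is a fin_num.
  by rewrite ge0_fin_numE// ltey.
rewrite -Lr lee_fin; set L := fine _ in Lr *.
have main' M : \sum_(0 <= z < M) `|g z e - g z e'| + `|ln (g y e) - ln (g y e')|
    <= L / (1 + alpha).
  apply/ler_addgt0Pr => eps eps0; rewrite -lerBlDr ler_pdivlMr// mulrC.
  by rewrite -lee_fin Lr; exact: main.
(* The budget [L / (1 + alpha)] is divided exactly: the increment of the logarithm takes its own
   size, and the remainder bounds all partial sums of the other increments. *)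
have := @dpd_loss_dist_le _ g alpha alpha_ge0 g_ge0 g_sum1 y e e'
  (L / (1 + alpha) - `|ln (g y e) - ln (g y e')|) (`|ln (g y e) - ln (g y e')|) gn0.
rewrite subrK (mulrC (1 + alpha)) divfK ?gt_eqF//; apply => // M.
by rewrite lerBrDr.
Unshelve. all: by end_near. Qed.

End loss_bound.

(** * Measurability of the model *)

Section measurability_lemmas.
Set Implicit Arguments.
Unset Strict Implicit.
Context {R : realType} {d dx : nat}.

Lemma dense_sequence_le (X : pseudoMetricType R) (K : set X) (q : nat -> X)
    (h : X -> R) (c : R) :
  (forall i, K (q i)) ->
  (forall x e, K x -> 0 < e -> exists i, ball x e (q i)) ->
  {within K, continuous h} -> (forall i, h (q i) <= c) ->
  forall x, K x -> h x <= c.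
Proof.
move=> Kq dq ch hq x Kx; rewrite leNgt; apply/negP => cx.
have /cvgrPdist_lt /(_ (h x - c)) := (subspace_continuousP _ _).1 ch x Kx.
rewrite subr_gt0 => /(_ cx) /nbhs_ballP [e /= e0 he].
have [i xi] := dq x e Kx e0.
have /= /ltr_normlW := he _ xi (Kq i); rewrite ltrD2l ltrN2.
by move=> /lt_le_trans /(_ (hq i)); rewrite ltxx.
Qed.

Lemma measurable_rV_norm (dT : measure_display) (T : measurableType dT)
    (V : T -> 'rV[R]_dx) : (forall i, measurable_fun setT (fun w => V w 0 i)) ->
  measurable_fun setT (fun w => `|V w|).
Proof.
move=> mV.
have E w : `|V w| = \big[Num.max/0]_ij `|V w ij.1 ij.2| := mx_normrE (V w).
under eq_fun do rewrite E.
elim: (index_enum _) => [|i s IH].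
  by under eq_fun do rewrite big_nil; exact: measurable_cst.
under eq_fun do rewrite big_cons.
apply: measurable_maxr => //.
rewrite (ord1 i.1).
by apply: measurableT_comp => //; exact: mV.
Qed.

(** The generators of [arg_sigma], named so that [g_sigma_algebraType] turns the argument space into
    a measurable type. [past_gen] and [path_gen] do the same for [past_sigma] and [path_sigma]. *)
Definition arg_gen : set (set ((nat -> nat) * (nat -> 'rV[R]_dx))) :=
  [set A | exists k : nat,
        (exists y : nat, A = [set p : (nat -> nat) * (nat -> 'rV[R]_dx) | p.1 k = y]) \/
        (exists (i : 'I_dx) (B : set R), measurable B /\
           A = [set p : (nat -> nat) * (nat -> 'rV[R]_dx) | B (p.2 k 0 i)])].

Lemma measurable_model (dT : measure_display) (T : measurableType dT)
    (u : T -> nat -> nat) (v : T -> nat -> 'rV[R]_dx)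
    (F : (nat -> nat) -> (nat -> 'rV[R]_dx) -> R) :
  (forall B : set R, measurable B -> @arg_sigma R dx ((fun p => F p.1 p.2) @^-1` B)) ->
  (forall k y, measurable [set w | u w k = y]) ->
  (forall k i, measurable_fun setT (fun w => v w k 0 i)) ->
  measurable_fun setT (fun w => F (u w) (v w)).
Proof.
move=> mF mu mv.
have m1 : @measurable_fun _ _ T (g_sigma_algebraType arg_gen) setT (fun w => (u w, v w)).
  apply: (@measurability _ _ T (g_sigma_algebraType arg_gen) setT _ arg_gen) => //.
  move=> _ [A [k [[y ->]|[i [B [mB ->]]]]] <-]; rewrite setTI.
    exact: mu.
  by have := mv k i measurableT B mB; rewrite setTI.
have m2 : measurable_fun (setT : set (g_sigma_algebraType arg_gen)) (fun p => F p.1 p.2).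
  by move=> _ B mB; rewrite setTI; exact: mF.
exact: (measurableT_comp m2 m1).
Qed.

(** The link function is controlled only above [cl]. Truncating its argument there gives a
    continuous function on the whole line that agrees with it at all values of the model. *)
Lemma lipschitz_max_continuous (h : R -> R) (c l : R) : 0 < c ->
  (forall x y, l <= x -> l <= y -> `|h x - h y| <= c * `|x - y|) ->
  continuous (fun x => h (Num.max l x)).
Proof.
move=> c0 hl x; apply/cvgrPdist_lt => e e0.
have d0 : 0 < e / c by rewrite divr_gt0.
exists (e / c) => //= y xy; apply: le_lt_trans (hl _ _ _ _) _; rewrite ?le_max ?lexx//.
rewrite mulrC -ltr_pdivlMr//; apply: le_lt_trans xy.
by case: (leP l x) => ?; case: (leP l y) => ?; rewrite ?subrr ?normr0 ?normr_ge0//;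
  rewrite !ler_norml; apply/andP; split; have := ler_norm (x - y);
  have := ler_norm (y - x); rewrite (distrC y x); lra.
Qed.

End measurability_lemmas.

Section process.
Set Implicit Arguments.
Unset Strict Implicit.
Context {R : realType} {d dx : nat} {d0 : measure_display} {Omega : measurableType d0}.
Variables (P : probability Omega R) (Theta : set 'rV[R]_d) (f : model R d dx)
  (Y : int -> Omega -> nat) (X : int -> Omega -> 'rV[R]_dx) (cl : R) (eta : R -> R)
  (ceta : R).
Hypothesis f_meas : forall th, Theta th -> forall B : set R, measurable B ->
  @arg_sigma R dx ((fun p => f th p.1 p.2) @^-1` B).
Hypothesis Y_meas : forall t y, measurable (Y t @^-1` [set y]).
Hypothesis X_meas : forall t (i : 'I_dx), measurable_fun setT (fun w => X t w 0 i).
Hypothesis f_ge : forall th y x, Theta th -> cl <= f th y x.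
Hypothesis ceta_gt0 : 0 < ceta.
Hypothesis eta_lip : forall l l', cl <= l -> cl <= l' ->
  `|eta l - eta l'| <= ceta * `|l - l'|.

Definition past_gen (t : int) : set (set Omega) :=
  [set A | exists s : int, s < t /\
        ((exists y : nat, A = Y s @^-1` [set y]) \/
         (exists (i : 'I_dx) (B : set R), measurable B /\
             A = (fun w => X s w 0 i) @^-1` B))].

Lemma past_gen_measurable t : <<s past_gen t >> `<=` @measurable _ Omega.
Proof.
apply: smallest_sub; first exact: sigma_algebra_measurable.
move=> A [s [_ [[y ->]|[i [B [mB ->]]]]]]; first exact: Y_meas.
by rewrite -[X in measurable X]setTI; exact: X_meas.
Qed.

Lemma link_comp_measurable (dS : measure_display) (S : measurableType dS) (h : S -> R) :
  measurable_fun setT h -> (forall x, cl <= h x) ->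
  measurable_fun setT (fun x => eta (h x)).
Proof.
move=> mh hcl.
rewrite (_ : (fun x => _) = (fun x => eta (Num.max cl (h x)))); last first.
  by apply/funext => x; rewrite max_r.
apply: (measurableT_comp (f := fun x => eta (Num.max cl x))) => //.
exact: continuous_measurable_fun (lipschitz_max_continuous ceta_gt0 eta_lip).
Qed.

Lemma lam_past_measurable th t : Theta th ->
  measurable_fun (setT : set (g_sigma_algebraType (past_gen t))) (lam f Y X th t).
Proof.
move=> Tth; apply: measurable_model; first exact: f_meas.
- move=> k y; rewrite -[measurable _]/(<<s past_gen t >> (Y (t - k.+1%:Z) @^-1` [set y])).
  apply: sub_gen_smallest; exists (t - k.+1%:Z); split; last by left; exists y.
  by rewrite gtrDl oppr_lt0.
- move=> k i _ B mB; rewrite setTI.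
  rewrite -[measurable _]/(<<s past_gen t >> ((fun w => X (t - k.+1%:Z) w 0 i) @^-1` B)).
  apply: sub_gen_smallest; exists (t - k.+1%:Z); split; last by right; exists i, B.
  by rewrite gtrDl oppr_lt0.
Qed.

Lemma lam_measurable th t : Theta th -> measurable_fun setT (lam f Y X th t).
Proof.
move=> Tth; apply: measurable_fun_sub_sigma (lam_past_measurable Tth).
exact: past_gen_measurable.
Qed.

Lemma lamhat_measurable th t : Theta th -> measurable_fun setT (lamhat f Y X th t).
Proof.
move=> Tth; apply: measurable_model; first exact: f_meas.
- move=> k y; case: (k.+1 < t)%N; first exact: Y_meas.
  have [<-|y0] := eqVneq 0%N y.
    by rewrite (_ : [set w | _] = setT)//; apply/seteqP; split.
  by rewrite (_ : [set w | _] = set0)//; apply/seteqP; split => // w /= /eqP; rewrite (negPf y0).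
- move=> k i; case: (k.+1 < t)%N; first exact: X_meas.
  exact: measurable_cst.
Qed.

End process.

(** * Moments and tails *)

Section moments.
Set Implicit Arguments.
Unset Strict Implicit.
Context {R : realType} {d0 : measure_display} {Omega : measurableType d0}.
Variable (P : probability Omega R).

Lemma square_moment_bound (V W : Omega -> R) (C eps : R) :
  2 < eps -> measurable_fun setT V -> (forall w, 0 <= V w <= 2 * W w) ->
  (\int[P]_w (W w `^ (1 + eps))%:E < C%:E)%E ->
  (\int[P]_w (V w ^+ 2)%:E <= (4 * (1 + C))%:E)%E.
Proof.
move=> eps2 mV VW WC.
(* [W] carries no measurability, so its moment bound is first handed down to the measurable function
   [V / 2], which lies below it. *)
pose V2 w := (V w / 2) `^ (1 + eps).
have V2W : (\int[P]_w (V2 w)%:E <= C%:E)%E.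
  apply: le_trans (ltW WC); apply: ge0_le_lower_integral => w.
    by rewrite lee_fin powR_ge0.
  have /andP[V0 VWw] := VW w.
  rewrite lee_fin; apply: ge0_ler_powR; rewrite ?nnegrE ?divr_ge0//; lra.
have mV2 : measurable_fun setT V2.
  apply: (measurableT_comp (measurable_powR (1 + eps))).
  exact: measurable_funM.
have h w : ((V w ^+ 2)%:E <= 4%:E * (1%:E + (V2 w)%:E))%E.
  have /andP[V0 _] := VW w.
  rewrite -EFinD -EFinM lee_fin /V2; set z := V w / 2.
  have -> : V w = 2 * z by rewrite /z mulrCA divff ?mulr1.
  rewrite exprMn.
  have z0 : 0 <= z by rewrite divr_ge0.
  suff : z ^+ 2 <= 1 + z `^ (1 + eps) by have := powR_ge0 z (1 + eps); lra.
  have [z1|z1] := leP z 1.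
    have : z ^+ 2 <= 1 by rewrite exprn_ile1.
    by have := powR_ge0 z (1 + eps); lra.
  rewrite -powR_mulrn//.
  have : z `^ 2%:R <= z `^ (1 + eps) by apply: ler_powR; [exact: ltW|lra].
  lra.
apply: (@le_trans _ _ (\int[P]_w (4%:E * (1%:E + (V2 w)%:E)))%E).
  apply: ge0_le_integral => //.
  - by move=> w _; rewrite lee_fin sqr_ge0.
  - by apply/measurable_EFinP; exact: measurable_funX.
  - apply/measurable_EFinP; apply: measurable_funM => //.
    exact: measurable_funD.
have V20 w : (0 <= (V2 w)%:E)%E by rewrite lee_fin powR_ge0.
have mV2E : measurable_fun setT (fun w => (V2 w)%:E) by exact/measurable_EFinP.
have mS : measurable_fun setT (fun w => (1%:E + (V2 w)%:E)%E).
  by apply: emeasurable_funD => //; exact: measurable_cst.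
have S0 w : (0 <= 1%:E + (V2 w)%:E)%E by rewrite adde_ge0.
rewrite (ge0_integralZl P measurableT mS (fun w _ => S0 w))//.
rewrite EFinM lee_wpmul2l ?lee_fin//.
rewrite (ge0_integralD P measurableT (fun _ _ => lee01) (measurable_cst _)
  (fun w _ => V20 w) mV2E).
rewrite integral_cst//= probability_setT mule1 EFinD leeD2l//.
Qed.

End moments.

Section tails.
Context {R : realType}.

(** The weights of the coordinates that [lamhat] sets to [0]. Index [k] is the lag [k + 1] and the
    observed lags are those below [t], so the weights kept belong to the lags from [t] on. *)
Definition tail_coeff (a : nat -> R) (t k : nat) : R :=
  if (k.+1 < t)%N then 0 else a k.

Lemma tail_coeff_ge0 (a : nat -> R) (t k : nat) :
  (forall k, 0 <= a k) -> 0 <= tail_coeff a t k.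
Proof. by move=> a0; rewrite /tail_coeff; case: ifP. Qed.

Lemma tail_coeff_sum_le (a : nat -> R) (gamma C : R) :
  (forall k, 0 <= a k) -> (\sum_(k <oo) (a k)%:E < 1)%E -> 1 < gamma ->
  (\forall k \near \oo, a k <= C * ((k.+1)%:R `^ (- gamma))) ->
  exists2 K : R, 0 <= K & forall t, (0 < t)%N ->
    (\sum_(k <oo) (tail_coeff a t k)%:E <= (K * t%:R `^ (1 - gamma))%:E)%E.
Proof.
move=> a0 a1 g1 [n0 _ aC].
have [K K0 HK] := sum_powRN_le g1.
(* The decay is known from [n0] on. Below [n0] one has [a k <= 1], since the whole sum is below [1],
   and [(n0 + 1) ^ gamma] outweighs the factor [(k + 1) ^ (- gamma)]. *)
pose C' := Num.max C (n0.+1%:R `^ gamma).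
have C'0 : 0 <= C' by rewrite le_max powR_ge0 orbT.
have aC' k : a k <= C' * k.+1%:R `^ (- gamma).
  have [kn|kn] := leqP n0 k.
    apply: le_trans (aC k kn) _; rewrite ler_wpM2r ?powR_ge0//.
    by rewrite /C' le_max lexx.
  apply: (@le_trans _ _ 1).
    rewrite -lee_fin; apply: le_trans (ltW a1).
    apply: le_trans (le_partial_nneseries k.+1 a0).
    by rewrite lee_fin big_nat_recr//= lerDr sumr_ge0.
  apply: (@le_trans _ _ (n0.+1%:R `^ gamma * k.+1%:R `^ (- gamma))).
    rewrite powRN ler_pdivlMr ?powR_gt0// mul1r.
    by apply: ge0_ler_powR; rewrite ?nnegrE ?ler0n ?ler_nat//; [lra|exact: ltnW].
  by rewrite ler_wpM2r ?powR_ge0// /C' le_max lexx orbT.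
exists (C' * K); first exact: mulr_ge0.
move=> t t0; apply: nneseries_le => [k|n]; first by rewrite lee_fin tail_coeff_ge0.
rewrite sumEFin lee_fin.
apply: (@le_trans _ _ (\sum_(0 <= k < t.-1 + n) tail_coeff a t k)).
  rewrite (@big_cat_nat _ _ _ n 0 (t.-1 + n))//= ?leq_addl// lerDl sumr_ge0// => k _.
  exact: tail_coeff_ge0.
rewrite (@big_cat_nat _ _ _ t.-1 0 (t.-1 + n))//= ?leq_addr//.
rewrite big_nat big1 ?add0r; last first.
  by move=> k /andP[_ kt]; rewrite /tail_coeff (_ : (k.+1 < t)%N)// -(prednK t0).
apply: le_trans (_ : _ <= C' * \sum_(t.-1 <= k < t.-1 + n) k.+1%:R `^ (- gamma)) _.
  rewrite mulr_sumr; apply: ler_sum => k _; apply: le_trans (aC' k).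
  by rewrite /tail_coeff; case: ifP.
rewrite -mulrA ler_wpM2l//.
have := HK t n t0; rewrite -{1 2}(prednK t0) addSn big_add1/=; apply: le_trans.
by [].
Qed.
End tails.

(** * Replacing the infinite past by the observed one *)

Section approximation.
Set Implicit Arguments.
Unset Strict Implicit.
Context {R : realType} {d dx : nat} {d0 : measure_display} {Omega : measurableType d0}.
Variables (P : probability Omega R) (Theta : set 'rV[R]_d) (f : model R d dx)
  (g : nat -> R -> R) (eta : R -> R)
  (Y : int -> Omega -> nat) (X : int -> Omega -> 'rV[R]_dx)
  (alpha cl ceta : R) (alpha0 : nat -> R).
Hypothesis alpha_ge0 : 0 <= alpha.
Hypothesis f_meas : forall th, Theta th -> forall B : set R, measurable B ->
  @arg_sigma R dx ((fun p => f th p.1 p.2) @^-1` B).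
Hypothesis g_ge0 : forall e y, 0 <= g y e.
Hypothesis g_sum1 : forall e, (\sum_(y <oo) (g y e)%:E)%E = 1%E.
Hypothesis g_derivable : forall y e, derivable (g y) e 1.
Hypothesis g_C1 : forall y, continuous (derive1 (g y)).
Hypothesis Y_meas : forall t y, measurable (Y t @^-1` [set y]).
Hypothesis X_meas : forall t (i : 'I_dx), measurable_fun setT (fun w => X t w 0 i).
Hypothesis f_cont : forall y x, {within Theta, continuous (fun th => f th y x)}.
Hypothesis alpha0_ge0 : forall k, 0 <= alpha0 k.
Hypothesis f_lip : forall y x y' x' th, Theta th ->
     (`|f th y x - f th y' x'|%:E
      <= \sum_(k <oo) (alpha0 k * (`|(y k)%:R - (y' k)%:R| + `|x k - x' k|))%:E)%E.
Hypothesis f_ge : forall th y x, Theta th -> cl <= f th y x.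
Hypothesis ceta_gt0 : 0 < ceta.
Hypothesis eta_lip : forall l l', cl <= l -> cl <= l' ->
  `|eta l - eta l'| <= ceta * `|l - l'|.

Lemma loss_continuous_in_parameter (n : nat) (y : nat -> nat) (x : nat -> 'rV[R]_dx) :
  (forall e, g n e != 0) ->
  {within Theta, continuous (fun th => dpd_loss g alpha (eta (f th y x)) n)}.
Proof.
move=> gn0; apply: (@subspace_eq_continuous _ _ _
  (fun th => dpd_loss g alpha (eta (Num.max cl (f th y x))) n)).
  by move=> th; rewrite inE => Tth; rewrite /from_subspace/= max_r// f_ge.
move=> th; apply: (@continuous_comp _ _ _ (fun th : subspace Theta => f th y x)
  (fun l => dpd_loss g alpha (eta (Num.max cl l)) n)); first exact: f_cont.
apply: (@continuous_comp _ _ _ (fun l => eta (Num.max cl l))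
  (fun e => dpd_loss g alpha e n)).
  exact: lipschitz_max_continuous ceta_gt0 eta_lip _.
exact: dpd_loss_continuous.
Qed.

Variables (q : nat -> 'rV[R]_d).
Hypothesis Tq : forall i, Theta (q i).
Hypothesis q_dense : forall x e, Theta x -> 0 < e -> exists i, ball x e (q i).

Let U (t k : nat) (w : Omega) : R :=
  (Y (t%:Z - k.+1%:Z) w)%:R + `|X (t%:Z - k.+1%:Z) w|.

Let U_ge0 t k w : 0 <= U t k w.
Proof. by rewrite addr_ge0. Qed.

Let U_meas t k : measurable_fun setT (U t k).
Proof.
apply: measurable_funD; last exact: measurable_rV_norm.
apply: (@measurable_fun_nat_family _ _ (Y (t%:Z - k.+1%:Z)) _ R (fun n _ => n%:R)) => n.
  exact: Y_meas.
exact: measurable_cst.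
Qed.

Lemma lam_lamhat_dist_le t th w : Theta th ->
  ((`|eta (lam f Y X th t%:Z w) - eta (lamhat f Y X th t w)|%R)%:E <=
   ceta%:E * \sum_(k <oo) (tail_coeff alpha0 t k * U t k w)%:E)%E.
Proof.
move=> Tth; apply: (@le_trans _ _
  (ceta * `|lam f Y X th t%:Z w - lamhat f Y X th t w|)%:E).
  by rewrite lee_fin; apply: eta_lip; exact: f_ge.
rewrite EFinM lee_wpmul2l ?lee_fin ?(ltW ceta_gt0)//.
apply: le_trans (f_lip _ _ _ _ Tth) _; apply: lee_nneseries => [k _ _|k _].
  by rewrite lee_fin mulr_ge0// addr_ge0.
rewrite lee_fin /tail_coeff /pastY /pastX; case: ifPn => _.
  by rewrite !subrr !normr0 addr0 mulr0 mul0r.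
by rewrite !subr0 /U normr_nat.
Qed.

Variables (C2 : R).
Hypothesis U_moment : forall t, (\int[P]_w (((Y t w)%:R + `|X t w|) ^+ 2)%:E <= C2%:E)%E.

Variables (t : nat) (A p1 p2 : R).
Hypothesis tail_sum : (\sum_(k <oo) (tail_coeff alpha0 t k)%:E = A%:E)%E.
Hypothesis p1_gt0 : 0 < p1.
Hypothesis p2_gt0 : 0 < p2.
Let arg (dl : R) th w := dl * eta (lam f Y X th t%:Z w)
                   + (1 - dl) * eta (lamhat f Y X th t w).
Hypothesis phi_bound : forall dl : R, 0 <= dl <= 1 ->
  (\int[P]_w (supTheta Theta (fun th => phi_g g (arg dl th w)) ^+ 2)
        <= (p1 ^+ 2)%:E)%E.
Hypothesis psi_bound : forall dl : R, 0 <= dl <= 1 ->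
  (\int[P]_w (supTheta Theta (fun th => (psi_g g (Y t%:Z w) (arg dl th w))%:E) ^+ 2)
        <= (p2 ^+ 2)%:E)%E.

(** [esups] at [0] is the supremum of the whole sequence. Taken over [q], it is measurable and lies
    below the supremum over [Theta]. *)
Let Phi dl w := esups (fun j => phi_g g (arg dl (q j) w)) 0.
Let Psi dl w := esups (fun j => (psi_g g (Y t%:Z w) (arg dl (q j) w))%:E) 0.
(** The weight of the AM-GM inequality. It makes both contributions to the mean of [B] linear in
    [s]: [s * A * C2 / 2] from [S], and at most [2 * A * s] from the squares of [Phi] and [Psi],
    whose means are at most [s ^ 2]. *)
Let s := Num.max p1 p2.
Let S w := (\sum_(k <oo) (tail_coeff alpha0 t k * U t k w ^+ 2)%:E)%E.
Let B (N i : nat) w := ((s / 2)%:E * S w +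
       (A / s)%:E * (Phi (i%:R / N%:R)%R w ^+ 2 + Psi (i%:R / N%:R)%R w ^+ 2))%E.
Let u (N : nat) w := (((1 + alpha) * ceta * N%:R^-1)%:E * \sum_(i < N) B N i w)%E.

Let s_gt0 : 0 < s.
Proof. by rewrite lt_max p1_gt0. Qed.

Let tail0 k : 0 <= tail_coeff alpha0 t k.
Proof. exact: tail_coeff_ge0. Qed.

Let A_ge0 : 0 <= A.
Proof.
by rewrite -lee_fin -tail_sum; apply: nneseries_ge0 => k _ _; rewrite lee_fin.
Qed.

Let S_ge0 w : (0 <= S w)%E.
Proof. by apply: nneseries_ge0 => k _ _; rewrite lee_fin mulr_ge0// sqr_ge0. Qed.

Let U2_meas k : measurable_fun setT (fun w => (tail_coeff alpha0 t k * U t k w ^+ 2)%:E).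
Proof.
apply/measurable_EFinP; apply: measurable_funM => //.
exact: measurable_funX.
Qed.

Let S_meas : measurable_fun setT S.
Proof.
apply: (ge0_emeasurable_sum (P := xpredT)) => [k w _ _|k _]; last exact: U2_meas.
by rewrite lee_fin mulr_ge0// sqr_ge0.
Qed.

Let S_int : (\int[P]_w S w <= (A * C2)%:E)%E.
Proof.
rewrite /S integral_nneseries//; last first.
  by move=> k w _; rewrite lee_fin mulr_ge0// sqr_ge0.
rewrite mulrC EFinM -tail_sum -nneseriesZl; last by move=> k _; rewrite lee_fin.
apply: lee_nneseries => [k _ _|k _].
  by apply: integral_ge0 => w _; rewrite lee_fin mulr_ge0// sqr_ge0.
under eq_integral do rewrite EFinM.
rewrite ge0_integralZl//; last 3 first.
- by apply/measurable_EFinP; exact: measurable_funX.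
- by move=> w _; rewrite lee_fin sqr_ge0.
- by rewrite lee_fin.
by rewrite muleC lee_wpmul2r ?lee_fin//; exact: U_moment.
Qed.

Let arg_meas dl j : measurable_fun setT (arg dl (q j)).
Proof.
apply: measurable_funD; apply: measurable_funM => //.
  apply: (link_comp_measurable ceta_gt0 eta_lip); last by move=> w; exact: f_ge.
  exact: (lam_measurable f_meas).
apply: (link_comp_measurable ceta_gt0 eta_lip); last by move=> w; exact: f_ge.
exact: (lamhat_measurable f_meas).
Qed.

Let phi_ge0 e : (0 <= phi_g g e)%E.
Proof. by apply: nneseries_ge0 => k _ _; rewrite lee_fin. Qed.

Let Phi_ge0 dl w : (0 <= Phi dl w)%E.
Proof. by apply: le_trans (phi_ge0 _) (ereal_sup_ubound _); exists 0%N. Qed.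

Let Psi_ge0 dl w : (0 <= Psi dl w)%E.
Proof.
apply: le_trans (ereal_sup_ubound _); last by exists 0%N.
by rewrite lee_fin /psi_g.
Qed.

Let derive1_meas y : measurable_fun setT (derive1 (g y)).
Proof. exact: continuous_measurable_fun. Qed.

Let phi_meas : measurable_fun setT (phi_g g).
Proof.
apply: (ge0_emeasurable_sum (P := xpredT)) => [k e _ _|k _]; first by rewrite lee_fin.
by apply/measurable_EFinP; apply: measurableT_comp.
Qed.

Let Phi_meas dl : measurable_fun setT (Phi dl).
Proof.
apply: measurable_fun_esups => j.
exact: (measurableT_comp phi_meas).
Qed.

Let g_meas y : measurable_fun setT (g y).
Proof. by apply: continuous_measurable_fun; exact: pmf_continuous. Qed.

Let Psi_meas dl : measurable_fun setT (Psi dl).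
Proof.
apply: measurable_fun_esups => j; apply/measurable_EFinP.
apply: (measurable_fun_nat_family (Y_meas t%:Z)
  (h := fun n w => psi_g g n (arg dl (q j) w))) => n.
apply: (measurableT_comp (f := psi_g g n)) => //.
apply: measurableT_comp => //; apply: measurable_funM => //.
under eq_fun do rewrite -powR_inv1//.
exact: (measurableT_comp (measurable_powR _) (g_meas n)).
Qed.

Let sqr_meas (F : Omega -> \bar R) :
  measurable_fun setT F -> measurable_fun setT (fun w => F w ^+ 2)%E.
Proof. by move=> mF; under eq_fun do rewrite expe2; exact: emeasurable_funM. Qed.

Let Phi_int dl : 0 <= dl <= 1 -> (\int[P]_w (Phi dl w ^+ 2) <= (p1 ^+ 2)%:E)%E.
Proof.
move=> dl01; apply: le_trans (phi_bound dl01); apply: ge0_le_lower_integral => w.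
  exact: sqre_ge0.
have h : (Phi dl w <= supTheta Theta (fun th => phi_g g (arg dl th w)))%E.
  by apply: le_ereal_sup => _ [j _ <-]; exists (q j).
by rewrite lee_sqr//; exact: le_trans h.
Qed.

Let Psi_int dl : 0 <= dl <= 1 -> (\int[P]_w (Psi dl w ^+ 2) <= (p2 ^+ 2)%:E)%E.
Proof.
move=> dl01; apply: le_trans (psi_bound dl01); apply: ge0_le_lower_integral => w.
  exact: sqre_ge0.
have h : (Psi dl w <=
    supTheta Theta (fun th => (psi_g g (Y t%:Z w) (arg dl th w))%:E))%E.
  by apply: le_ereal_sup => _ [j _ <-]; exists (q j).
by rewrite lee_sqr//; exact: le_trans h.
Qed.

Let As0 : (0 <= (A / s)%:E)%E. Proof. by rewrite lee_fin divr_ge0// ltW. Qed.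
Let s20 : (0 <= (s / 2)%:E)%E. Proof. by rewrite lee_fin divr_ge0// ltW. Qed.

Let B_ge0 N i w : (0 <= B N i w)%E.
Proof. by rewrite adde_ge0// mule_ge0// adde_ge0// sqre_ge0. Qed.

Let Q_meas dl : measurable_fun setT (fun w => Phi dl w ^+ 2 + Psi dl w ^+ 2)%E.
Proof. by apply: emeasurable_funD; exact: sqr_meas. Qed.

Let B_meas N i : measurable_fun setT (B N i).
Proof. by apply: emeasurable_funD; apply: emeasurable_funM. Qed.

Let B_int N i : (i < N)%N -> (\int[P]_w B N i w <= (s * A * (C2 / 2 + 2))%:E)%E.
Proof.
move=> iN.
have iN01 : 0 <= (i%:R / N%:R : R) <= 1.
  have N0 : (0 < N)%N by exact: leq_ltn_trans iN.
  by rewrite divr_ge0 ?ler0n//= ler_pdivrMr ?ltr0n// mul1r ler_nat ltnW.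
rewrite /B ge0_integralD//; last 4 first.
- by move=> w _; rewrite mule_ge0.
- exact: emeasurable_funM.
- by move=> w _; rewrite mule_ge0// adde_ge0// sqre_ge0.
- exact: emeasurable_funM.
rewrite ge0_integralZl// [X in (_ + X)%E]ge0_integralZl//; last first.
  by move=> w _; rewrite adde_ge0// sqre_ge0.
rewrite ge0_integralD//; last 4 first.
- by move=> w _; rewrite sqre_ge0.
- exact: sqr_meas.
- by move=> w _; rewrite sqre_ge0.
- exact: sqr_meas.
apply: (@le_trans _ _ ((s / 2)%:E * (A * C2)%:E + (A / s)%:E * ((p1 ^+ 2)%:E + (p2 ^+ 2)%:E))%E).
  by apply: leeD; apply: lee_wpmul2l => //; apply: leeD; [exact: Phi_int|exact: Psi_int].
rewrite -[leLHS]/((s / 2 * (A * C2) + A / s * (p1 ^+ 2 + p2 ^+ 2))%:E) lee_fin.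
have h1 : p1 <= s by rewrite le_max lexx.
have h2 : p2 <= s by rewrite le_max lexx orbT.
have h3 : p1 ^+ 2 + p2 ^+ 2 <= 2 * s ^+ 2.
  have : p1 ^+ 2 <= s ^+ 2 by rewrite ler_sqr ?nnegrE// ltW.
  have : p2 ^+ 2 <= s ^+ 2 by rewrite ler_sqr ?nnegrE// ltW.
  lra.
have h4 : A / s * (p1 ^+ 2 + p2 ^+ 2) <= A / s * (2 * s ^+ 2).
  by rewrite ler_wpM2l// divr_ge0// ltW.
have h5 : A / s * (2 * s ^+ 2) = 2 * A * s by field; rewrite gt_eqF.
lra.
Qed.

(** The majorant is the limit inferior of [u N]: measurable because it is built from [q], with its
    mean bounded by Fatou's lemma. It dominates the error at the points [q j], and continuity in the
    parameter, which rests on [g] not vanishing at the observed value, extends this to [Theta]. *)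
Lemma loss_error_dominated : exists De : Omega -> \bar R,
  [/\ measurable_fun setT De, (forall w, 0 <= De w)%E,
    (\int[P]_w De w <= ((1 + alpha) * ceta * (C2 / 2 + 2) * (A * Num.max p1 p2))%:E)%E &
    forall w, (forall e, g (Y t%:Z w) e != 0) -> forall th, Theta th ->
    ((`|dpd_loss g alpha (eta (lam f Y X th t%:Z w)) (Y t%:Z w)
      - dpd_loss g alpha (eta (lamhat f Y X th t w)) (Y t%:Z w)|%R)%:E <= De w)%E].
Proof.
have al0 : 0 < 1 + alpha by rewrite ltr_pwDl.
have cN0 N : (0 <= ((1 + alpha) * ceta * N%:R^-1)%:E)%E.
  by rewrite lee_fin !mulr_ge0// ?invr_ge0 ?ler0n// ltW.
have mu_ N : measurable_fun setT (u N).
  apply: emeasurable_funM => //.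
  by apply: emeasurable_sum => i; exact: B_meas.
have u0 N w : (0 <= u N w)%E.
  by rewrite mule_ge0//; apply: sume_ge0 => i _; exact: B_ge0.
exists (fun w => limn_einf (fun N => u N w)); split.
- rewrite /limn_einf; apply: measurableT_comp => //.
  by apply: measurable_fun_limn_esup => N; exact: measurableT_comp.
- by move=> w; apply: limn_einf_ge; exact: nearW.
- apply: le_trans (fatou P measurableT mu_ (fun N w _ => u0 N w)) _.
  have ub N : (0 < N)%N -> (\int[P]_w u N w <=
      ((1 + alpha) * ceta * (C2 / 2 + 2) * (A * Num.max p1 p2))%:E)%E.
    move=> N0; rewrite /u ge0_integralZl//; last 2 first.
    - by apply: emeasurable_sum => i; exact: B_meas.
    - by move=> w _; apply: sume_ge0 => i _; exact: B_ge0.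
    rewrite ge0_integral_sum//.
    apply: (@le_trans _ _ (((1 + alpha) * ceta * N%:R^-1)%:E *
        \sum_(i < N) (s * A * (C2 / 2 + 2))%:E)%E).
      by apply: lee_wpmul2l => //; apply: lee_sum => i _; exact: B_int.
    rewrite sumEFin sumr_const card_ord -EFinM lee_fin -[_ *+ N]mulr_natl.
    rewrite le_eqVlt; apply/orP; left; apply/eqP; rewrite -/s.
    by field; rewrite pnatr_eq0 -lt0n.
  rewrite limn_einf_lim; apply: lime_le; first exact: is_cvg_einfs.
  exists 1%N => // n /= n0; apply: le_trans (ub n n0).
  by apply: ereal_inf_lbound; exists n => /=.
- move=> w gn0 th Tth.
  set L := limn_einf _.
  have hq j : ((`|dpd_loss g alpha (eta (lam f Y X (q j) t%:Z w)) (Y t%:Z w)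
      - dpd_loss g alpha (eta (lamhat f Y X (q j) t w)) (Y t%:Z w)|%R)%:E <= L)%E.
    apply: (dpd_loss_dist_le_liminf alpha_ge0 g_ge0 g_sum1 g_derivable g_C1
      (Phi := fun dl => Phi dl w) (Psi := fun dl => Psi dl w)
      (a := tail_coeff alpha0 t) (U := fun k => U t k w) gn0 ceta_gt0 s_gt0) => //.
      exact: lam_lamhat_dist_le.
    move=> dl _; split; apply: ereal_sup_ubound; by exists j.
  have L0 : (0 <= L)%E by apply: le_trans (hq 0%N); rewrite lee_fin.
  have [->|Lfin] := eqVneq L +oo%E; first by rewrite leey.
  have {Lfin}/fineK Lr : L \is a fin_num by rewrite ge0_fin_numE// ltey.
  rewrite -Lr lee_fin.
  pose h (th : 'rV[R]_d) : R := `|dpd_loss g alpha (eta (lam f Y X th t%:Z w)) (Y t%:Z w)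
      - dpd_loss g alpha (eta (lamhat f Y X th t w)) (Y t%:Z w)|.
  have hqL i : h (q i) <= fine L by rewrite -lee_fin Lr; exact: hq.
  have ch : {within Theta, continuous h}.
    move=> z; apply: (@continuous_comp _ _ _ (fun th : subspace Theta =>
      dpd_loss g alpha (eta (lam f Y X th t%:Z w)) (Y t%:Z w)
      - dpd_loss g alpha (eta (lamhat f Y X th t w)) (Y t%:Z w)) Num.norm);
      last exact: norm_continuous.
    have c1 := @loss_continuous_in_parameter (Y t%:Z w) (pastY Y t%:Z w) (pastX X t%:Z w) gn0.
    have c2 := @loss_continuous_in_parameter (Y t%:Z w)
      (fun k => if (k.+1 < t)%N then Y (t%:Z - (k.+1)%:Z) w else 0%N)
      (fun k => if (k.+1 < t)%N then X (t%:Z - (k.+1)%:Z) w else 0) gn0.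
    by apply: cvgB; [exact: (c1 z)|exact: (c2 z)].
  exact: (@dense_sequence_le R 'rV[R]_d Theta q h (fine L) Tq q_dense ch hqL th Tth).
Qed.

End approximation.

(** * Summing the approximation errors over time *)

Section approximation_average.
Set Implicit Arguments.
Unset Strict Implicit.
Context {R : realType} {d dx : nat} {d0 : measure_display} {Omega : measurableType d0}.
Variables (P : probability Omega R) (Theta : set 'rV[R]_d) (f : model R d dx)
  (g : nat -> R -> R) (eta : R -> R)
  (Y : int -> Omega -> nat) (X : int -> Omega -> 'rV[R]_dx)
  (alpha cl ceta : R) (alpha0 : nat -> R).
Hypothesis alpha_ge0 : 0 <= alpha.
Hypothesis f_meas : forall th, Theta th -> forall B : set R, measurable B ->
  @arg_sigma R dx ((fun p => f th p.1 p.2) @^-1` B).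
Hypothesis g_ge0 : forall e y, 0 <= g y e.
Hypothesis g_sum1 : forall e, (\sum_(y <oo) (g y e)%:E)%E = 1%E.
Hypothesis g_derivable : forall y e, derivable (g y) e 1.
Hypothesis g_C1 : forall y, continuous (derive1 (g y)).
Hypothesis Y_meas : forall t y, measurable (Y t @^-1` [set y]).
Hypothesis X_meas : forall t (i : 'I_dx), measurable_fun setT (fun w => X t w 0 i).
Hypothesis f_cont : forall y x, {within Theta, continuous (fun th => f th y x)}.
Hypothesis alpha0_ge0 : forall k, 0 <= alpha0 k.
Hypothesis alpha0_sum : (\sum_(k <oo) (alpha0 k)%:E < 1)%E.
Hypothesis f_lip : forall y x y' x' th, Theta th ->
     (`|f th y x - f th y' x'|%:E
      <= \sum_(k <oo) (alpha0 k * (`|(y k)%:R - (y' k)%:R| + `|x k - x' k|))%:E)%E.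
Hypothesis f_ge : forall th y x, Theta th -> cl <= f th y x.
Hypothesis ceta_gt0 : 0 < ceta.
Hypothesis eta_lip : forall l l', cl <= l -> cl <= l' ->
  `|eta l - eta l'| <= ceta * `|l - l'|.
Variables (q : nat -> 'rV[R]_d).
Hypothesis Tq : forall i, Theta (q i).
Hypothesis q_dense : forall x e, Theta x -> 0 < e -> exists i, ball x e (q i).
Variables (C2 : R).
Hypothesis U_moment : forall t, (\int[P]_w (((Y t w)%:R + `|X t w|) ^+ 2)%:E <= C2%:E)%E.
Variables (phibar psibar : nat -> R) (gamma C : R).
Hypothesis phi_bound : forall t : nat, (0 < t)%N -> 0 < phibar t /\
     forall delta : R, 0 <= delta <= 1 ->
       (\int[P]_w (supTheta Theta (fun th =>
          phi_g g (delta * eta (lam f Y X th t%:Z w)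
                   + (1 - delta) * eta (lamhat f Y X th t w))) ^+ 2)
        <= (phibar t ^+ 2)%:E)%E.
Hypothesis psi_bound : forall t : nat, (0 < t)%N -> 0 < psibar t /\
     forall delta : R, 0 <= delta <= 1 ->
       (\int[P]_w (supTheta Theta (fun th =>
          (psi_g g (Y t%:Z w) (delta * eta (lam f Y X th t%:Z w)
                   + (1 - delta) * eta (lamhat f Y X th t w)))%:E) ^+ 2)
        <= (psibar t ^+ 2)%:E)%E.
Hypothesis g_neq0 : forall t : nat, (0 < t)%N ->
  {ae P, forall w, forall e, g (Y t%:Z w) e != 0}.
Hypothesis gamma_gt1 : 1 < gamma.
Hypothesis alpha0_decay : \forall k \near \oo, alpha0 k <= C * ((k.+1)%:R `^ (- gamma)).
Hypothesis weights_sum :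
  (\sum_(k <oo) (((k.+1)%:R `^ (- gamma)) * Num.max (phibar k.+1) (psibar k.+1))%:E < +oo)%E.

(** [D n] belongs to time [n + 1]. The weighted series of the extended-real majorants has a finite
    mean, hence is almost surely finite; this makes all its terms finite at once, and Kronecker's
    lemma applies to them as reals. *)
Lemma loss_error_average_cvg0 : {ae P, forall w, exists D : nat -> R,
  (forall n th, Theta th ->
     `|dpd_loss g alpha (eta (lam f Y X th n.+1%:Z w)) (Y n.+1%:Z w)
      - dpd_loss g alpha (eta (lamhat f Y X th n.+1 w)) (Y n.+1%:Z w)| <= D n) /\
  n%:R^-1 * \sum_(0 <= i < n) D i @[n --> \oo] --> (0 : R)}.
Proof.
have [K K0 tailK] := tail_coeff_sum_le alpha0_ge0 alpha0_sum gamma_gt1 alpha0_decay.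
pose m (n : nat) := Num.max (phibar n.+1) (psibar n.+1).
have m0 n : 0 < m n by rewrite lt_max (phi_bound (ltn0Sn n)).1.
have C20 : 0 <= C2.
  rewrite -lee_fin; apply: le_trans (U_moment 0); apply: integral_ge0 => w _.
  by rewrite lee_fin sqr_ge0.
pose Kc := (1 + alpha) * ceta * (C2 / 2 + 2).
have Kc0 : 0 <= Kc by rewrite !mulr_ge0 ?addr_ge0 ?divr_ge0// ltW.
have HDe n : exists De : Omega -> \bar R,
  [/\ measurable_fun setT De, (forall w, 0 <= De w)%E,
    (\int[P]_w De w <= (Kc * K * (n.+1%:R `^ (1 - gamma) * m n))%:E)%E &
    forall w, (forall e, g (Y n.+1%:Z w) e != 0) -> forall th, Theta th ->
    ((`|dpd_loss g alpha (eta (lam f Y X th n.+1%:Z w)) (Y n.+1%:Z w)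
      - dpd_loss g alpha (eta (lamhat f Y X th n.+1 w)) (Y n.+1%:Z w)|%R)%:E <= De w)%E].
  have tn := tailK n.+1 (ltn0Sn n).
  have tfin : (\sum_(k <oo) (tail_coeff alpha0 n.+1 k)%:E)%E \is a fin_num.
    rewrite ge0_fin_numE; first by apply: le_lt_trans tn _; rewrite ltry.
    by apply: nneseries_ge0 => k _ _; rewrite lee_fin tail_coeff_ge0.
  have [pg pb] := phi_bound (ltn0Sn n); have [sg sb] := psi_bound (ltn0Sn n).
  have [De [mDe De0 iDe hDe]] := loss_error_dominated alpha_ge0 f_meas g_ge0 g_sum1
    g_derivable g_C1 Y_meas X_meas f_cont alpha0_ge0 f_lip f_ge ceta_gt0 eta_lip
    Tq q_dense U_moment (esym (fineK tfin)) pg sg pb sb.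
  exists De; split => //; apply: le_trans iDe _.
  rewrite lee_fin -/Kc -/(m n) -mulrA ler_wpM2l// mulrA ler_wpM2r ?(ltW (m0 n))//.
  by rewrite -lee_fin fineK.
have [De HD] := choice HDe.
have w0 n : 0 <= n.+1%:R^-1 :> R by rewrite invr_ge0.
pose T w := (\sum_(n <oo) (n.+1%:R^-1)%:E * De n w)%E.
have mDe n : measurable_fun setT (De n) by have [] := HD n.
have De0 n w : (0 <= De n w)%E by have [_ + _ _] := HD n; apply.
have wDe0 n w : (0 <= (n.+1%:R^-1)%:E * De n w)%E by rewrite mule_ge0// lee_fin.
have mT : measurable_fun setT T.
  apply: (ge0_emeasurable_sum (P := xpredT)) => // k _.
  exact: emeasurable_funM.
have iT : (\int[P]_w T w < +oo)%E.
  rewrite /T integral_nneseries//; last by move=> n; exact: emeasurable_funM.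
  apply: (@le_lt_trans _ _ (\sum_(n <oo) (Kc * K)%:E * (n.+1%:R `^ (- gamma) * m n)%:E)%E).
    apply: lee_nneseries => [n _ _|n _]; first exact: integral_ge0.
    have wE : (0 <= (n.+1%:R^-1)%:E :> \bar R)%E by rewrite lee_fin.
    rewrite (ge0_integralZl P measurableT (mDe n) (fun w _ => De0 n w) wE).
    have [_ _ iD _] := HD n.
    apply: (@le_trans _ _ ((n.+1%:R^-1)%:E * (Kc * K * (n.+1%:R `^ (1 - gamma) * m n))%:E)%E).
      exact: lee_wpmul2l.
    rewrite -!EFinM lee_fin powRD; last by rewrite pnatr_eq0 implybT.
    rewrite powRr1//.
    have n1 : n.+1%:R != 0 :> R by rewrite pnatr_eq0.
    have -> : n.+1%:R^-1 * (Kc * K * (n.+1%:R * n.+1%:R `^ (- gamma) * m n)) =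
      (n.+1%:R^-1 * n.+1%:R) * (Kc * K * (n.+1%:R `^ (- gamma) * m n)) :> R by ring.
    by rewrite mulVf// mul1r.
  rewrite nneseriesZl; last by move=> n _; rewrite lee_fin mulr_ge0 ?powR_ge0// ltW.
  rewrite lte_mul_pinfty// lee_fin; exact: mulr_ge0.
have aeT : {ae P, forall w, setT w -> T w \is a fin_num}.
  apply: (integrable_ae measurableT); apply/integrableP; split => //.
  under eq_integral do rewrite gee0_abs ?nneseries_ge0//.
  exact: iT.
have aeg : {ae P, forall w, forall n, forall e, g (Y n.+1%:Z w) e != 0}.
  by apply: ae_foralln => n; exact: g_neq0.
apply: filterS2 aeT aeg => w /(_ I) Tw gw.
have Dfin n : De n w \is a fin_num.
  rewrite ge0_fin_numE// ltey; apply/eqP => De_oo.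
  have : ((n.+1%:R^-1)%:E * De n w <= T w)%E.
    apply: le_trans (nneseries_lim_ge n.+1 (fun k _ _ => wDe0 k w)).
    by rewrite big_nat_recr//= leeDr// sume_ge0.
  rewrite De_oo gt0_muley ?lte_fin ?invr_gt0// leye_eq => /eqP Too.
  by move: Tw; rewrite Too.
exists (fun n => fine (De n w)); split.
  move=> n th Tth; rewrite -lee_fin fineK//.
  by have [_ _ _ h] := HD n; exact: h (gw n) th Tth.
apply: kronecker_nneseries => [n|]; first exact: fine_ge0.
move: Tw; rewrite ge0_fin_numE; last exact: nneseries_ge0.
apply: le_lt_trans; apply: lee_nneseries => [n _ _|n _].
  by rewrite lee_fin mulr_ge0// fine_ge0.
by rewrite EFinM fineK.
Qed.
End approximation_average.

(** * Identification of the true parameter *)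

Section identification.
Set Implicit Arguments.
Unset Strict Implicit.
Context {R : realType} {d : measure_display} {T : measurableType d}.
Variables (P : probability T R) (g : nat -> R -> R) (alpha : R).
Hypothesis alpha_ge0 : 0 <= alpha.
Hypothesis g_ge0 : forall e y, 0 <= g y e.
Hypothesis g_sum1 : forall e, (\sum_(y <oo) (g y e)%:E)%E = 1%E.
Hypothesis g_derivable : forall y e, derivable (g y) e 1.
Variable G : set (set T).
Hypothesis G_meas : <<s G >> `<=` @measurable _ T.
Variables (N : T -> nat) (es : g_sigma_algebraType G -> R).
Hypothesis N_meas : forall n, measurable (N @^-1` [set n]).
Hypothesis es_meas : measurable_fun setT es.
Hypothesis N_pmf : forall A, <<s G >> A -> forall n,
  (P (A `&` N @^-1` [set n]) = \int[P]_(w in A) (g n (es w))%:E)%E.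
Hypothesis g_neq0 : {ae P, forall w, forall e, g (N w) e != 0}.
Hypothesis N_mean : (\int[P]_w ((N w)%:R)%:E < +oo)%E.

Let c := 1 + alpha^-1.
Let ell (e : R) (y : nat) := dpd_loss g alpha e y + c.

Let c_gt0 : 0 < c.
Proof. by rewrite ltr_pwDl// invr_ge0. Qed.

Let ell_ge0 e y : 0 <= ell e y.
Proof. by have := dpd_loss_ge alpha_ge0 g_ge0 g_sum1 y e; rewrite /ell /c; lra. Qed.

Let g_meas y : measurable_fun setT (g y).
Proof. by apply: continuous_measurable_fun; exact: pmf_continuous. Qed.

Let gs_meas y (e : g_sigma_algebraType G -> R) : measurable_fun setT e ->
  measurable_fun setT (fun w => g y (e w)).
Proof. by move=> me; exact: (measurableT_comp (g_meas y) me). Qed.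

Let toT (d' : measure_display) (S : measurableType d') (F : g_sigma_algebraType G -> S) :
  measurable_fun setT F -> measurable_fun (setT : set T) F.
Proof. by move=> mF; exact: (measurable_fun_sub_sigma G_meas mF). Qed.

Let cond_int (F : nat -> g_sigma_algebraType G -> R) :
  (forall n, measurable_fun setT (F n)) -> (forall n w, 0 <= F n w) ->
  (\int[P]_w (F (N w) w)%:E = \int[P]_w (\sum_(n <oo) (F n w * g n (es w))%:E))%E.
Proof.
move=> mF F0.
have mFE n : measurable_fun setT (fun w => (F n w)%:E) by exact/measurable_EFinP.
have F0E n w : (0 <= (F n w)%:E)%E by rewrite lee_fin.
exact: (integral_conditional_pmf G_meas N_meas (fun n => toT (gs_meas n es_meas))
  (fun n w => g_ge0 (es w) n) N_pmf mFE F0E).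
Qed.

Let ell_meas (e : g_sigma_algebraType G -> R) : measurable_fun setT e ->
  measurable_fun (setT : set T) (fun w => ell (e w) (N w)).
Proof.
move=> me; apply: (measurable_fun_nat_family N_meas (h := fun n (w : T) => ell (e w) n)) => n.
apply: measurable_funD => //.
exact: (measurableT_comp (dpd_loss_measurable alpha_ge0 g_ge0 g_sum1 g_derivable n) (toT me)).
Qed.

Let ell_measE (e : g_sigma_algebraType G -> R) : measurable_fun setT e ->
  measurable_fun (setT : set T) (fun w => (ell (e w) (N w))%:E).
Proof. by move=> me; apply/measurable_EFinP; exact: ell_meas. Qed.

(** For [alpha > 0] the loss is bounded. For [alpha = 0] the claim is that a law on the integers
    with finite mean has finite entropy: with the geometric weights in [F], [ln F <= F - 1] gives
    [- ln g + 1 <= F + N * ln 2], and the conditional mean of [F] is at most the sum of all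
    [2 ^ (- n)]. *)
Lemma integral_shifted_loss_lty : (\int[P]_w (ell (es w) (N w))%:E < +oo)%E.
Proof.
have [al0|al0] := eqVneq alpha 0; last first.
  apply: (@le_lt_trans _ _ (\int[P]_w (1 + c)%:E)%E).
    apply: ge0_le_integral => //.
    - by move=> w _; rewrite lee_fin.
    - exact: ell_measE.
    - by move=> w _; rewrite lee_fin lerD2r dpd_loss_le.
  by rewrite integral_cst//= probability_setT mule1 ltry.
pose F (n : nat) (w : g_sigma_algebraType G) : R := 2^-1 ^+ n / g n (es w).
have F0 n w : 0 <= F n w by rewrite divr_ge0// exprn_ge0// invr_ge0.
have mF n : measurable_fun setT (F n).
  apply: measurable_funM => //; under eq_fun do rewrite -powR_inv1//.
  exact: (measurableT_comp (measurable_powR _) (gs_meas n es_meas)).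
have mFN : measurable_fun (setT : set T) (fun w => (F (N w) w)%:E).
  apply/measurable_EFinP; apply: (measurable_fun_nat_family N_meas) => n.
  exact: toT.
have mNE : measurable_fun setT (fun w => ((N w)%:R)%:E : \bar R).
  apply/measurable_EFinP.
  apply: (measurable_fun_nat_family N_meas (h := fun n _ => n%:R : R)) => n.
  exact: measurable_cst.
have iF : (\int[P]_w (F (N w) w)%:E <= 2%:E)%E.
  rewrite cond_int//.
  apply: (@le_trans _ _ (\int[P]_w 2%:E)%E); last first.
    by rewrite integral_cst//= probability_setT mule1.
  apply: ge0_le_integral => //.
  - by move=> w _; apply: nneseries_ge0 => n _ _; rewrite lee_fin mulr_ge0.
  - apply: (ge0_emeasurable_sum (P := xpredT)) => [k w _ _|k _].
      by rewrite lee_fin mulr_ge0.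
    apply/measurable_EFinP; apply: measurable_funM; first exact: toT.
    by apply: toT; exact: gs_meas.
  - move=> w _; apply: nneseries_le => [n|n]; first by rewrite lee_fin mulr_ge0.
    rewrite sumEFin lee_fin.
    apply: (@le_trans _ _ (\sum_(0 <= i < n) 2^-1 ^+ i)).
      apply: ler_sum => i _; rewrite /F.
      (* Off the support the quotient in [F] is [0] by convention, and the bound persists. *)
      have [->|h] := eqVneq (g i (es w)) 0; last by rewrite divfK.
      by rewrite mulr0 exprn_ge0// invr_ge0.
    have : \sum_(0 <= i < n) 2^-1 ^+ i = 2 - 2 * 2^-1 ^+ n :> R.
      elim: n => [|n IH]; first by rewrite big_geq// expr0 mulr1 subrr.
      by rewrite big_nat_recr//= IH exprS mulrA mulfV// mul1r; lra.
    by move=> ->; rewrite gerBl mulr_ge0// exprn_ge0// invr_ge0.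
apply: (@le_lt_trans _ _ (\int[P]_w ((F (N w) w)%:E + ((N w)%:R)%:E))%E).
  apply: ae_ge0_le_integral => //.
  - by move=> w _; rewrite lee_fin.
  - exact: ell_measE.
  - by move=> w _; rewrite -EFinD lee_fin addr_ge0.
  - exact: emeasurable_funD.
  - apply: filterS g_neq0 => w gw _; rewrite -EFinD lee_fin.
    have gp : 0 < g (N w) (es w) by rewrite lt_neqAle eq_sym gw g_ge0.
    rewrite /ell /dpd_loss al0 eqxx /c al0 invr0 addr0.
    have q0 : 0 < 2^-1 ^+ N w :> R by rewrite exprn_gt0// invr_gt0.
    have Fp : 0 < F (N w) w by rewrite divr_gt0.
    have := ln_le_sub1 Fp; rewrite {1}/F ln_div ?posrE// lnXn ?invr_gt0//.
    rewrite lnV ?posrE// mulNrn -[ln 2 *+ _]mulr_natl.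
    have : ln 2 <= 1 :> R by have := @ln_le_sub1 R 2 (ltr0Sn _ _); lra.
    have := ler0n R (N w); nra.
rewrite ge0_integralD//; [|by move=> w _; rewrite lee_fin..].
by rewrite lte_add_pinfty// (le_lt_trans iF)// ltry.
Qed.

Variable e : g_sigma_algebraType G -> R.
Hypothesis e_meas : measurable_fun setT e.
Hypothesis support : forall w y, (0 < g y (e w)) = (0 < g y (es w)).

Let ae_zero (F : T -> \bar R) : measurable_fun setT F -> (forall w, 0 <= F w)%E ->
  (\int[P]_w F w <= 0)%E -> {ae P, forall w, F w = 0%E}.
Proof.
move=> mF F0 iF.
have : (\int[P]_w `|F w| = 0)%E.
  apply/eqP; rewrite eq_le integral_ge0// andbT; apply: le_trans iF.
  by under eq_integral do rewrite gee0_abs//.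
by move/(ae_eq_integral_abs P measurableT mF).1; apply: filterS => w; apply.
Qed.

Let g_neq0_pos : {ae P, forall w, 0 < g (N w) (es w) /\ 0 < g (N w) (e w)}.
Proof.
apply: filterS g_neq0 => w gw.
by split; rewrite lt_neqAle eq_sym gw g_ge0.
Qed.

Let series_meas (F : nat -> g_sigma_algebraType G -> R) :
  (forall n, measurable_fun setT (F n)) -> (forall n w, 0 <= F n w) ->
  measurable_fun (setT : set T) (fun w => \sum_(n <oo) (F n w)%:E)%E.
Proof.
move=> mF F0; apply: (ge0_emeasurable_sum (P := xpredT)) => [k w _ _|k _].
  by rewrite lee_fin.
by apply/measurable_EFinP; exact: toT.
Qed.

Let series_ge0 (F : nat -> g_sigma_algebraType G -> R) w :
  (forall n w, 0 <= F n w) -> (0 <= \sum_(n <oo) (F n w)%:E)%E.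
Proof. by move=> F0; apply: nneseries_ge0 => n _ _; rewrite lee_fin. Qed.

Let series_eq0 (F : nat -> g_sigma_algebraType G -> R) w n :
  (forall n w, 0 <= F n w) -> (\sum_(n <oo) (F n w)%:E = 0)%E -> F n w = 0.
Proof.
move=> F0 S0; apply/eqP; rewrite eq_le F0 andbT -lee_fin.
have := le_partial_nneseries n.+1 (fun n => F0 n w); rewrite S0; apply: le_trans.
by rewrite lee_fin big_nat_recr//= lerDr sumr_ge0.
Qed.

Let family_meas (F : nat -> g_sigma_algebraType G -> R) :
  (forall n, measurable_fun setT (F n)) ->
  measurable_fun (setT : set T) (fun w => (F (N w) w)%:E).
Proof.
move=> mF; apply/measurable_EFinP; apply: (measurable_fun_nat_family N_meas) => n.
exact: toT.
Qed.

(** Conditioning turns equality at the random value [N] into equality at every [y] of the support of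
    the true law. Off that support both masses vanish, by [support]. *)
Let eq_on_support : {ae P, forall w, g (N w) (e w) = g (N w) (es w)} ->
  {ae P, forall w, forall y, g y (e w) = g y (es w)}.
Proof.
move=> aeN.
pose F n (w : g_sigma_algebraType G) := `|g n (e w) - g n (es w)|.
have mF n : measurable_fun setT (F n).
  by apply: measurableT_comp => //; apply: measurable_funB; exact: gs_meas.
have F0 n w : 0 <= F n w by exact: normr_ge0.
have FB0 n w : 0 <= F n w * g n (es w) by rewrite mulr_ge0.
have mFB n : measurable_fun setT (fun w => F n w * g n (es w)).
  by apply: measurable_funM => //; exact: gs_meas.
have : (\int[P]_w (\sum_(n <oo) (F n w * g n (es w))%:E) <= 0)%E.
  rewrite -cond_int//.
  rewrite (ae_eq_integral (cst 0%E))//; first by rewrite integral0.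
    exact: family_meas.
  by apply: filterS aeN => w + _; rewrite /F => ->; rewrite subrr normr0.
move=> /(ae_zero (series_meas mFB FB0) (fun w => series_ge0 w FB0)).
apply: filterS => w Sw y.
have := series_eq0 y FB0 Sw; rewrite /F => /eqP; rewrite mulf_eq0 => /orP[|/eqP b0].
  by rewrite normr_eq0 subr_eq0 => /eqP.
have := support w y; rewrite b0 ltxx => /negbT; rewrite -leNgt => a0.
by apply/eqP; rewrite eq_le a0 g_ge0.
Qed.

(** With the likelihood ratio [r], of mean at most [1], and [k = r - 1 - ln r], almost surely
    [ell e + r = ell es + 1 + k]. All terms are nonnegative, so the identity can be integrated even
    if the mean of [ell e] is infinite; cancelling the finite mean of [ell es] leaves a mean of [k]
    that is at most [0], hence [r = 1]. *)
Let kullback_leibler : alpha = 0 ->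
  (\int[P]_w (ell (e w) (N w))%:E <= \int[P]_w (ell (es w) (N w))%:E)%E ->
  {ae P, forall w, g (N w) (e w) = g (N w) (es w)}.
Proof.
move=> al0 le.
have Efin : (\int[P]_w (ell (es w) (N w))%:E)%E \is a fin_num.
  rewrite ge0_fin_numE ?integral_shifted_loss_lty//.
  by apply: integral_ge0 => w _; rewrite lee_fin.
pose r (n : nat) (w : g_sigma_algebraType G) : R := g n (e w) / g n (es w).
have r0 n w : 0 <= r n w by rewrite divr_ge0.
have mr n : measurable_fun setT (r n).
  apply: measurable_funM; first exact: gs_meas.
  under eq_fun do rewrite -powR_inv1//.
  exact: (measurableT_comp (measurable_powR _) (gs_meas n es_meas)).
have ir : (\int[P]_w (r (N w) w)%:E <= 1)%E.
  rewrite cond_int//; apply: (@le_trans _ _ (\int[P]_w (cst 1%E w))%E); last first.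
    by rewrite integral_cst//= probability_setT mule1.
  have rb0 n w : 0 <= r n w * g n (es w) by rewrite mulr_ge0.
  apply: ge0_le_integral => //.
  - by move=> w _; exact: (series_ge0 w rb0).
  - apply: series_meas => // n; apply: measurable_funM => //; exact: gs_meas.
  - move=> w _ /=; rewrite -(g_sum1 (e w)); apply: lee_nneseries => [n _ _|n _].
      by rewrite lee_fin.
    rewrite lee_fin /r; have [->|h] := eqVneq (g n (es w)) 0; last by rewrite divfK.
    by rewrite mulr0.
(* The absolute value keeps [k] nonnegative also where a mass vanishes and [ln] takes its default
   value. *)
pose k (n : nat) (w : g_sigma_algebraType G) : R :=
  `|r n w - 1 - (ln (g n (e w)) - ln (g n (es w)))|.
have mk n : measurable_fun setT (k n).
  apply: measurableT_comp => //; apply: measurable_funB.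
    by apply: measurable_funB => //; exact: mr.
  by apply: measurable_funB; apply: measurableT_comp => //; exact: gs_meas.
have k0 n w : 0 <= k n w by exact: normr_ge0.
have id : {ae P, forall w, setT w ->
    ((ell (e w) (N w))%:E + (r (N w) w)%:E = (ell (es w) (N w))%:E + (1 + (k (N w) w)%:E))%E}.
  apply: filterS g_neq0_pos => w [b0 a0] _.
  rewrite -!EFinD /ell /dpd_loss al0 eqxx /k ger0_norm; last first.
    rewrite subr_ge0 -ln_div ?posrE//; apply: ln_le_sub1; exact: divr_gt0.
  congr (_%:E); lra.
have mell x mx := @ell_measE x mx.
have mrN := family_meas mr; have mkN := family_meas mk.
have ell0 x w : (0 <= (ell x (N w))%:E)%E by rewrite lee_fin.
have := ae_eq_integral _ _ measurableT (emeasurable_funD (mell _ e_meas) mrN)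
  (emeasurable_funD (mell _ es_meas) (emeasurable_funD (measurable_cst 1%E) mkN)) id.
have rN0 w : (0 <= (r (N w) w)%:E)%E by rewrite lee_fin.
have kN0 w : (0 <= (k (N w) w)%:E)%E by rewrite lee_fin.
rewrite ge0_integralD//; last exact: mell.
rewrite ge0_integralD//; last 3 first.
- exact: mell.
- by move=> w _; rewrite adde_ge0.
- exact: emeasurable_funD.
rewrite ge0_integralD//.
rewrite integral_cst//= probability_setT mule1 => sumE.
have ik : (\int[P]_w (k (N w) w)%:E <= 0)%E.
  have : (\int[P]_w (ell (es w) (N w))%:E + (1 + \int[P]_w (k (N w) w)%:E) <=
      \int[P]_w (ell (es w) (N w))%:E + 1)%E.
    by rewrite -sumE; exact: leeD.
  rewrite leeD2lE//.
  rewrite -[X in (_ <= X)%E](adde0 1%E) leeD2lE//.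
apply: filterS2 (ae_zero mkN kN0 ik) g_neq0_pos => w [] /normr0_eq0 kw [b0 a0].
have rp : 0 < r (N w) w by rewrite divr_gt0.
have [r1|r1] := eqVneq (r (N w) w) 1.
  by have := divfK (lt0r_neq0 b0) (g (N w) (e w)); rewrite -/(r (N w) w) r1 mul1r.
have := ln_lt_sub1 rp r1; rewrite {1}/r ln_div ?posrE//; lra.
Qed.

(** The shift is spent on the random term: [c * (1 - g ^ alpha)] is nonnegative because [g <= 1], so
    the conditional formula for nonnegative functions applies to it. *)
Let loss_integral_series (x : g_sigma_algebraType G -> R) : alpha != 0 ->
  measurable_fun setT x ->
  (\int[P]_w (ell (x w) (N w))%:E = \int[P]_w (\sum_(n <oo)
    (g n (x w) `^ (1 + alpha) + c * (1 - g n (x w) `^ alpha) * g n (es w))%:E))%E.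
Proof.
move=> al0 mx.
have alp : 0 < alpha by rewrite lt_neqAle eq_sym al0.
pose F n (w : g_sigma_algebraType G) := c * (1 - g n (x w) `^ alpha).
have mp p n : measurable_fun setT (fun w => g n (x w) `^ p).
  exact: (measurableT_comp (measurable_powR _) (gs_meas n mx)).
have mF n : measurable_fun setT (F n).
  by apply: measurable_funM => //; exact: measurable_funB.
have F0 n w : 0 <= F n w.
  rewrite mulr_ge0 ?(ltW c_gt0)// subr_ge0.
  have : g n (x w) `^ alpha <= 1 `^ alpha.
    by apply: ge0_ler_powR; rewrite ?nnegrE// (pmf_le1 g_ge0 g_sum1).
  by rewrite powR1.
have mFb n : measurable_fun setT (fun w => F n w * g n (es w)).
  by apply: measurable_funM => //; exact: gs_meas.
have Fb0 n w : 0 <= F n w * g n (es w) by rewrite mulr_ge0.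
have p0 n (w : g_sigma_algebraType G) : 0 <= g n (x w) `^ (1 + alpha) by exact: powR_ge0.
have -> : (\int[P]_w (ell (x w) (N w))%:E =
    \int[P]_w (\sum_(n <oo) (g n (x w) `^ (1 + alpha))%:E + (F (N w) w)%:E))%E.
  apply: eq_integral => w _.
  rewrite -(EFin_pmf_pow_sum alpha_ge0 g_ge0 g_sum1) -EFinD /ell /dpd_loss (negPf al0) /F /c.
  by congr (_%:E); ring.
rewrite ge0_integralD//; last 4 first.
- by move=> w _; exact: (series_ge0 w p0).
- exact: series_meas.
- by move=> w _; rewrite lee_fin.
- exact: family_meas.
rewrite cond_int// -ge0_integralD//; last 4 first.
- by move=> w _; exact: (series_ge0 w p0).
- exact: series_meas.
- by move=> w _; exact: (series_ge0 w Fb0).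
- exact: series_meas.
apply: eq_integral => w _.
rewrite -nneseriesD; [|by move=> n _ _; rewrite lee_fin..].
by apply: eq_eseriesr => n _; rewrite EFinD.
Qed.

(** In the difference of the two series the terms [c * g n (es w)] cancel, and the Young gap [K]
    between the two masses remains. Its equality case gives equality of the masses at every [y]
    directly. *)
Let density_power : alpha != 0 ->
  (\int[P]_w (ell (e w) (N w))%:E <= \int[P]_w (ell (es w) (N w))%:E)%E ->
  {ae P, forall w, forall y, g y (e w) = g y (es w)}.
Proof.
move=> al0 le.
have alp : 0 < alpha by rewrite lt_neqAle eq_sym al0.
pose K n (w : g_sigma_algebraType G) : R :=
  g n (e w) `^ (1 + alpha) + alpha^-1 * g n (es w) `^ (1 + alpha)
       - (1 + alpha^-1) * (g n (e w) `^ alpha * g n (es w)).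
have K0 n w : 0 <= K n w by have [] := young_gap_ge0 alp (g_ge0 (e w) n) (g_ge0 (es w) n).
have mp x p n : measurable_fun setT x ->
    measurable_fun setT (fun w : g_sigma_algebraType G => g n (x w) `^ p).
  by move=> mx; exact: (measurableT_comp (measurable_powR _) (gs_meas n mx)).
have mK n : measurable_fun setT (K n).
  apply: measurable_funB; [apply: measurable_funD|]; [exact: mp| |].
    by apply: measurable_funM => //; exact: mp.
  apply: measurable_funM => //; apply: measurable_funM; [exact: mp|exact: gs_meas].
have : (\int[P]_w (ell (e w) (N w))%:E =
   \int[P]_w (ell (es w) (N w))%:E + \int[P]_w (\sum_(n <oo) (K n w)%:E))%E.
  rewrite !loss_integral_series//.
  pose B n (w : g_sigma_algebraType G) :=
    g n (es w) `^ (1 + alpha) + c * (1 - g n (es w) `^ alpha) * g n (es w).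
  have B0 n w : 0 <= B n w.
    rewrite addr_ge0 ?powR_ge0// !mulr_ge0 ?(ltW c_gt0)// subr_ge0.
    have : g n (es w) `^ alpha <= 1 `^ alpha.
      by apply: ge0_ler_powR; rewrite ?nnegrE// (pmf_le1 g_ge0 g_sum1).
    by rewrite powR1.
  have mB n : measurable_fun setT (B n).
    apply: measurable_funD; first exact: mp.
    apply: measurable_funM; last exact: gs_meas.
    by apply: measurable_funM => //; apply: measurable_funB => //; exact: mp.
  rewrite -ge0_integralD//; last 4 first.
  - by move=> w _; exact: (series_ge0 w B0).
  - exact: series_meas.
  - by move=> w _; exact: (series_ge0 w K0).
  - exact: series_meas.
  apply: eq_integral => w _.
  rewrite -nneseriesD; last 2 first.
  - by move=> n _ _; rewrite lee_fin; exact: B0.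
  - by move=> n _ _; rewrite lee_fin.
  apply: eq_eseriesr => n _; rewrite -EFinD; congr (_%:E).
  rewrite /B /K /c.
  have -> : g n (es w) `^ (1 + alpha) = g n (es w) * g n (es w) `^ alpha.
    have := g_ge0 (es w) n; rewrite le_eqVlt => /predU1P[<-|b0].
      by rewrite mul0r powR0// gt_eqF// ltr_pwDl.
    by rewrite powRD ?powRr1// (gt_eqF b0) implybT.
  ring.
have Efin : (\int[P]_w (ell (es w) (N w))%:E)%E \is a fin_num.
  rewrite ge0_fin_numE ?integral_shifted_loss_lty//.
  by apply: integral_ge0 => w _; rewrite lee_fin.
move=> sumE; move: le; rewrite sumE -[X in (_ <= X)%E]adde0 leeD2lE// => iK.
have := ae_zero (series_meas mK K0) (fun w => series_ge0 w K0) iK.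
apply: filterS => w Sw y; have := series_eq0 y K0 Sw.
by have [_] := young_gap_ge0 alp (g_ge0 (e w) y) (g_ge0 (es w) y).
Qed.

Lemma integral_shifted_loss_lt :
  ~ {ae P, forall w, forall y, g y (e w) = g y (es w)} ->
  (\int[P]_w (ell (es w) (N w))%:E < \int[P]_w (ell (e w) (N w))%:E)%E.
Proof.
move=> ne; rewrite ltNge; apply/negP => le; apply: ne.
have [al0|al0] := eqVneq alpha 0; last exact: density_power.
exact: eq_on_support (kullback_leibler al0 le).
Qed.

End identification.

(** * Stationary ergodic processes *)

Section stationary.
Set Implicit Arguments.
Unset Strict Implicit.
Context {R : realType} {d d' : measure_display} {Omega : measurableType d}
  {S : measurableType d'}.
Variables (P : probability Omega R) (Z : Omega -> S) (tau : S -> S).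
Hypothesis mZ : measurable_fun setT Z.
Hypothesis mtau : measurable_fun setT tau.
Hypothesis stationary : forall B, measurable B ->
  P (Z @^-1` (tau @^-1` B)) = P (Z @^-1` B).
Hypothesis ergodic : forall B, measurable B -> tau @^-1` B = B ->
  P (Z @^-1` B) = 0%E \/ P (Z @^-1` B) = 1%E.

(** [Omega] carries no shift, so the ergodic theorem is applied to the law of [Z] on the space of
    paths. *)
Lemma birkhoff_process_lt (h : S -> R) (c : R) : measurable_fun setT h ->
  P.-integrable setT (EFin \o (h \o Z)) -> (\int[P]_w (h (Z w))%:E < c%:E)%E ->
  {ae P, forall w, \forall n \near \oo,
     n%:R^-1 * \sum_(i < n) h (iter i tau (Z w)) < c}.
Proof.
move=> mh ih hc.
pose ZM : {mfun Omega >-> S} :=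
  MeasurableFun.Pack (MeasurableFun.Class (isMeasurableFun.Build _ _ _ _ _ mZ)).
have mhE : measurable_fun setT (EFin \o h) by exact/measurable_EFinP.
have ih' : (distribution P ZM).-integrable setT (EFin \o h).
  by apply: (integrable_pushforward mZ).
have hc' : (\int[distribution P ZM]_x (h x)%:E < c%:E)%E.
  have := integral_pushforward mZ mhE ih measurableT.
  by rewrite preimage_setT => e; apply: le_lt_trans hc; rewrite -e.
have [A [mA A0 sA]] := birkhoff_average_lt (mu := distribution P ZM) mtau stationary ergodic ih' hc'.
exists (Z @^-1` A); split => //.
  by rewrite -[X in measurable X]setTI; exact: mZ.
by move=> w /= nw; apply: sA.
Qed.

Variables (V : pseudoMetricType R) (Theta : set V) (q : nat -> V) (L : V -> S -> R).
Hypothesis Tq : forall i, Theta (q i).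
Hypothesis q_dense : forall x e, Theta x -> 0 < e -> exists i, ball x e (q i).
Hypothesis L_ge0 : forall th p, 0 <= L th p.
Hypothesis L_meas : forall th, Theta th -> measurable_fun setT (L th).
Hypothesis L_cont : {ae P, forall w, forall i,
  {within Theta, continuous (fun th => L th (iter i tau (Z w)))}}.

(* [m k] is a measurable lower bound, truncated at [k], for the loss on the ball
   of radius [1 / (k + 1)] around [th]; it increases to [L th] as [k] grows. *)
Let hk (th : V) (k : nat) (j : nat) (p : S) : R :=
  if `[< ball th k.+1%:R^-1 (q j) >] then Num.min k%:R (L (q j) p) else k%:R.
Let m (th : V) (k : nat) (p : S) : R := infs (fun j => hk th k j p) 0.

Let hk_ge0 th k j p : 0 <= hk th k j p.
Proof. by rewrite /hk; case: ifP => // _; rewrite le_min ler0n L_ge0. Qed.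

Let hk_lb th k p : has_lbound (range (fun j => hk th k j p)).
Proof. by exists 0 => _ [j _ <-]. Qed.

Let m_le th k j p : m th k p <= hk th k j p.
Proof.
apply: ge_inf; last by exists j.
by exists 0 => _ [i _ <-].
Qed.

Let le_m th k p (c : R) : (forall j, c <= hk th k j p) -> c <= m th k p.
Proof. by move=> H; apply: lb_le_inf; [exists (hk th k 0 p); exists 0%N|move=> _ [j _ <-]]. Qed.

Let m_meas th k : measurable_fun setT (m th k).
Proof.
apply: measurable_fun_infs => [p _|j]; first exact: hk_lb.
rewrite /hk; case: `[< ball th k.+1%:R^-1 (q j) >]; last exact: measurable_cst.
by apply: measurable_minr => //; exact: L_meas.
Qed.

Let m_bound th k p : 0 <= m th k p <= k%:R.
Proof.
rewrite le_m//=; apply: le_trans (m_le th k 0 p) _.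
by rewrite /hk; case: ifP => // _; rewrite ge_min lexx.
Qed.

Let m_homo th p : {homo (fun k => m th k p) : k l / (k <= l)%N >-> k <= l}.
Proof.
move=> k l kl; apply: le_m => j; apply: le_trans (m_le th k j p) _.
have kl' : k%:R <= l%:R :> R by rewrite ler_nat.
rewrite /hk; case: asboolP => [bk|nbk]; case: asboolP => [bl|nbl] //.
- by rewrite le_min !ge_min kl' lexx/= orbT.
- by rewrite ge_min kl'.
- exfalso; apply: nbk; apply: le_ball bl.
  by rewrite lef_pV2 ?posrE// ler_nat.
Qed.

(** Continuity at [th] makes the limit of [m th k] at least [L th] almost surely. Monotone
    convergence covers an infinite mean of [L th], while the truncation keeps each [m th k]
    integrable. *)
Let integral_m_gt (th : V) (x : \bar R) : Theta th ->
  (x < \int[P]_w (L th (Z w))%:E)%E -> exists k, (x < \int[P]_w (m th k (Z w))%:E)%E.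
Proof.
move=> Tth xL.
have mE k : measurable_fun setT (fun w => (m th k (Z w))%:E).
  by apply/measurable_EFinP; exact: (measurableT_comp (m_meas th k) mZ).
have m0 k w : (0 <= (m th k (Z w))%:E)%E.
  by rewrite lee_fin; have /andP[] := m_bound th k (Z w).
have nd w : {homo (fun k => (m th k (Z w))%:E) : k l / (k <= l)%N >-> (k <= l)%E}.
  by move=> k l kl; rewrite lee_fin; exact: m_homo.
have cv := cvg_monotone_convergence (mu := P) measurableT mE (fun k w _ => m0 k w)
  (fun w _ => nd w).
have : (\int[P]_w (L th (Z w))%:E <= \int[P]_w (limn (fun k => (m th k (Z w))%:E)))%E.
  apply: ae_ge0_le_integral => //.
  - by move=> w _; rewrite lee_fin.
  - by apply/measurable_EFinP; apply: (measurableT_comp (L_meas Tth)).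
  - by move=> w _; apply: lime_ge; [exact: ereal_nondecreasing_is_cvgn|exact: nearW].
  - apply: (@emeasurable_fun_cvg _ _ _ _ (fun k w => (m th k (Z w))%:E)) => // w _.
    exact: ereal_nondecreasing_is_cvgn.
  apply: filterS L_cont => w /(_ 0%N) /= cw _.
  apply/lee_addgt0Pr => e e0; rewrite -leeBlDr// -EFinB.
  apply: lime_ge; first exact: ereal_nondecreasing_is_cvgn.
  have /cvgrPdist_lt /(_ e e0) := (subspace_continuousP _ _).1 cw th Tth.
  move=> /nbhs_ballP [r /= r0 hr].
  near=> k; rewrite lee_fin; apply: le_m => j; rewrite /hk; case: asboolP => [bj|_].
    rewrite le_min; apply/andP; split.
      apply: (@le_trans _ _ (L th (Z w))); first by rewrite gerBl ltW.
      by near: k; exact: nbhs_infty_ger.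
    have : ball th r (q j).
      apply: le_ball bj; rewrite ltW//.
      rewrite invf_plt ?posrE//.
      have : r^-1 < k%:R by near: k; exact: nbhs_infty_gtr.
      by move=> /lt_le_trans; apply; rewrite ler_nat.
    by move=> bq; have /= /ltr_normlW := hr _ bq (Tq j); rewrite ltrBlDr -ltrBlDl => /ltW.
  apply: (@le_trans _ _ (L th (Z w))); first by rewrite gerBl ltW.
  by near: k; exact: nbhs_infty_ger.
move=> /(lt_le_trans xL) xlim.
apply: contrapT => nk.
have : (\int[P]_w (limn (fun k => (m th k (Z w))%:E)) <= x)%E.
  rewrite -(cvg_lim _ cv)//; apply: lime_le; first by apply/cvg_ex; eexists; exact: cv.
  by apply: nearW => k; rewrite leNgt; apply/negP => xk; apply: nk; exists k.
by rewrite leNgt xlim.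
Unshelve. all: by end_near. Qed.

(** The infimum in [m] sees only the points of [q]. Points of [q] inside the ball come arbitrarily
    close to any point of its interior, and continuity carries the bound over. *)
Let m_le_loss (th th' : V) k w : (forall i,
  {within Theta, continuous (fun th => L th (iter i tau (Z w)))}) ->
  Theta th' -> (ball th k.+1%:R^-1)° th' ->
  forall i, m th k (iter i tau (Z w)) <= L th' (iter i tau (Z w)).
Proof.
move=> cw Tth' /nbhs_ballP [r /= r0 hr] i; rewrite leNgt; apply/negP => lt.
have e0 : 0 < m th k (iter i tau (Z w)) - L th' (iter i tau (Z w)) by rewrite subr_gt0.
have /cvgrPdist_lt /(_ _ e0) := (subspace_continuousP _ _).1 (cw i) th' Tth'.
move=> /nbhs_ballP [s /= s0 hs].
have sr0 : 0 < Num.min s r by rewrite lt_min s0.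
have [j bj] := q_dense Tth' sr0.
have bs : ball th' s (q j) by apply: le_ball bj; rewrite ge_min lexx.
have br : ball th' r (q j) by apply: le_ball bj; rewrite ge_min lexx orbT.
have := m_le th k j (iter i tau (Z w)).
rewrite /hk asboolT; last exact: hr.
rewrite le_min => /andP[_].
have /= := hs _ bs (Tq j); rewrite distrC => /ltr_normlW /=;
  rewrite ltrD2r => lt1 /le_lt_trans /(_ lt1); by rewrite ltxx.
Qed.

Lemma wald_separation (th ths : V) : Theta th -> Theta ths ->
  (\int[P]_w (L ths (Z w))%:E < +oo)%E ->
  (\int[P]_w (L ths (Z w))%:E < \int[P]_w (L th (Z w))%:E)%E ->
  exists r c del : R, [/\ 0 < r, 0 < del &
    {ae P, forall w, \forall n \near \oo,
      n%:R^-1 * \sum_(i < n) L ths (iter i tau (Z w)) < c - del /\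
      forall th', Theta th' -> (ball th r)° th' ->
        c + del < n%:R^-1 * \sum_(i < n) L th' (iter i tau (Z w))}].
Proof.
move=> Tth Tths fin lt.
have [k kgt] := integral_m_gt Tth lt.
have Lsfin : (\int[P]_w (L ths (Z w))%:E)%E \is a fin_num.
  by rewrite ge0_fin_numE//; apply: integral_ge0 => w _; rewrite lee_fin.
have mLs : measurable_fun setT (EFin \o (L ths \o Z)).
  by apply/measurable_EFinP; exact: (measurableT_comp (L_meas Tths) mZ).
have iLs : P.-integrable setT (EFin \o (L ths \o Z)).
  apply/integrableP; split => //.
  by under eq_integral do rewrite /= ger0_norm//.
have mm : measurable_fun setT (EFin \o (m th k \o Z)).
  by apply/measurable_EFinP; exact: (measurableT_comp (m_meas th k) mZ).
have im : P.-integrable setT (EFin \o (m th k \o Z)).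
  have ik : P.-integrable setT (EFin \o cst (k%:R : R)).
    by apply: finite_measure_integrable_cst.
  apply: (le_integrable measurableT mm _ ik).
  move=> w _ /=; have /andP[h1 h2] := m_bound th k (Z w).
  by rewrite lee_fin !ger0_norm.
have mfin : (\int[P]_w (m th k (Z w))%:E)%E \is a fin_num.
  exact: (integrable_fin_num measurableT im).
pose a := fine (\int[P]_w (L ths (Z w))%:E)%E.
pose b := fine (\int[P]_w (m th k (Z w))%:E)%E.
have ab : a < b by rewrite -lte_fin !fineK.
(* Both [c - del] and [c + del] lie strictly between the two means, and the gap [2 * del] is
   reserved for the approximation errors at two parameters. *)
pose c := (a + b) / 2; pose del := (b - a) / 4.
have h1 : (\int[P]_w (L ths (Z w))%:E < (c - del)%:E)%E.
  by rewrite -(fineK Lsfin) lte_fin -/a /c /del; lra.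
(* The lower bound on the averages of [m] is obtained as an upper bound on those of [- m]. *)
have h2 : (\int[P]_w (- m th k (Z w))%:E < (- (c + del))%:E)%E.
  under eq_integral do rewrite EFinN.
  rewrite integralN/=; last first.
    apply: fin_num_adde_defl; rewrite fin_numN.
    have := integrable_neg_fin_num measurableT im.
    by [].
  by rewrite -(fineK mfin) -EFinN lte_fin -/b /c /del; lra.
have iN : P.-integrable setT (EFin \o ((fun p => - m th k p) \o Z)).
  exact: (integrableN im).
have mN : measurable_fun setT (fun p => - m th k p) by exact: measurable_funN.
exists k.+1%:R^-1, c, del; split; [by []|by rewrite /del; lra|].
have B1 := birkhoff_process_lt (L_meas Tths) iLs h1.
have B2 := birkhoff_process_lt mN iN h2.
apply: filterS3 L_cont B1 B2 => w cw b1 b2.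
near=> n; split; first by near: n.
move=> th' Tth' bth'.
have : n%:R^-1 * (\sum_(i < n) - m th k (iter i tau (Z w))) < - (c + del) by near: n.
rewrite sumrN mulrN ltrN2 => /lt_le_trans; apply.
rewrite ler_wpM2l ?invr_ge0//; apply: ler_sum => i _.
exact: m_le_loss.
Unshelve. all: by end_near. Qed.
End stationary.

(** * Consistency *)

Section path_space.
Set Implicit Arguments.
Unset Strict Implicit.
Context {R : realType} {d dx : nat} {d0 : measure_display} {Omega : measurableType d0}.
Variables (Theta : set 'rV[R]_d) (f : model R d dx) (g : nat -> R -> R) (eta : R -> R)
  (Y : int -> Omega -> nat) (X : int -> Omega -> 'rV[R]_dx) (alpha cl ceta : R).
Hypothesis f_meas : forall th, Theta th -> forall B : set R, measurable B ->
  @arg_sigma R dx ((fun p => f th p.1 p.2) @^-1` B).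
Hypothesis Y_meas : forall t y, measurable (Y t @^-1` [set y]).
Hypothesis X_meas : forall t (i : 'I_dx), measurable_fun setT (fun w => X t w 0 i).
Hypothesis f_ge : forall th y x, Theta th -> cl <= f th y x.
Hypothesis ceta_gt0 : 0 < ceta.
Hypothesis eta_lip : forall l l', cl <= l -> cl <= l' ->
  `|eta l - eta l'| <= ceta * `|l - l'|.
Hypothesis alpha_ge0 : 0 <= alpha.
Hypothesis g_ge0 : forall e y, 0 <= g y e.
Hypothesis g_sum1 : forall e, (\sum_(y <oo) (g y e)%:E)%E = 1%E.
Hypothesis g_derivable : forall y e, derivable (g y) e 1.

Definition path_gen : set (set (Defs.path R dx)) :=
  [set A | exists t : int,
        (exists y : nat, A = [set p : Defs.path R dx | (p t).1.1 = y]) \/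
        (exists B : set R, measurable B /\ A = [set p : Defs.path R dx | B (p t).1.2]) \/
        (exists (i : 'I_dx) (B : set R), measurable B /\
             A = [set p : Defs.path R dx | B ((p t).2 0 i)])].

Let PT := g_sigma_algebraType path_gen.

Let path_gen_measurable A : path_gen A -> measurable (A : set PT).
Proof. by move=> GA; apply: sub_gen_smallest. Qed.

Lemma procZ_measurable th : Theta th ->
  @measurable_fun _ _ Omega (g_sigma_algebraType path_gen) setT (procZ f Y X th).
Proof.
move=> Tth; apply: (@measurability _ _ Omega PT setT _ path_gen) => //.
move=> _ [A [t [[y ->]|[[B [mB ->]]|[i [B [mB ->]]]]]] <-]; rewrite setTI.
- exact: Y_meas.
- have mlam := lam_measurable f_meas Y_meas X_meas t Tth.
  by have := mlam measurableT B mB; rewrite setTI.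
- by have := X_meas t i measurableT mB; rewrite setTI.
Qed.

Lemma pshift_measurable :
  @measurable_fun _ _ (g_sigma_algebraType path_gen) (g_sigma_algebraType path_gen)
    setT (@pshift R dx).
Proof.
apply: (@measurability _ _ PT PT setT _ path_gen) => //.
move=> _ [A [t [[y ->]|[[B [mB ->]]|[i [B [mB ->]]]]]] <-]; rewrite setTI;
  apply: path_gen_measurable; exists (t + 1).
- by left; exists y.
- by right; left; exists B.
- by right; right; exists i, B.
Qed.

(* The loss at time [1], shifted to make it nonnegative; the shift is [1] when
   [alpha = 0], since [0^-1 = 0]. *)
Definition path_loss (th : 'rV[R]_d) (p : g_sigma_algebraType path_gen) : R :=
  dpd_loss g alpha (eta (f th (fun k => (p (1 - k.+1%:Z)).1.1)
    (fun k => (p (1 - k.+1%:Z)).2))) (p 1).1.1 + (1 + alpha^-1).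

Lemma path_loss_ge0 th p : 0 <= path_loss th p.
Proof.
rewrite /path_loss -lerBlDr sub0r.
exact: dpd_loss_ge.
Qed.

Lemma path_loss_measurable th : Theta th -> measurable_fun setT (path_loss th).
Proof.
move=> Tth; apply: measurable_funD => //.
apply: (measurable_fun_nat_family (N := fun p : PT => (p 1).1.1)
  (h := fun n (p : PT) => dpd_loss g alpha (eta (f th (fun k => (p (1 - k.+1%:Z)).1.1)
    (fun k => (p (1 - k.+1%:Z)).2))) n)) => n.
  by apply: path_gen_measurable; exists 1; left; exists n.
apply: (measurableT_comp (dpd_loss_measurable alpha_ge0 g_ge0 g_sum1 g_derivable n)).
apply: (link_comp_measurable ceta_gt0 eta_lip); last by move=> p; exact: f_ge.
apply: measurable_model; first exact: f_meas.
- by move=> k y; apply: path_gen_measurable; exists (1 - k.+1%:Z); left; exists y.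
- move=> k i _ B mB; rewrite setTI; apply: path_gen_measurable.
  by exists (1 - k.+1%:Z); right; right; exists i, B.
Qed.

(** [path_loss] looks at time [1], so [i] shifts lead to time [i + 1], in line with criteria that
    sum from time [1]. The path is formed with [ths], but only its [Y] and [X] coordinates are read,
    which leaves [th] free. *)
Lemma path_loss_iter ths th i w :
  path_loss th (iter i (@pshift R dx) (procZ f Y X ths w)) =
  dpd_loss g alpha (eta (lam f Y X th i.+1%:Z w)) (Y i.+1%:Z w) + (1 + alpha^-1).
Proof.
have it (p : Defs.path R dx) t : iter i (@pshift R dx) p t = p (t + i%:Z).
  elim: i t => [|i IH] t; first by rewrite addr0.
  by rewrite iterS /pshift IH intS addrA.
have idx k : 1 - k.+1%:Z + i%:Z = i.+1%:Z - k.+1%:Z by rewrite intS addrAC.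
have eY : (fun k => (iter i (@pshift R dx) (procZ f Y X ths w) (1 - k.+1%:Z)).1.1)
    = pastY Y i.+1%:Z w by apply/funext => k; rewrite it idx.
have eX : (fun k => (iter i (@pshift R dx) (procZ f Y X ths w) (1 - k.+1%:Z)).2)
    = pastX X i.+1%:Z w by apply/funext => k; rewrite it idx.
by rewrite /path_loss eY eX it -intS.
Qed.

End path_space.

(** A finite cover calls for this twice: once for almost sure statements, once for eventual ones. *)
Lemma filter_seq_forall {T : Type} {I : eqType} (F : set_system T) {FF : Filter F}
    (s : seq I) (Q : I -> set T) :
  (forall x, x \in s -> F (Q x)) -> F [set t | forall x, x \in s -> Q x t].
Proof.
elim: s => [_|x s IH H]; first by apply: nearW.
have H1 : F (Q x) by apply: H; rewrite inE eqxx.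
have H2 : F [set t | forall x, x \in s -> Q x t].
  by apply: IH => y ys; apply: H; rewrite inE ys orbT.
apply: filterS2 H1 H2 => t Qx Qs y; rewrite inE => /predU1P[->//|]; exact: Qs.
Qed.

Theorem theorem2p1
  (R : realType) (d dx : nat) (d0 : measure_display) (Omega : measurableType d0)
  (P : probability Omega R)
  (Theta : set 'rV[R]_d) (f : model R d dx) (g : nat -> R -> R) (eta : R -> R)
  (thetas : 'rV[R]_d)
  (Y : int -> Omega -> nat) (X : int -> Omega -> 'rV[R]_dx)
  (alpha : R) (alpha0 : nat -> R) (cl ceta : R) (phibar psibar : nat -> R)
  (thetahat : nat -> Omega -> 'rV[R]_d) :
  (* tuning parameter *)
  0 <= alpha ->
  (* parameter space: compact, containing the true parameter *)
  compact Theta -> Theta thetas ->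
  (* f_theta is a measurable function on N_0^N x (R^dx)^N *)
  (forall th, Theta th -> forall B : set R, measurable B ->
     @arg_sigma R dx ((fun p => f th p.1 p.2) @^-1` B)) ->
  (* g(. | eta) is a probability mass function on N_0 *)
  (forall e y, 0 <= g y e) ->
  (forall e, (\sum_(y <oo) (g y e)%:E)%E = 1%E) ->
  (* measurability of the observed process *)
  (forall t y, measurable (Y t @^-1` [set y])) ->
  (forall t (i : 'I_dx), measurable_fun setT (fun w => X t w 0 i)) ->
  (* conditionally on F_{t-1}, Y_t has pmf g(. | eta(lambda_t(theta_star))) *)
  (forall (t : int) (A : set Omega), past_sigma Y X t A -> forall y : nat,
     P (A `&` Y t @^-1` [set y])
     = (\int[P]_(w in A) (g y (eta (lam f Y X thetas t w)))%:E)%E) ->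
  (* E(Y_t | F_{t-1}) = lambda_t(theta_star) *)
  (forall (t : int) (A : set Omega), past_sigma Y X t A ->
     (\int[P]_(w in A) ((Y t w)%:R)%:E
      = \int[P]_(w in A) (lam f Y X thetas t w)%:E)%E) ->
  (* the support of g(. | eta_t(theta)) does not depend on theta *)
  (forall t th th' w y, Theta th -> Theta th' ->
     (0 < g y (eta (lam f Y X th t w))) = (0 < g y (eta (lam f Y X th' t w)))) ->
  (* (Y_t, lambda_t, X_t) is stationary and ergodic *)
  (forall B, @path_sigma R dx B ->
     P (procZ f Y X thetas @^-1` ((@pshift R dx) @^-1` B))
     = P (procZ f Y X thetas @^-1` B)) ->
  (forall B, @path_sigma R dx B -> (@pshift R dx) @^-1` B = B ->
     P (procZ f Y X thetas @^-1` B) = 0%E \/ P (procZ f Y X thetas @^-1` B) = 1%E) ->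
  (* condition A_0(Theta); alpha0 k stands for alpha^{(0)}_{k+1} *)
  (forall y x, {within Theta, continuous (fun th => f th y x)}) ->
  (exists M : R, forall th, Theta th -> `|f th (fun=> 0%N) (fun=> 0)| <= M) ->
  (forall k, 0 <= alpha0 k) ->
  (\sum_(k <oo) (alpha0 k)%:E < 1)%E ->
  (forall y x y' x' th, Theta th ->
     (`|f th y x - f th y' x'|%:E
      <= \sum_(k <oo) (alpha0 k * (`|(y k)%:R - (y' k)%:R| + `|x k - x' k|))%:E)%E) ->
  (* (A0) *)
  (forall th th', Theta th -> Theta th' ->
     (exists t : int, {ae P, forall w, lam f Y X th t w = lam f Y X th' t w}) ->
     th = th') ->
  0 < cl ->
  (forall th y x, Theta th -> cl <= f th y x) ->
  (* (A1) *)
  interior Theta thetas ->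
  (* (A2) *)
  (exists lb : R, forall t : int, 0 < t ->
     (\int[P]_w (supTheta Theta (fun th => (`|lam f Y X th t w|)%:E) ^+ 4)
      = lb%:E)%E) ->
  (* (A3) *)
  (forall y, (forall e, derivable (g y) e 1) /\
             (forall e, derivable (derive1 (g y)) e 1) /\
             continuous (derive1n 2 (g y))) ->
  (forall e e', (forall y, g y e = g y e') -> e = e') ->
  (* (A4) *)
  (forall e, (phi_g g e < +oo)%E) ->
  (forall t : nat, (0 < t)%N -> 0 < phibar t /\
     forall delta : R, 0 <= delta <= 1 ->
       (\int[P]_w (supTheta Theta (fun th =>
          phi_g g (delta * eta (lam f Y X th t%:Z w)
                   + (1 - delta) * eta (lamhat f Y X th t w))) ^+ 2)
        <= (phibar t ^+ 2)%:E)%E) ->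
  (* (A5) *)
  (forall t : nat, (0 < t)%N -> {ae P, forall w, forall e, g (Y t%:Z w) e != 0}) ->
  (forall t : nat, (0 < t)%N -> 0 < psibar t /\
     forall delta : R, 0 <= delta <= 1 ->
       (\int[P]_w (supTheta Theta (fun th =>
          (psi_g g (Y t%:Z w) (delta * eta (lam f Y X th t%:Z w)
                   + (1 - delta) * eta (lamhat f Y X th t w)))%:E) ^+ 2)
        <= (psibar t ^+ 2)%:E)%E) ->
  (* (A6) *)
  0 < ceta ->
  (forall l l', cl <= l -> cl <= l' -> `|eta l - eta l'| <= ceta * `|l - l'|) ->
  (forall l l', cl <= l -> cl <= l' -> eta l = eta l' -> l = l') ->
  (* moment condition (M) with some epsilon > 2 *)
  (exists eps : R, 2 < eps /\ exists C : R, forall t : int,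
     (\int[P]_w ((Num.max (Num.max (Y t w)%:R `|lam f Y X thetas t w|) `|X t w|)
                   `^ (1 + eps))%:E < C%:E)%E) ->
  (* decay of the Lipschitz coefficients and summability *)
  (exists gamma : R, 1 < gamma /\
     (exists C : R, \forall k \near \oo, alpha0 k <= C * ((k.+1)%:R `^ (- gamma))) /\
     (\sum_(k <oo) (((k.+1)%:R `^ (- gamma)) * Num.max (phibar k.+1) (psibar k.+1))%:E
        < +oo)%E) ->
  (* thetahat n is a minimiser of hat H_{alpha,n} over Theta *)
  (forall n w, (0 < n)%N -> Theta (thetahat n w) /\
     forall th, Theta th ->
       Hhat f g eta alpha Y X n (thetahat n w) w <= Hhat f g eta alpha Y X n th w) ->
  (* strong consistency *)
  {ae P, forall w, thetahat n w @[n --> \oo] --> thetas}.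

Proof.
move=> alpha_ge0 cTheta Tthetas f_meas g_ge0 g_sum1 Y_meas X_meas Y_pmf _ support
  stationary ergodic f_cont _ alpha0_ge0 alpha0_sum f_lip identifiable cl_gt0 f_ge _ _
  g_smooth g_inj _ phi_bound g_neq0 psi_bound ceta_gt0 eta_lip eta_inj
  [eps [eps2 [C0 moment]]] [gamma [gamma_gt1 [[C alpha0_decay] weights_sum]]] argmin.
have g_derivable y e : derivable (g y) e 1 by exact: (g_smooth y).1.
have g_C1 y : continuous (derive1 (g y)).
  move=> e; apply/differentiable_continuous/derivable1_diffP.
  exact: (g_smooth y).2.1.
have [q [Tq q_dense]] := compact_dense_sequence cTheta Tthetas.
have V_meas t : measurable_fun setT (fun w => (Y t w)%:R + `|X t w|).
  apply: measurable_funD; last exact: measurable_rV_norm.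
  apply: (@measurable_fun_nat_family _ _ (Y t) _ R (fun n _ => n%:R)) => n.
    exact: Y_meas.
  exact: measurable_cst.
have U_moment t : (\int[P]_w (((Y t w)%:R + `|X t w|) ^+ 2)%:E <= (4 * (1 + C0))%:E)%E.
  apply: (square_moment_bound eps2 (V_meas t) _ (moment t)) => w.
  rewrite addr_ge0//=; set a := Num.max _ _.
  have h1 : (Y t w)%:R <= a by rewrite /a !le_max lexx.
  have h2 : `|X t w| <= a by rewrite /a !le_max lexx !orbT.
  lra.
have avg := loss_error_average_cvg0 alpha_ge0 f_meas g_ge0 g_sum1 g_derivable g_C1
  Y_meas X_meas f_cont alpha0_ge0 alpha0_sum f_lip f_ge ceta_gt0 eta_lip Tq q_dense
  U_moment phi_bound psi_bound g_neq0 gamma_gt1 alpha0_decay weights_sum.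
(* From [y <= 1 + (y + x)^2]; the entropy bound for [alpha = 0] rests on this finite mean. *)
have N_mean : (\int[P]_w ((Y 1%:Z w)%:R)%:E < +oo)%E.
  apply: (@le_lt_trans _ _
    (\int[P]_w (1 + (((Y 1%:Z w)%:R + `|X 1%:Z w|) ^+ 2)%:E))%E).
    apply: ge0_le_lower_integral => w; first by rewrite lee_fin.
    rewrite -EFinD lee_fin.
    have := normr_ge0 (X 1%:Z w); have := ler0n R (Y 1%:Z w); nra.
  have mV2 : measurable_fun setT (fun w => (((Y 1%:Z w)%:R + `|X 1%:Z w|) ^+ 2)%:E).
    by apply/measurable_EFinP; exact: measurable_funX.
  rewrite (ge0_integralD P measurableT (fun _ _ => lee01) (measurable_cst _)
    _ mV2); last by move=> w _; rewrite lee_fin sqr_ge0.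
  rewrite integral_cst//= probability_setT mule1.
  by rewrite lte_add_pinfty ?ltry// (le_lt_trans (U_moment 1%:Z))// ltry.
pose Z : Omega -> g_sigma_algebraType (@path_gen R dx) := procZ f Y X thetas.
pose L := @path_loss R d dx f g eta alpha.
pose c0 := 1 + alpha^-1.
have LE th i w : L th (iter i (@pshift R dx) (Z w)) =
    dpd_loss g alpha (eta (lam f Y X th i.+1%:Z w)) (Y i.+1%:Z w) + c0.
  exact: path_loss_iter.
have L_cont : {ae P, forall w, forall i,
    {within Theta, continuous (fun th => L th (iter i (@pshift R dx) (Z w)))}}.
  have aeg : {ae P, forall w, forall n, forall e, g (Y n.+1%:Z w) e != 0}.
    by apply: ae_foralln => n; exact: g_neq0.
  apply: filterS aeg => w gw i.
  rewrite (_ : (fun th => _) = (fun th =>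
    dpd_loss g alpha (eta (lam f Y X th i.+1%:Z w)) (Y i.+1%:Z w) + c0)); last first.
    by apply/funext => th; exact: LE.
  have cl1 := @loss_continuous_in_parameter _ _ _ _ f g eta alpha cl ceta alpha_ge0
    g_ge0 g_sum1 g_derivable f_cont f_ge ceta_gt0 eta_lip (Y i.+1%:Z w)
    (pastY Y i.+1%:Z w) (pastX X i.+1%:Z w) (gw i).
  by move=> th; apply: cvgD; [exact: (cl1 th)|exact: cvg_cst].
have local th : Theta th -> th != thetas -> exists2 r : R, 0 < r &
    {ae P, forall w, \forall n \near \oo, forall th', Theta th' -> (ball th r)° th' ->
      Hhat f g eta alpha Y X n thetas w < Hhat f g eta alpha Y X n th' w}.
  move=> Tth thne.
  have mpar th1 : Theta th1 ->
      measurable_fun (setT : set (g_sigma_algebraType (past_gen Y X 1%:Z)))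
        (fun w => eta (lam f Y X th1 1%:Z w)).
    move=> Tth1; apply: (link_comp_measurable ceta_gt0 eta_lip).
      exact: (lam_past_measurable f_meas).
    by move=> w; exact: f_ge.
  have fin := integral_shifted_loss_lty alpha_ge0 g_ge0 g_sum1 g_derivable
    (@past_gen_measurable _ _ _ _ Y X Y_meas X_meas 1%:Z) (Y_meas 1%:Z)
    (mpar _ Tthetas) (Y_pmf 1%:Z) (g_neq0 1%N isT) N_mean.
  (* The mass function determines the natural parameter, the natural parameter determines the
     conditional mean, and the conditional mean determines [th]. *)
  have ne : ~ {ae P, forall w, forall y, g y (eta (lam f Y X th 1%:Z w)) =
      g y (eta (lam f Y X thetas 1%:Z w))}.
    move=> aeq; move/eqP : thne; apply; apply: (identifiable _ _ Tth Tthetas).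
    exists 1%:Z; apply: filterS aeq => w gw.
    by apply: eta_inj; [exact: f_ge|exact: f_ge|exact: g_inj].
  have lt := integral_shifted_loss_lt alpha_ge0 g_ge0 g_sum1 g_derivable
    (@past_gen_measurable _ _ _ _ Y X Y_meas X_meas 1%:Z) (Y_meas 1%:Z)
    (mpar _ Tthetas) (Y_pmf 1%:Z) (g_neq0 1%N isT) N_mean (mpar _ Tth)
    (fun w y => support 1%:Z th thetas w y Tth Tthetas) ne.
  have fin' : (\int[P]_w (L thetas (Z w))%:E < +oo)%E.
    by under eq_integral do rewrite (LE thetas 0%N).
  have lt' : (\int[P]_w (L thetas (Z w))%:E < \int[P]_w (L th (Z w))%:E)%E.
    under eq_integral do rewrite (LE thetas 0%N).
    by under [ltRHS]eq_integral do rewrite (LE th 0%N).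
  have L_meas th1 : Theta th1 -> measurable_fun setT (L th1).
    move=> Tth1; exact: (path_loss_measurable f_meas f_ge ceta_gt0 eta_lip alpha_ge0
      g_ge0 g_sum1 g_derivable Tth1).
  have L_ge0 th1 p : 0 <= L th1 p by exact: path_loss_ge0.
  have mZ := procZ_measurable f_meas Y_meas X_meas Tthetas.
  have [r [c [del [r0 del0 sep]]]] := wald_separation (Z := Z) (L := L) mZ
    (@pshift_measurable R dx) stationary ergodic Tq q_dense L_ge0 L_meas L_cont
    Tth Tthetas fin' lt'.
  exists r => //; apply: filterS2 avg sep => w [D [Dle D0]] sepw.
  have Dsmall : \forall n \near \oo, n%:R^-1 * \sum_(0 <= i < n) D i < del.
    have /cvgrPdist_lt /(_ del del0) := D0; apply: filterS => n.
    by rewrite sub0r normrN => /(le_lt_trans (ler_norm _)).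
  have n_gt0 : \forall n \near \oo, (0 < n)%N by exists 1%N.
  apply: filterS3 sepw Dsmall n_gt0 => n [s1 s2] Dn n0 th' Tth' bth'.
  have {s2} := s2 th' Tth' bth'.
  have nR0 : 0 < n%:R :> R by rewrite ltr0n.
  have HE th1 : Hhat f g eta alpha Y X n th1 w = n%:R^-1 * \sum_(i < n)
      dpd_loss g alpha (eta (lamhat f Y X th1 i.+1 w)) (Y i.+1%:Z w).
    by rewrite /Hhat big_add1/= big_mkord.
  have LS th1 : n%:R^-1 * \sum_(i < n) L th1 (iter i (@pshift R dx) (Z w)) =
      n%:R^-1 * (\sum_(i < n)
        dpd_loss g alpha (eta (lam f Y X th1 i.+1%:Z w)) (Y i.+1%:Z w)) + c0.
    under eq_bigr do rewrite LE.
    rewrite big_split/= sumr_const card_ord mulrDr -[c0 *+ n]mulr_natl.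
    by rewrite mulKf// gt_eqF.
  (* The averages from the infinite past differ by more than [2 * del]; an error below [del] at each
     of the two parameters preserves the order. The shift [c0] occurs on both sides and cancels. *)
  have err th1 : Theta th1 ->
      `|n%:R^-1 * (\sum_(i < n)
          dpd_loss g alpha (eta (lam f Y X th1 i.+1%:Z w)) (Y i.+1%:Z w))
        - Hhat f g eta alpha Y X n th1 w| < del.
    move=> Tth1; apply: le_lt_trans Dn.
    rewrite HE -mulrBr -sumrB normrM ger0_norm ?invr_ge0 ?ler0n//.
    rewrite ler_wpM2l ?invr_ge0 ?ler0n// big_mkord.
    apply: le_trans (ler_norm_sum _ _ _) _; apply: ler_sum => i _.
    exact: Dle.
  move: s1; rewrite !LS.
  have := err _ Tth'; have := err _ Tthetas.
  rewrite !ltr_norml => /andP[a1 a2] /andP[a3 a4] a5 a6; lra.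
(* The radii [1 / (k + 1)] are enough for convergence and countable in number, so one null set
   serves them all. *)
have near_ball (k : nat) : {ae P, forall w, \forall n \near \oo,
    ball thetas k.+1%:R^-1 (thetahat n w)}.
  pose K := Theta `&` ~` (ball thetas k.+1%:R^-1)°.
  have cK : compact K.
    rewrite /K; apply: compact_closedI => //.
    by apply: open_closedC; exact: open_interior.
  have [r Hr] : exists r : 'rV[R]_d -> R, forall th, K th -> 0 < r th /\
     {ae P, forall w, \forall n \near \oo, forall th', Theta th' -> (ball th (r th))° th' ->
      Hhat f g eta alpha Y X n thetas w < Hhat f g eta alpha Y X n th' w}.
    have h th : exists r : R, K th -> 0 < r /\
     {ae P, forall w, \forall n \near \oo, forall th', Theta th' -> (ball th r)° th' ->
      Hhat f g eta alpha Y X n thetas w < Hhat f g eta alpha Y X n th' w}.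
      have [[Tth nb]|nK] := pselect (K th); last by exists 0.
      have [|r r0 hr] := local th Tth; last by exists r.
      apply/eqP => tt; apply: nb; rewrite tt; apply: nbhsx_ballx.
      by rewrite invr_gt0.
    by have [r hr] := choice h; exists r.
  move: cK; rewrite compact_cover => /(_ _ K (fun th => (ball th (r th))°)) [].
  - by move=> th _; exact: open_interior.
  - by move=> th Kth; exists th => //; apply: nbhsx_ballx; have [] := Hr th Kth.
  move=> s sK Kcov.
  have aes : {ae P, forall w, forall th, th \in (s : seq _) ->
      \forall n \near \oo, forall th', Theta th' -> (ball th (r th))° th' ->
      Hhat f g eta alpha Y X n thetas w < Hhat f g eta alpha Y X n th' w}.
    apply: filter_seq_forall => th ths.
    have : K th by have := sK th ths; rewrite inE.
    by move=> /Hr [].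
  apply: filterS aes => w /filter_seq_forall ws.
  have n_gt0 : \forall n \near \oo, (0 < n)%N by exists 1%N.
  apply: filterS2 ws n_gt0 => n sep n0.
  have [Tn mn] := argmin n w n0.
  apply: contrapT => nb.
  (* Otherwise the minimiser lies in a ball of the cover, where the criterion exceeds its value at
     the true parameter. The separation is uniform over the ball and therefore applies to this
     random point. *)
  have [th /= ths thb] : cover [set` s] (fun th => (ball th (r th))°) (thetahat n w).
    by apply: Kcov; split => // /interior_subset.
  by have := sep th ths _ Tn thb; rewrite ltNge mn.
have := ae_foralln near_ball; apply: filterS => w nw.
apply/cvg_ballP => e e0.
have [k ke] : exists k : nat, (k.+1%:R^-1 : R) < e.
  by have [//|k] := @ltr_add_invr R 0 e _; rewrite add0r => ?; exists k.
by apply: filterS (nw k) => n; apply: le_ball; exact: ltW.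
Qed.
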